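(* The curvature $$\mathcal F:\widetilde{\mathcal A}(\mathbf a)\longrightarrow\mathrm{Lie}(\mathcal G_1)^*,\qquad\mathcal F(\alpha)=-d\alpha+\alpha\wedge\alpha,\qquad \langle\mathcal F(\alpha),x\rangle=\frac1{2\pi\sqrt{-1}}\int_{\mathbb P^1}\mathrm{Tr}(\mathcal F(\alpha)x),$$ is an equivariant moment map for the $\mathcal G_1$ action by gauge transformations on the extended space $\widetilde{\mathcal A}(\mathbf a)$ of singular connections.
   Context: Data $\mathbf a$: an effective divisor $D=\sum_{i=1}^mk_i(a_i)$ on $\mathbb P^1$, with coordinates $z_i$ vanishing at $a_i$ on disjoint discs $D_i\ni a_i$, and germs $d-{}^i\!A^0$ at $a_i$ of diagonal meromorphic connections of rank $n$ with pole of order $k_i$, generic (leading coefficient with distinct eigenvalues if $k_i\ge2$, eigenvalues distinct mod $\mathbb Z$ if $k_i=1$). Write ${}^i\!\Lambda^0=\mathrm{Res}({}^i\!A^0)$; $\mathfrak t$ is the set of diagonal $n\times n$ matrices and $\mathfrak t'\subset\mathfrak t$ those with eigenvalues distinct mod $\mathbb Z$. A $C^\infty$ singular one-form with poles on $D$ is one which near $a_i$ is $z_i^{-k_i}$ times a smooth one-form. $L_i$ denotes the $C^\infty$ Laurent (or Taylor) expansion at $a_i$ in $z_i,\bar z_i$. $\widetilde{\mathcal A}(\mathbf a)$ is the set of connections $d-\alpha$ on the trivial rank $n$ bundle $E$ on $\mathbb P^1$, $\alpha$ an $n\times n$ matrix of $C^\infty$ one-forms with poles on $D$, such that for each $i$,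 $L_i(\alpha)={}^i\!A^0+({}^i\!\Lambda-{}^i\!\Lambda^0)dz_i/z_i$ for some ${}^i\!\Lambda\in\mathfrak t$ (in $\mathfrak t'$ if $k_i=1$). It is a complex Fréchet manifold with tangent space $\{\phi\in\Omega^1[D](\mathbb P^1,\mathrm{End}(E)):L_i(\phi)\in\mathfrak t\,dz_i/z_i\ \forall i\}$ at every point and symplectic form $\omega_\alpha(\phi,\psi)=\frac1{2\pi\sqrt{-1}}\int_{\mathbb P^1}\mathrm{Tr}(\phi\wedge\psi)$ (the integrand is non-singular). For $\alpha\in\widetilde{\mathcal A}(\mathbf a)$, $\mathcal F(\alpha)$ is a matrix of non-singular two-forms. $\mathcal G_1$ is the Fréchet Lie group of $g\in GL_n(C^\infty(\mathbb P^1))$ with Taylor expansion $1$ at each $a_i$, acting by $g[\alpha]=g\alpha g^{-1}+(dg)g^{-1}$; $\mathrm{Lie}(\mathcal G_1)=\{x\in C^\infty(\mathbb P^1,\mathfrak{gl}_n(\mathbb C)):L_i(x)=0\ \forall i\}$. Conventions: the fundamental vector field of $x$ is minus the tangent to the flow of $\exp(tx)$, i.e. $-d_\alpha x$ at $\alpha$, where $d_\alpha$ is the singular connection on $\mathrm{End}(E)$ induced from $d-\alpha$; a moment map $\mu$ satisfies $d\langle\mu,x\rangle_\alpha=\omega_\alpha(\,\cdot\,,-d_\alpha x)$; equivariance is with respect to the coadjoint action. *)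

(* Defs.v *)
From HB Require Import structures.
From mathcomp Require Import all_boot all_order all_algebra.
From mathcomp Require Import complex.
From mathcomp Require Import all_classical all_reals all_analysis.

Set Implicit Arguments.
Unset Strict Implicit.
Unset Printing Implicit Defensive.

Import Order.TTheory GRing.Theory Num.Theory.
Import numFieldNormedType.Exports.

Local Open Scope classical_set_scope.
Local Open Scope ring_scope.
Local Open Scope complex_scope.

Section SmoothPlane.
Context {R : realType}.
Local Notation C := R[i].
Implicit Types (F : R * R -> R) (f : C -> C) (U : set C).

Definition cnorm (z : C) : R := ComplexField.Normc.normc z.

Definition disc (z : C) (r : R) : set C := [set w | cnorm (w - z) < r].

Definition dir (b : bool) : R * R := if b then (0, 1) else (1, 0).

(* Iterated real partial derivatives: [false] is d/dx, [true] is d/dy. *)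
Definition partials (l : seq bool) F : R * R -> R :=
  foldr (fun b G p => 'D_(dir b) G p) F l.

Definition rsmooth_on (U : set (R * R)) F : Prop :=
  forall l p, U p ->
    {for p, continuous (partials l F)} /\
    forall b, derivable (partials l F) p (dir b).

Definition toC (p : R * R) : C := p.1 +i* p.2.
Definition ofC (z : C) : R * R := (complex.Re z, complex.Im z).

Definition rpart f : R * R -> R := fun p => complex.Re (f (toC p)).
Definition ipart f : R * R -> R := fun p => complex.Im (f (toC p)).

(* C^oo in the real sense on an open set U. *)
Definition csmooth_on U f : Prop :=
  rsmooth_on (toC @^-1` U) (rpart f) /\ rsmooth_on (toC @^-1` U) (ipart f).

Definition cpartials (l : seq bool) f : C -> C :=
  fun z => partials l (rpart f) (ofC z) +i* partials l (ipart f) (ofC z).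

(* Wirtinger derivatives d/dz and d/d(conj z). *)
Definition del f : C -> C :=
  fun z => (cpartials [:: false] f z - 'i * cpartials [:: true] f z) / 2.
Definition delbar f : C -> C :=
  fun z => (cpartials [:: false] f z + 'i * cpartials [:: true] f z) / 2.

Definition holo_on U f : Prop :=
  csmooth_on U f /\ forall z, U z -> delbar f z = 0.

Section Matrix.
Context {n : nat}.
Local Notation M := 'M[C]_n.
Implicit Types (h : C -> M).

Definition mxsmooth_on U h : Prop :=
  forall i j, csmooth_on U (fun z => h z i j).
Definition mxpartials (l : seq bool) h : C -> M :=
  fun z => \matrix_(i, j) cpartials l (fun w => h w i j) z.
Definition mxdel h : C -> M :=
  fun z => \matrix_(i, j) del (fun w => h w i j) z.
Definition mxdelbar h : C -> M :=
  fun z => \matrix_(i, j) delbar (fun w => h w i j) z.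

(* Coefficient of z^p (conj z)^q in the C^oo Taylor expansion at 0. *)
Definition taylor h (p q : nat) : M :=
  ((p`! * q`!)%:R)^-1 *: iter p mxdel (iter q mxdelbar h) 0.

(* Formal series in z, conj z with finitely many negative powers of z;
   [l j q] is the coefficient of z^j (conj z)^q. *)
Definition formal_laurent := int -> nat -> M.

(* Near 0, h = z^-k s with s smooth, and z^-k times the Taylor series of s is l.
   Since 0^-1 = 0, a function with a pole (k > 0) takes the value 0 at 0. *)
Definition laurent_expansion (k : nat) h (l : formal_laurent) : Prop :=
  exists r : R, 0 < r /\ exists s : C -> M,
    [/\ mxsmooth_on (disc 0 r) s,
        forall z, disc 0 r z -> h z = z ^- k *: s z
      & forall (j : int) (q : nat),
          l j q = if j + k%:Z is Posz p then taylor s p q else 0].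

End Matrix.
End SmoothPlane.

(* The Riemann sphere; [None] is the point at infinity. *)
Definition P1 (R : realType) : Type := option R[i].

Section Sphere.
Context {R : realType}.
Local Notation C := R[i].

(* The two affine charts, and the standard local parametrizations inverse to
   them. *)
Definition aff0 (p : P1 R) : C := if p is Some z then z else 0.
Definition affoo (p : P1 R) : C := if p is Some z then z^-1 else 0.
Definition par0 : C -> P1 R := fun z => Some z.
Definition paroo : C -> P1 R := fun w => if w == 0 then None else Some w^-1.

Definition stdpar (b : bool) : C -> P1 R := if b then paroo else par0.

(* For each point of the sphere: the chart and the parameter describing it. *)
Definition at_oo (p : P1 R) : bool := if p is Some _ then false else true.
Definition stdcoord (p : P1 R) : C := if p is Some z then z else 0.

Definition holoP1_on (U : set C) (c : C -> P1 R) : Prop :=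
  forall u, U u -> exists e : R, 0 < e /\
    ((forall v, disc u e v -> c v <> None) /\ holo_on (disc u e) (aff0 \o c)
  \/ (forall v, disc u e v -> c v <> Some 0) /\ holo_on (disc u e) (affoo \o c)).

(* Derivative of a holomorphic c, read in the affine coordinate z at finite
   points of the sphere and in w = 1/z at infinity. *)
Definition dparam (c : C -> P1 R) (u : C) : C :=
  if c u is Some _ then del (aff0 \o c) u else del (affoo \o c) u.

Section Forms.
Context {n : nat}.
Local Notation M := 'M[C]_n.

Definition mxfun := P1 R -> M.

(* A matrix of one-forms A dz + B d(conj z) (A dw + B d(conj w), with w = 1/z,
   at infinity) is given by the pair (A, B); a matrix of two-forms by its
   coefficient of dz /\ d(conj z) (resp. dw /\ d(conj w)). *)
Definition form1 := P1 R -> M * M.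
Definition form2 := P1 R -> M.

(* Coefficients of du and d(conj u) in the pull-back of a one-form by c. *)
Definition pull (c : C -> P1 R) (phi : form1) : C -> M * M :=
  fun u => (dparam c u *: (phi (c u)).1, (dparam c u)^* *: (phi (c u)).2).
Definition pull10 c (phi : form1) : C -> M := fun u => (pull c phi u).1.
Definition pull01 c (phi : form1) : C -> M := fun u => (pull c phi u).2.

Definition smooth_P1 (f : mxfun) : Prop :=
  forall b, mxsmooth_on setT (f \o stdpar b).

Definition dfun (f : mxfun) : form1 := fun p =>
  (mxdel (f \o stdpar (at_oo p)) (stdcoord p),
   mxdelbar (f \o stdpar (at_oo p)) (stdcoord p)).

Definition dform (phi : form1) : form2 := fun p =>
  mxdel (pull01 (stdpar (at_oo p)) phi) (stdcoord p)
  - mxdelbar (pull10 (stdpar (at_oo p)) phi) (stdcoord p).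

Definition wedge (phi psi : form1) : form2 := fun p =>
  (phi p).1 *m (psi p).2 - (phi p).2 *m (psi p).1.

Definition lmulf (f : mxfun) (phi : form1) : form1 :=
  fun p => (f p *m (phi p).1, f p *m (phi p).2).
Definition rmulf (phi : form1) (f : mxfun) : form1 :=
  fun p => ((phi p).1 *m f p, (phi p).2 *m f p).

Definition addf (phi psi : form1) : form1 :=
  fun p => ((phi p).1 + (psi p).1, (phi p).2 + (psi p).2).
Definition scalef (t : C) (phi : form1) : form1 :=
  fun p => (t *: (phi p).1, t *: (phi p).2).
Definition oppf (phi : form1) : form1 := scalef (-1) phi.

End Forms.

(* Integral over the sphere of the scalar two-form tau dz /\ d(conj z): infinity
   has measure zero and dz /\ d(conj z) = -2i dx /\ dy. *)
Definition integralP1 (tau : P1 R -> C) : C :=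
  - 2 * 'i *
  ((\int[(@lebesgue_measure R \x @lebesgue_measure R)%E]_(p in setT)
      complex.Re (tau (Some (toC p))))
   +i* (\int[(@lebesgue_measure R \x @lebesgue_measure R)%E]_(p in setT)
      complex.Im (tau (Some (toC p))))).

Definition twopii : C := (2 * pi)%:C * 'i.

End Sphere.

Arguments mxfun : clear implicits.
Arguments form1 : clear implicits.
Arguments form2 : clear implicits.

Definition distinct_mod_Z {R : realType} {n : nat} (v : 'rV[R[i]]_n) : Prop :=
  forall i j, i != j -> forall z : int, v 0 i - v 0 j != z%:~R.

(* The data a.  The coordinate z_i on D_i is given through its inverse [locpar i],
   a biholomorphic map from the disc |u| < [disc_rad i] onto D_i, so that
   a_i = [locpar i 0].  The germ of A^0 at a_i is diag(h_i(z_i)) dz_i / z_i^k_i, where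
   h_i is the convergent power series with coefficients [germ i p]. *)
Record conn_data (R : realType) (n m : nat) := ConnData {
  pole_ord : 'I_m -> nat;
  pole_ord_gt0 : forall i, (0 < pole_ord i)%N;
  disc_rad : 'I_m -> R;
  disc_rad_gt0 : forall i, 0 < disc_rad i;
  locpar : 'I_m -> R[i] -> P1 R;
  locpar_holo : forall i, holoP1_on (disc 0 (disc_rad i)) (locpar i);
  locpar_deriv : forall i u, disc 0 (disc_rad i) u -> dparam (locpar i) u != 0;
  locpar_inj : forall i u v, disc 0 (disc_rad i) u -> disc 0 (disc_rad i) v ->
    locpar i u = locpar i v -> u = v;
  locpar_disj : forall i j u v, i != j ->
    disc 0 (disc_rad i) u -> disc 0 (disc_rad j) v -> locpar i u <> locpar j v;
  germ : 'I_m -> nat -> 'rV[R[i]]_n;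
  germ_cvg : forall i j, exists2 r : R, 0 < r &
    cvgn (series (fun p => cnorm (germ i p 0 j) * r ^+ p));
  germ_pole : forall i, germ i 0%N != 0;
  germ_generic_irr : forall i, (2 <= pole_ord i)%N ->
    forall j l, j != l -> germ i 0%N 0 j != germ i 0%N 0 l;
  germ_generic_log : forall i, pole_ord i = 1%N -> distinct_mod_Z (germ i 0%N)
}.

Section Connections.
Context {R : realType} {n m : nat}.
Variable a : conn_data R n m.
Local Notation C := R[i].
Local Notation M := 'M[C]_n.
Local Notation mxfun := (mxfun R n).
Local Notation form1 := (form1 R n).
Local Notation form2 := (form2 R n).

Definition point (i : 'I_m) : P1 R := locpar a i 0.

Definition off_D (p : P1 R) : Prop := forall i, p <> point i.

Definition singular_form (phi : form1) : Prop :=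
  (forall b, mxsmooth_on (stdpar b @^-1` off_D) (pull10 (stdpar b) phi) /\
             mxsmooth_on (stdpar b @^-1` off_D) (pull01 (stdpar b) phi)) /\
  (forall i, exists r : R, 0 < r /\ exists s10 s01 : C -> M,
     [/\ mxsmooth_on (disc 0 r) s10, mxsmooth_on (disc 0 r) s01
       & forall u, disc 0 r u ->
           pull10 (locpar a i) phi u = u ^- pole_ord a i *: s10 u /\
           pull01 (locpar a i) phi u = u ^- pole_ord a i *: s01 u]).

Definition L_form (i : 'I_m) (phi : form1) (l10 l01 : formal_laurent) : Prop :=
  laurent_expansion (pole_ord a i) (pull10 (locpar a i) phi) l10 /\
  laurent_expansion (pole_ord a i) (pull01 (locpar a i) phi) l01.

Definition L_fun (i : 'I_m) (f : mxfun) (l : formal_laurent) : Prop :=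
  laurent_expansion 0 (f \o locpar a i) l.

Definition zero_series : @formal_laurent R n := fun _ _ => 0.
Definition one_series : @formal_laurent R n :=
  fun j q => if (j == 0) && (q == 0%N) then 1%:M else 0.

Definition dlog_series (v : 'rV[C]_n) : @formal_laurent R n :=
  fun j q => if (j == -1) && (q == 0%N) then diag_mx v else 0.

Definition germ_series (i : 'I_m) : @formal_laurent R n := fun j q =>
  if q is 0%N then
    if j + (pole_ord a i)%:Z is Posz p then diag_mx (germ a i p) else 0
  else 0.

Definition germ_residue (i : 'I_m) : 'rV[C]_n := germ a i (pole_ord a i).-1.

(* The extended space: alpha stands for the connection d - alpha. *)
Definition extA (alpha : form1) : Prop :=
  singular_form alpha /\
  forall i, exists v : 'rV[C]_n,
    (pole_ord a i = 1%N -> distinct_mod_Z v) /\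
    L_form i alpha
      (fun j q => germ_series i j q + dlog_series (v - germ_residue i) j q)
      zero_series.

Definition extA_tangent (phi : form1) : Prop :=
  singular_form phi /\
  forall i, exists v : 'rV[C]_n, L_form i phi (dlog_series v) zero_series.

Definition omega (phi psi : form1) : C :=
  twopii^-1 * integralP1 (fun p => \tr (wedge phi psi p)).

Definition G1 (g : mxfun) : Prop :=
  [/\ smooth_P1 g, forall p, g p \in unitmx & forall i, L_fun i g one_series].

Definition lieG1 (x : mxfun) : Prop :=
  smooth_P1 x /\ forall i, L_fun i x zero_series.

Definition ginv (g : mxfun) : mxfun := fun p => invmx (g p).

Definition gauge (g : mxfun) (alpha : form1) : form1 :=
  addf (rmulf (lmulf g alpha) (ginv g)) (rmulf (dfun g) (ginv g)).

Definition Ad (g x : mxfun) : mxfun := fun p => g p *m x p *m invmx (g p).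

Definition covd (alpha : form1) (x : mxfun) : form1 :=
  addf (dfun x) (addf (oppf (rmulf alpha x)) (lmulf x alpha)).

Definition fundamental_field (x : mxfun) (alpha : form1) : form1 :=
  oppf (covd alpha x).

(* Basic neighbourhoods of 0 for the C^oo topology on matrix functions; the two
   closed unit discs cover the sphere. *)
Definition small_fun (N : nat) (d : R) (f : mxfun) : Prop :=
  forall b l u, (size l <= N)%N -> cnorm u <= 1 ->
    forall i j, cnorm (mxpartials l (f \o stdpar b) u i j) < d.

(* Same for one-forms with poles on D: the C^N size of z_i^k_i phi near a_i and
   of phi on the complement of the discs |z_i| < disc_rad i / 2. *)
Definition small_form (N : nat) (d : R) (phi : form1) : Prop :=
  (forall k l u, (size l <= N)%N -> 0 < cnorm u <= disc_rad a k / 2 ->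
     forall i j,
       cnorm (mxpartials l
         (fun v => v ^+ pole_ord a k *: pull10 (locpar a k) phi v) u i j) < d /\
       cnorm (mxpartials l
         (fun v => v ^+ pole_ord a k *: pull01 (locpar a k) phi v) u i j) < d) /\
  (forall b l u, (size l <= N)%N -> cnorm u <= 1 ->
     (forall k v, disc 0 (disc_rad a k / 2) v -> locpar a k v <> stdpar b u) ->
     forall i j,
       cnorm (mxpartials l (pull10 (stdpar b) phi) u i j) < d /\
       cnorm (mxpartials l (pull01 (stdpar b) phi) u i j) < d).

Definition lieG1_dual (xi : mxfun -> C) : Prop :=
  (forall (t : C) x y, lieG1 x -> lieG1 y ->
     xi (fun p => t *: x p + y p) = t * xi x + xi y) /\
  (forall x, lieG1 x -> forall e : R, 0 < e -> exists N, exists2 d : R, 0 < d &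
     forall y, lieG1 y -> small_fun N d (fun p => y p - x p) ->
       cnorm (xi y - xi x) < e).

Definition coAd (g : mxfun) (xi : mxfun -> C) : mxfun -> C :=
  fun x => xi (Ad (ginv g) x).

(* f is C^1 on the Frechet manifold extA (an open subset of an affine space
   modelled on extA_tangent) with differential df: complex directional
   derivatives, jointly continuous in the point and the direction. *)
Definition has_differential (f : form1 -> C) (df : form1 -> form1 -> C) : Prop :=
  (forall alpha phi, extA alpha -> extA_tangent phi ->
     (exists2 r : R, 0 < r &
        forall t, disc 0 r t -> extA (addf alpha (scalef t phi))) /\
     is_derive (0 : C^o) (1 : C^o)
       (fun t : C^o => f (addf alpha (scalef t phi)) : C^o) (df alpha phi)) /\
  (forall alpha phi, extA alpha -> extA_tangent phi ->
     forall e : R, 0 < e -> exists N, exists2 d : R, 0 < d &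
     forall beta psi, extA beta -> extA_tangent psi ->
       small_form N d (addf beta (oppf alpha)) ->
       small_form N d (addf psi (oppf phi)) ->
       cnorm (df beta psi - df alpha phi) < e).

(* A moment map for the gauge action of G_1 on extA, as a map mu from extA to
   the continuous dual of Lie(G_1); the clauses on gauge, Ad and the fundamental
   vector fields say that they act within extA, Lie(G_1) and the tangent space. *)
Definition equivariant_moment_map (mu : form1 -> mxfun -> C) : Prop :=
  [/\ forall alpha, extA alpha -> lieG1_dual (mu alpha),
      forall x, lieG1 x ->
        (forall alpha, extA alpha -> extA_tangent (fundamental_field x alpha)) /\
        has_differential (fun alpha => mu alpha x)
          (fun alpha phi => omega phi (fundamental_field x alpha))
    & forall g alpha, G1 g -> extA alpha ->
        extA (gauge g alpha) /\
        forall x, lieG1 x -> lieG1 (Ad (ginv g) x) /\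
          mu (gauge g alpha) x = coAd g (mu alpha) x].

Definition curvature (alpha : form1) : form2 :=
  fun p => - dform alpha p + wedge alpha alpha p.

Definition curvature_pairing (alpha : form1) (x : mxfun) : C :=
  twopii^-1 * integralP1 (fun p => \tr (curvature alpha p *m x p)).

End Connections.

(* Main.v *)
Require Import Defs.
From HB Require Import structures.
From mathcomp Require Import all_boot all_order all_algebra.
From mathcomp Require Import perm complex.
From mathcomp Require Import all_classical all_reals all_analysis.
From mathcomp Require Import measurable_realfun ring lra.

(** The curvature is quadratic in alpha: F(alpha + t phi) is the sum of F(alpha),
    of - t (d phi - alpha /\ phi - phi /\ alpha) and of t^2 phi /\ phi.  After pairing with x,
    cyclicity of the trace and the Leibniz rule turn the linear term into
    Tr (phi /\ (- d_alpha x)) - d Tr (phi x), so that the moment map identity amounts to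
    Stokes' theorem for the one-form Tr (phi x) ([tr_curvature_algebra], [stokes_sphere]).
    Equivariance is the identity F(g[alpha]) = g F(alpha) g^-1 ([curvature_gauge]) together
    with the invariance of the trace.

    What remains is the analysis at the points of D.  An element x of Lie(G_1) has zero
    Taylor series at a_i, hence is smaller than every power of |z_i| ([flat_bound]), and so
    are its derivatives; this absorbs every pole.  Thus d_alpha x has zero Laurent expansion,
    g[alpha] - alpha has zero Laurent expansion for g in G_1, and Tr (phi x) extends by zero
    to a C^1 form.  For alpha in the extended space the Laurent expansion contains no
    conj z_i: the (0,1)-part is flat at a_i, and d-bar of the (1,0)-part is flat as well
    because z_i^-k is holomorphic.  Hence the curvature, and the wedge product of any two
    such forms, are flat at D although the forms themselves have poles ([polar],
    [rapid2_wedge], [polar_dform]).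

    Infinity, which may or may not be on D, is handled by measuring forms in the round
    metric of the sphere.  A two-form which is smooth off D and bounded near D in the
    coordinates z_i is bounded in that metric by compactness ([bounded2_tnorm]), i.e. it is
    O((1 + |z|^2)^-2) in the affine coordinate: it is integrable, and its integral is
    controlled by its supremum norm ([integralP1_bound]).  All continuity statements,
    including the joint continuity of the differential, are uniform estimates fed into that
    bound.  A one-form which is bounded in the round metric is O((1 + |z|^2)^-1), so that the
    boundary terms of the divergence theorem on a square of size N are O(1/N)
    ([stokes_real]). *)

Set Implicit Arguments.
Unset Strict Implicit.
Unset Printing Implicit Defensive.

Import Order.TTheory GRing.Theory Num.Theory.
Import numFieldNormedType.Exports.

Local Open Scope classical_set_scope.
Local Open Scope ring_scope.
Local Open Scope complex_scope.

(** * Differential calculus on the real plane *)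

Section LinearForm.
Context {R : realType}.
Definition lform (a b : R) (h : R * R) : R := a * h.1 + b * h.2.
Fact lform_linear a b : linear (lform a b).
Proof. by move=> k [x y] [x' y']; rewrite /lform /= /GRing.scale /=; ring. Qed.
HB.instance Definition _ a b :=
  GRing.isLinear.Build R (R * R)%type R *:%R (lform a b) (lform_linear a b).
End LinearForm.

Section PlaneCalculus.
Context {R : realType}.
Implicit Types (F G : R * R -> R) (p v : R * R) (U : set (R * R)).

Lemma addpE p v : p + v = (p.1 + v.1, p.2 + v.2). Proof. by []. Qed.
Lemma scalepE (k : R) p : k *: p = (k * p.1, k * p.2). Proof. by []. Qed.

Lemma addpKA p v (w : R * R) : p + v + w - p = v + w.
Proof. by rewrite -[p + v + w]addrA [p + _]addrC addrK. Qed.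
Lemma addpK p v : p + v - p = v.
Proof. by rewrite [p + _]addrC addrK. Qed.

Lemma lform_continuous (a b : R) : continuous (lform a b).
Proof.
move=> p; rewrite /lform /continuous_at; apply: cvgD.
  by apply: cvgM; [exact: cvg_cst | exact: cvg_fst].
by apply: cvgM; [exact: cvg_cst | exact: cvg_snd].
Qed.

Lemma differentiable_of_bound F p (a b : R) :
  (forall e : R, 0 < e -> \forall h \near (0 : R * R),
     `|F (h + p) - F p - lform a b h| <= e * `|h|) ->
  differentiable F p /\ forall v, 'D_v F p = lform a b v.
Proof.
move=> H.
have E : F \o shift p = cst (F p) + lform a b +o_ (0 : R * R) id.
  apply/eqaddoP => e e0 /=.
  have := H _ e0; apply: filterS => h /=.
  suff -> : (F \o +%R^~ p - (cst (F p) + lform a b)) h = F (h + p) - F p - lform a b h by [].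
  by rewrite -addrA -opprD.
have D := diff_unique (lform_continuous (a := a) (b := b)) E.
have dF : differentiable F p by apply/diff_locallyP; rewrite D; split => //; exact: lform_continuous.
by split=> // v; rewrite (deriveE _ dF) D.
Qed.

Lemma is_derive_slice F p v (s : R) : derivable F (p + s *: v) v ->
  is_derive s (1 : R) (fun t : R => F (p + t *: v)) ('D_v F (p + s *: v)).
Proof.
move=> H.
have E : (fun h : R => h^-1 *: (((fun t : R => F (p + t *: v)) \o shift s) (h *: (1 : R)) - F (p + s *: v)))
  = (fun h : R => h^-1 *: ((F \o shift (p + s *: v)) (h *: v) - F (p + s *: v))).
  apply/funext => h /=; congr (_ *: (F _ - _)).
  by rewrite [h%:A]mulr1 scalerDl addrCA.
by split; rewrite /derivable /derive ?E.
Qed.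

Lemma mvt01 F p v :
  (forall s, 0 <= s <= 1 -> derivable F (p + s *: v) v) ->
  exists2 s : R, 0 <= s <= 1 & F (p + v) - F p = 'D_v F (p + s *: v).
Proof.
move=> H.
have [s||s Hs] := @MVT_segment R (fun t => F (p + t *: v)) (fun t => 'D_v F (p + t *: v)) 0 1 ler01.
- rewrite in_itv /= => /andP[s0 s1]; apply: is_derive_slice; apply: H.
  by rewrite !ltW.
- apply: derivable_within_continuous => s; rewrite in_itv /= => Hs.
  by have [] := is_derive_slice (H s Hs).
rewrite scale1r scale0r addr0 subr0 mulr1 => E.
by exists s => //; move: Hs; rewrite in_itv.
Qed.

Lemma is_deriveZv F p v (k : R) : derivable F p v ->
  is_derive p (k *: v) F (k * 'D_v F p).
Proof.
move=> H.
have H0 : derivable F (p + 0 *: v) v by rewrite scale0r addr0.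
have D := is_derive_slice H0.
have D' : is_derive (0 : R) (1 : R) (fun t : R => k * t) k.
  have -> : (fun t : R => k * t) = k \*: (id : R -> R) by [].
  by apply: is_derive_eq; rewrite [LHS]mulr1.
have D2 : is_derive (k * 0) (1:R) (fun t : R => F (p + t *: v)) ('D_v F p).
  by rewrite mulr0; move: D; rewrite scale0r addr0.
have D3 := is_derive1_comp D2 D'.
have E : (fun h : R => h^-1 *: ((F \o shift p) (h *: (k *: v)) - F p)) =
   (fun h : R => h^-1 *: ((((fun t : R => F (p + t *: v)) \o (fun t => k * t)) \o shift 0) (h *: (1 : R)) - F (p + (k * 0) *: v))).
  apply/funext => h /=; rewrite mulr0 scale0r !addr0; congr (_ *: (F _ - _)).
  by rewrite [h%:A]mulr1 addrC scalerA mulrC.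
case: D3 => D3 D4; split; first by rewrite /derivable E; exact: D3.
by rewrite mulrC -D4 {1}/derive E.
Qed.

Lemma dirE (h : R * R) : h = h.1 *: dir false + h.2 *: dir true.
Proof.
by case: h => x y; rewrite !scalepE addpE /= !mulr1 !mulr0 addr0 add0r.
Qed.

Lemma normp_fst (h : R * R) : `|h.1| <= `|h|.
Proof. by rewrite prod_normE /= le_max lexx. Qed.
Lemma normp_snd (h : R * R) : `|h.2| <= `|h|.
Proof. by rewrite prod_normE /= le_max lexx orbT. Qed.
Lemma normp_le (h : R * R) (e : R) : (`|h| <= e) = (`|h.1| <= e) && (`|h.2| <= e).
Proof. by rewrite prod_normE /= ge_max. Qed.
Lemma normp_lt (h : R * R) (e : R) : (`|h| < e) = (`|h.1| < e) && (`|h.2| < e).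
Proof. by rewrite prod_normE /= gt_max. Qed.

Lemma nbhs_pP p (A : set (R * R)) :
  nbhs p A <-> exists2 e : R, 0 < e & forall q, `|q - p| < e -> A q.
Proof.
split.
  move=> /nbhs_ballP[e /= e0 H]; exists e => // q Hq; apply: H.
  by rewrite -ball_normE /= distrC.
move=> [e e0 H]; apply/nbhs_ballP; exists e => // q; rewrite -ball_normE /= => Hq.
by apply: H; rewrite distrC.
Qed.

(** Along the broken segment from p to p + h, both legs are controlled by the
   mean value theorem. *)
Lemma C1_differentiable F p :
  (\forall q \near p, forall b, derivable F q (dir b)) ->
  (forall b, {for p, continuous ('D_(dir b) F)}) ->
  differentiable F p.
Proof.
move=> Hd Hc; apply: (@differentiable_of_bound F p ('D_(dir false) F p) ('D_(dir true) F p) _).1.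
move=> e e0.
have e20 : 0 < e / 2 by rewrite divr_gt0.
have Hcc : forall b, \forall q \near p, `|'D_(dir b) F q - 'D_(dir b) F p| < e / 2.
  move=> b; have /cvgrPdist_lt /(_ _ e20) := Hc b.
  by apply: filterS => q; rewrite distrC.
have /nbhs_pP[d1 d10 H1] := Hd.
have /nbhs_pP[d2 d20 H2] := Hcc false.
have /nbhs_pP[d3 d30 H3] := Hcc true.
apply/nbhs_pP; exists (Num.min d1 (Num.min d2 d3)).
  by rewrite !lt_min d10 d20.
move=> h; rewrite subr0 !lt_min => /and3P[h1 h2 h3].
have leg1 : forall s : R, 0 <= s <= 1 -> `|s *: (h.1 *: dir false)| <= `|h|.
  move=> s /andP[s0 s1]; rewrite !scalepE normp_le /= !mulr1 !mulr0 normr0 normr_ge0 andbT.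
  rewrite normrM (ger0_norm s0) (le_trans _ (normp_fst h)) // ler_piMl //.
have leg2 : forall s : R, 0 <= s <= 1 -> `|h.1 *: dir false + s *: (h.2 *: dir true)| <= `|h|.
  move=> s /andP[s0 s1]; rewrite !scalepE addpE normp_le /= !mulr1 !mulr0 addr0 add0r normp_fst /=.
  rewrite normrM (ger0_norm s0) (le_trans _ (normp_snd h)) // ler_piMl //.
have [s|s s01 E1] := @mvt01 F p (h.1 *: dir false).
  move=> s01; have [] := @is_deriveZv F (p + s *: (h.1 *: dir false)) (dir false) h.1 => //.
  by apply: H1; rewrite addpK (le_lt_trans (leg1 s s01)).
have [t|t t01 E2] := @mvt01 F (p + h.1 *: dir false) (h.2 *: dir true).
  move=> t01; have [] := @is_deriveZv F (p + h.1 *: dir false + t *: (h.2 *: dir true)) (dir true) h.2 => //.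
  by apply: H1; rewrite addpKA (le_lt_trans (leg2 t t01)).
have B1 := le_lt_trans (leg1 s s01); have B2 := le_lt_trans (leg2 t t01).
have P1 : `|p + s *: (h.1 *: dir false) - p| < d1 by rewrite addpK B1.
have P2 : `|p + h.1 *: dir false + t *: (h.2 *: dir true) - p| < d1 by rewrite addpKA B2.
have [_ D1] := @is_deriveZv F (p + s *: (h.1 *: dir false)) (dir false) h.1 (H1 _ P1 false).
have [_ D2] := @is_deriveZv F (p + h.1 *: dir false + t *: (h.2 *: dir true)) (dir true) h.2 (H1 _ P2 true).
have C1 : `|'D_(dir false) F (p + s *: (h.1 *: dir false)) - 'D_(dir false) F p| < e / 2.
  by apply: H2; rewrite addpK B1.
have C2 : `|'D_(dir true) F (p + h.1 *: dir false + t *: (h.2 *: dir true)) - 'D_(dir true) F p| < e / 2.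
  by apply: H3; rewrite addpKA B2.
move: E1 E2; rewrite D1 D2 => E1 E2.
have -> : F (h + p) = F (p + h.1 *: dir false + h.2 *: dir true).
  by rewrite -addrA -dirE addrC.
rewrite /lform.
set u := 'D_(dir false) F (p + _) in C1 E1 *; set w := 'D_(dir true) F (p + _ + _) in C2 E2 *.
have -> : F (p + h.1 *: dir false + h.2 *: dir true) - F p -
    ('D_(dir false) F p * h.1 + 'D_(dir true) F p * h.2) =
   (u - 'D_(dir false) F p) * h.1 + (w - 'D_(dir true) F p) * h.2.
  rewrite -[F (p + _ + _)](subrK (F (p + h.1 *: dir false))) E2.
  rewrite -[F (p + h.1 *: _)](subrK (F p)) E1; ring.
rewrite (le_trans (ler_normD _ _)) // !normrM [e]splitr mulrDl lerD //.
  exact: (ler_pM (normr_ge0 _) (normr_ge0 _) (ltW C1) (normp_fst h)).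
exact: (ler_pM (normr_ge0 _) (normr_ge0 _) (ltW C2) (normp_snd h)).
Qed.

End PlaneCalculus.

(** * Functions smooth to finite order *)

Section Smooth.
Context {R : realType}.
Implicit Types (F G : R * R -> R) (p v : R * R) (U : set (R * R)).

(** Differentiability to order k, unfolded one derivative at a time: the form suited to
    inductions on sums, products and compositions, unlike [rsmooth_on]. *)
Fixpoint Sm (k : nat) U F : Prop := if k is k'.+1 then
  (forall p, U p -> differentiable F p) /\ forall b, Sm k' U ('D_(dir b) F)
  else True.

Lemma near_eq_differentiable F G p :
  (\near p, F p = G p) -> differentiable F p -> differentiable G p.
Proof.
move=> E /diff_locallyP [c D].
have E0 := nbhs_singleton E.
have D' : G \o shift p = cst (G p) + 'd F p +o_ (0 : R * R) id.
  apply/eqaddoP => e e0.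
  have /eqaddoP /(_ e e0) := D.
  have : \forall h \near (0 : R * R), F (h + p) = G (h + p).
    have /nbhs_pP[d d0 H] := E; apply/nbhs_pP; exists d => // h; rewrite subr0 => hd.
    by apply: H; rewrite addrK.
  move=> /nbhs_pP[a a0 A] /nbhs_pP[b b0 B]; apply/nbhs_pP.
  exists (Num.min a b) => [|h]; first by rewrite lt_min a0.
  rewrite lt_min => /andP[/A Eh /B].
  suff -> : (F \o shift p - (cst (F p) + 'd F p)) h = (G \o shift p - (cst (G p) + 'd F p)) h by [].
  by change (F (h + p) - (F p + 'd F p h) = G (h + p) - (G p + 'd F p h)); rewrite Eh E0.
by apply/diff_locallyP; rewrite (diff_unique c D').
Qed.

Lemma Sm_eq k U F G : open U -> (forall p, U p -> F p = G p) -> Sm k U F -> Sm k U G.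
Proof.
move=> oU; elim: k F G => //= k IH F G E [H1 H2].
have N p : U p -> \near p, F p = G p.
  by move=> Up; apply: filterS E _; exact: open_nbhs_nbhs.
split=> [p Up|b]; first by apply: near_eq_differentiable (N p Up) _; exact: H1.
apply: IH (H2 b) => p Up.
by apply: near_eq_derive; exact: N.
Qed.

Lemma SmS k U F : Sm k.+1 U F -> Sm k U F.
Proof. by elim: k F => //= k IH F [H1 H2]; split => // b; apply: IH. Qed.

Lemma rsmooth_partial U F b : rsmooth_on U F -> rsmooth_on U ('D_(dir b) F).
Proof. by move=> H l p Up; have := H (rcons l b) p Up; rewrite /partials foldr_rcons. Qed.

(** Continuity of the partial derivatives gives differentiability at every order. *)
Lemma rsmooth_Sm U F : open U -> rsmooth_on U F -> forall k, Sm k U F.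
Proof.
move=> oU H k; elim: k F H => //= k IH F H; split=> [p Up|b]; last first.
  by apply: IH; exact: rsmooth_partial.
apply: C1_differentiable => [|b].
  by apply: (@filterS _ _ _ U); [move=> q Uq; have [] := H [::] q Uq | exact: open_nbhs_nbhs].
by have [] := H [:: b] p Up.
Qed.

Lemma Sm_rsmooth U F : (forall k, Sm k U F) -> rsmooth_on U F.
Proof.
move=> H l; elim/last_ind: l F H => [|l b IH] F H p Up.
  have [D _] := H 1%N; split; first by apply: differentiable_continuous; exact: D.
  by move=> b; apply: diff_derivable; exact: D.
rewrite /partials foldr_rcons; apply: (IH ('D_(dir b) F)) => // k.
by have [_ Hb] := H k.+1; exact: Hb.
Qed.

Lemma rsmooth_sub U V F : U `<=` V -> rsmooth_on V F -> rsmooth_on U F.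
Proof. by move=> UV H l p /UV /H. Qed.

Lemma rsmooth_diff U F p : open U -> rsmooth_on U F -> U p -> differentiable F p.
Proof. by move=> oU /(rsmooth_Sm oU) /(_ 1%N) [H _] /H. Qed.

Lemma rsmooth_eq U F G : open U -> (forall p, U p -> F p = G p) ->
  rsmooth_on U F -> rsmooth_on U G.
Proof.
by move=> oU E H; apply: Sm_rsmooth => k; apply: Sm_eq E _ => //; exact: rsmooth_Sm.
Qed.

Lemma diff_dir F p h : differentiable F p ->
  'd F p h = h.1 * 'D_(dir false) F p + h.2 * 'D_(dir true) F p.
Proof.
move=> D; rewrite {1}[h]dirE linearD !linearZ /=.
by rewrite !(deriveE _ D).
Qed.

Lemma derive_pair_comp F (G1 G2 : R * R -> R) p v :
  differentiable G1 p -> differentiable G2 p -> differentiable F (G1 p, G2 p) ->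
  differentiable (fun q => F (G1 q, G2 q)) p /\
  'D_v (fun q => F (G1 q, G2 q)) p =
  'D_(dir false) F (G1 p, G2 p) * 'D_v G1 p + 'D_(dir true) F (G1 p, G2 p) * 'D_v G2 p.
Proof.
move=> D1 D2 D.
have D12 := differentiable_pair D1 D2.
have Dc : differentiable (F \o (fun q => (G1 q, G2 q))) p by exact: differentiable_comp.
split=> //.
rewrite (deriveE _ Dc) diff_comp //= diff_pair //= diff_dir //=.
by rewrite (deriveE v D1) (deriveE v D2) mulrC [X in _ + X]mulrC.
Qed.

Lemma Sm_cst k U (c : R) : Sm k U (cst c).
Proof.
elim: k c => //= k IH c; split=> // b.
suff -> : 'D_(dir b) (cst c : R * R -> R) = cst 0 by [].
by apply/funext => p; rewrite derive_cst.
Qed.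


Lemma lform_diff (a b : R) p : differentiable (lform a b) p.
Proof. by apply: linear_differentiable; exact: lform_continuous. Qed.

Lemma derive_lform (a b : R) p v : 'D_v (lform a b) p = lform a b v.
Proof. by rewrite (deriveE _ (lform_diff a b p)) diff_lin //; exact: lform_continuous. Qed.

Lemma Sm_lform k U (a b : R) : Sm k U (lform a b).
Proof.
case: k => //= k; split=> [p _|c]; first exact: lform_diff.
suff -> : 'D_(dir c) (lform a b) = cst (lform a b (dir c)) by exact: Sm_cst.
by apply/funext => p; rewrite derive_lform.
Qed.

Lemma SmD k U F G : open U -> Sm k U F -> Sm k U G -> Sm k U (fun p => F p + G p).
Proof.
move=> oU; elim: k F G => //= k IH F G [F1 F2] [G1 G2]; split=> [p Up|b].
  by apply: differentiableD; [exact: F1 | exact: G1].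
apply: Sm_eq oU _ (IH _ _ (F2 b) (G2 b)) => p Up.
by rewrite deriveD //; apply: diff_derivable; [exact: F1 | exact: G1].
Qed.

Lemma SmM k U F G : open U -> Sm k U F -> Sm k U G -> Sm k U (fun p => F p * G p).
Proof.
move=> oU; elim: k F G => //= k IH F G [F1 F2] [G1 G2]; split=> [p Up|b].
  by apply: differentiableM; [exact: F1 | exact: G1].
have F0 : Sm k U F by apply: SmS.
have G0 : Sm k U G by apply: SmS.
apply: Sm_eq oU _ (SmD oU (IH _ _ F0 (G2 b)) (IH _ _ G0 (F2 b))) => p Up.
by rewrite deriveM //; apply: diff_derivable; [exact: F1 | exact: G1].
Qed.

Lemma SmV k U F : open U -> (forall p, U p -> F p != 0) -> Sm k U F ->
  Sm k U (fun p => (F p)^-1).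
Proof.
move=> oU nz; elim: k => //= k IH [F1 F2]; split=> [p Up|b].
  by apply: differentiableV; [exact: F1 | exact: nz].
have F0 : Sm k U (fun p => (F p)^-1) by apply: IH; apply: SmS.
apply: Sm_eq oU _ (SmM oU (Sm_cst k U (-1)) (SmM oU (SmM oU F0 F0) (F2 b))) => p Up.
have Up0 := nz p Up.
rewrite deriveV //; last by apply: diff_derivable; exact: F1.
by rewrite /cst mulN1r /GRing.scale /= mulNr expr2 invfM.
Qed.

(** Induction on k: by the chain rule the derivatives are sums of products of functions of
    class k. *)
Lemma Sm_comp k U V F G1 G2 : open U -> open V ->
  (forall p, V p -> U (G1 p, G2 p)) -> Sm k U F -> Sm k V G1 -> Sm k V G2 ->
  Sm k V (fun p => F (G1 p, G2 p)).
Proof.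
move=> oU oV UV; elim: k F => //= k IH F [F1 F2] H1 H2.
have S1 : Sm k V G1 by apply: SmS.
have S2 : Sm k V G2 by apply: SmS.
have D p : V p -> differentiable G1 p /\ differentiable G2 p /\ differentiable F (G1 p, G2 p).
  by move=> Vp; case: H1 => H1 _; case: H2 => H2 _; split; [exact: H1 | split; [exact: H2 | exact/F1/UV]].
split=> [p Vp|b].
  have [D1 [D2 D3]] := D p Vp.
  by have [] := derive_pair_comp 0 D1 D2 D3.
have E1 : Sm k V ('D_(dir b) G1) by case: H1 => _.
have E2 : Sm k V ('D_(dir b) G2) by case: H2 => _.
have K1 := SmM oV (IH _ (F2 false) S1 S2) E1.
have K2 := SmM oV (IH _ (F2 true) S1 S2) E2.
apply: Sm_eq oV _ (SmD oV K1 K2) => p Vp.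
have [D1 [D2 D3]] := D p Vp.
by have [_ ->] := derive_pair_comp (dir b) D1 D2 D3.
Qed.

Lemma dist_common (a b x e : R) : `|b - x| < e -> `|a - x| < e -> `|a - b| <= e + e.
Proof.
move=> L1 L2; rewrite -(subrKA x) (le_trans (ler_normD _ _)) // lerD ?(ltW L2) //.
by rewrite distrC ltW.
Qed.

(** The mean value theorem in one variable, then in the other; b tells which comes first. *)
Lemma second_difference F p (h : R) (b : bool) (d : R) : 0 < h -> h < d ->
  (forall q, `|q - p| < d -> differentiable F q /\ differentiable ('D_(dir b) F) q) ->
  exists2 q, `|q - p| <= h &
    F (p + h *: dir false + h *: dir true) - F (p + h *: dir false)
      - F (p + h *: dir true) + F p = h * (h * 'D_(dir (~~ b)) ('D_(dir b) F) q).
Proof.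
move=> h0 hd D.
pose G q := F (q + h *: dir (~~ b)) - F q.
have N (s t : R) : 0 <= s <= 1 -> 0 <= t <= 1 ->
    `|s *: (h *: dir b) + t *: (h *: dir (~~ b))| <= h.
  move=> /andP[s0 s1] /andP[t0 t1]; rewrite normp_le.
  have A (c : R) : 0 <= c -> c <= 1 -> `|c * h| <= h.
    by move=> c0 c1; rewrite ger0_norm ?mulr_ge0 ?(ltW h0) // ler_piMl // ltW.
  by case: b {D G}; rewrite !scalepE addpE /= !mulr1 !mulr0 ?addr0 ?add0r !A.
have N0 (s : R) : 0 <= s <= 1 -> `|s *: (h *: dir b)| <= h.
  by move=> Hs; have := N s 0 Hs; rewrite scale0r addr0; apply; rewrite lexx ler01.
have N1 (s : R) : 0 <= s <= 1 -> `|s *: (h *: dir b) + h *: dir (~~ b)| <= h.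
  by move=> Hs; have := N s 1 Hs; rewrite scale1r; apply; rewrite ler01 lexx.
have dG s : 0 <= s <= 1 -> is_derive (p + s *: (h *: dir b)) (h *: dir b) G
  (h * ('D_(dir b) F (p + s *: (h *: dir b) + h *: dir (~~ b)) - 'D_(dir b) F (p + s *: (h *: dir b)))).
  move=> Hs.
  have [D1 _] := D (p + s *: (h *: dir b)) ltac:(by rewrite addpK (le_lt_trans (N0 s Hs))).
  have [D2 _] := D (p + s *: (h *: dir b) + h *: dir (~~ b)) ltac:(by rewrite addpKA (le_lt_trans (N1 s Hs))).
  have D2s : is_derive (p + s *: (h *: dir b)) (h *: dir b) (fun q => F (q + h *: dir (~~ b)))
     (h * 'D_(dir b) F (p + s *: (h *: dir b) + h *: dir (~~ b))).
    have [A1 A2] := is_deriveZv h (@diff_derivable _ _ _ _ _ (dir b) D2).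
    have E : (fun t : R => t^-1 *: (((fun q => F (q + h *: dir (~~ b))) \o shift (p + s *: (h *: dir b))) (t *: (h *: dir b)) - F (p + s *: (h *: dir b) + h *: dir (~~ b)))) =
      (fun t : R => t^-1 *: ((F \o shift (p + s *: (h *: dir b) + h *: dir (~~ b))) (t *: (h *: dir b)) - F (p + s *: (h *: dir b) + h *: dir (~~ b)))).
      by apply/funext => t /=; rewrite -!addrA.
    by split; [rewrite /derivable E | rewrite -A2 /derive E].
  have [B1 B2] := is_deriveZv h (@diff_derivable _ _ _ _ _ (dir b) D1).
  have B : is_derive (p + s *: (h *: dir b)) (h *: dir b) F (h * 'D_(dir b) F (p + s *: (h *: dir b))) by split.
  by rewrite mulrBr; apply: is_deriveB.
have [s Hs|s Hs E1] := @mvt01 R G p (h *: dir b).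
  by have [] := dG s Hs.
have [_ E2] := dG s Hs; rewrite E2 in E1.
have dD t : 0 <= t <= 1 -> is_derive (p + s *: (h *: dir b) + t *: (h *: dir (~~ b)))
    (h *: dir (~~ b)) ('D_(dir b) F)
    (h * 'D_(dir (~~ b)) ('D_(dir b) F) (p + s *: (h *: dir b) + t *: (h *: dir (~~ b)))).
  move=> Ht; apply: is_deriveZv; apply: diff_derivable.
  by have [] := D (p + s *: (h *: dir b) + t *: (h *: dir (~~ b))) ltac:(by rewrite addpKA (le_lt_trans (N s t Hs Ht))).
have [t Ht|t Ht E3] := @mvt01 R ('D_(dir b) F) (p + s *: (h *: dir b)) (h *: dir (~~ b)).
  by have [] := dD t Ht.
have [_ E4] := dD t Ht; rewrite E4 in E3.
exists (p + s *: (h *: dir b) + t *: (h *: dir (~~ b))); first by rewrite addpKA N.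
rewrite E3 in E1; rewrite -E1 /G.
case: b {D G N N0 N1 dG E1 E2 dD E3 E4}; rewrite /negb.
  rewrite [p + _ + h *: dir false]addrAC; lra.
lra.
Qed.

(** Both mixed derivatives are limits of the same second difference quotient. *)
Lemma schwarz U F p : open U -> rsmooth_on U F -> U p ->
  'D_(dir true) ('D_(dir false) F) p = 'D_(dir false) ('D_(dir true) F) p.
Proof.
move=> oU sF Up.
have cont b : {for p, continuous ('D_(dir (~~ b)) ('D_(dir b) F))}.
  by have [] := sF [:: ~~ b; b] p Up.
have [d d0 Hd] : exists2 d : R, 0 < d & forall q, `|q - p| < d -> U q.
  by apply/nbhs_pP; exact: open_nbhs_nbhs.
suff K (e : R) : 0 < e -> `|'D_(dir true) ('D_(dir false) F) p - 'D_(dir false) ('D_(dir true) F) p| <= e + e.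
  apply/eqP; rewrite -subr_eq0 -normr_le0; apply/ler_addgt0Pr => e e0; rewrite add0r.
  by rewrite [e]splitr; apply: K; rewrite divr_gt0.
move=> e0.
have [d1 d10 H1] : exists2 d : R, 0 < d & forall q, `|q - p| < d ->
    forall b, `|'D_(dir (~~ b)) ('D_(dir b) F) p - 'D_(dir (~~ b)) ('D_(dir b) F) q| < e.
  have /cvgrPdist_lt /(_ e e0) /nbhs_pP[a a0 A1] := cont true.
  have /cvgrPdist_lt /(_ e e0) /nbhs_pP[b b0 A2] := cont false.
  exists (Num.min a b) => [|q]; first by rewrite lt_min a0.
  rewrite lt_min => /andP[qa qb] [].
    exact: A1 qa.
  exact: A2 qb.
pose h := Num.min d d1 / 2.
have m0 : 0 < Num.min d d1 by rewrite lt_min d0.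
have h0 : 0 < h by rewrite divr_gt0.
have hm : h < Num.min d d1 by rewrite /h; lra.
have /andP[hd hd1] : (h < d) && (h < d1) by rewrite -lt_min.
have D b q : `|q - p| < d -> differentiable F q /\ differentiable ('D_(dir b) F) q.
  move=> /Hd Uq; split; first exact: rsmooth_diff oU sF Uq.
  exact: rsmooth_diff oU (rsmooth_partial b sF) Uq.
have [q1 Q1 E1] := second_difference h0 hd (D true).
have [q2 Q2 E2] := second_difference h0 hd (D false).
have hn : h != 0 by rewrite gt_eqF.
have L1 : `|'D_(dir false) ('D_(dir true) F) p - 'D_(dir false) ('D_(dir true) F) q1| < e.
  exact: H1 q1 (le_lt_trans Q1 hd1) true.
have L2 : `|'D_(dir true) ('D_(dir false) F) p - 'D_(dir true) ('D_(dir false) F) q2| < e.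
  exact: H1 q2 (le_lt_trans Q2 hd1) false.
have E : 'D_(dir false) ('D_(dir true) F) q1 = 'D_(dir true) ('D_(dir false) F) q2.
  apply: (mulfI hn); apply: (mulfI hn); exact: etrans (esym E1) E2.
rewrite -E in L2; exact: dist_common L1 L2.
Qed.

End Smooth.

(** * Wirtinger calculus *)

Section Cnorm.
Context {R : realType}.
Local Notation C := R[i].
Local Notation II := (@Complex R 0 1).
Local Notation cj := (@conjc R).
Implicit Types (z w : C).

Lemma ReD z w : complex.Re (z + w) = complex.Re z + complex.Re w.
Proof. by case: z; case: w. Qed.
Lemma ImD z w : complex.Im (z + w) = complex.Im z + complex.Im w.
Proof. by case: z; case: w. Qed.
Lemma ReN z : complex.Re (- z) = - complex.Re z. Proof. by case: z. Qed.
Lemma ImN z : complex.Im (- z) = - complex.Im z. Proof. by case: z. Qed.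
Lemma ReM z w : complex.Re (z * w) = complex.Re z * complex.Re w - complex.Im z * complex.Im w.
Proof. by case: z; case: w. Qed.
Lemma ImM z w : complex.Im (z * w) = complex.Re z * complex.Im w + complex.Im z * complex.Re w.
Proof. by case: z; case: w. Qed.
Lemma complex_ext z w : complex.Re z = complex.Re w -> complex.Im z = complex.Im w -> z = w.
Proof. by case: z => a b; case: w => c d /= -> ->. Qed.

Lemma cjD z w : cj (z + w) = cj z + cj w. Proof. exact: rmorphD. Qed.
Lemma cjM z w : cj (z * w) = cj z * cj w. Proof. exact: rmorphM. Qed.
Lemma cnorm_Cnorm z : (cnorm z)%:C = `|z|. Proof. by []. Qed.
Lemma cnormE z : cnorm z = Num.sqrt (complex.Re z ^+ 2 + complex.Im z ^+ 2).
Proof. by case: z. Qed.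
Lemma cnorm_sqr z : cnorm z ^+ 2 = complex.Re z ^+ 2 + complex.Im z ^+ 2.
Proof. by rewrite cnormE sqr_sqrtr // addr_ge0 // sqr_ge0. Qed.
Lemma cnorm_ge0 z : 0 <= cnorm z. Proof. by rewrite cnormE sqrtr_ge0. Qed.
Lemma cnorm0 : cnorm (0 : C) = 0. Proof. exact: ComplexField.Normc.normc0. Qed.
Lemma cnorm1 : cnorm (1 : C) = 1. Proof. exact: ComplexField.Normc.normc1. Qed.
Lemma cnormM z w : cnorm (z * w) = cnorm z * cnorm w.
Proof. exact: ComplexField.Normc.normcM. Qed.
Lemma cnormV z : cnorm z^-1 = (cnorm z)^-1.
Proof. exact: ComplexField.Normc.normcV. Qed.
Lemma cnormN z : cnorm (- z) = cnorm z.
Proof. by rewrite !cnormE ReN ImN !sqrrN. Qed.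
Lemma cnorm_dist z w : cnorm (z - w) = cnorm (w - z).
Proof. by rewrite -opprB cnormN. Qed.
Lemma cnormD z w : cnorm (z + w) <= cnorm z + cnorm w.
Proof. by rewrite -lecR rmorphD /= !cnorm_Cnorm ler_normD. Qed.
Lemma cnormB z w : cnorm (z - w) <= cnorm z + cnorm w.
Proof. by rewrite (le_trans (cnormD _ _)) // cnormN. Qed.
Lemma cnormX z k : cnorm (z ^+ k) = cnorm z ^+ k.
Proof. by elim: k => [|k IH]; rewrite ?expr0 ?cnorm1 // !exprS cnormM IH. Qed.
Lemma cnormJ z : cnorm (cj z) = cnorm z.
Proof. by rewrite !cnormE; case: z => a b /=; rewrite sqrrN. Qed.
Lemma cnorm_real (r : R) : cnorm r%:C = `|r|.
Proof. by rewrite cnormE /= expr0n /= addr0 sqrtr_sqr. Qed.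
Lemma cnormi : cnorm II = 1.
Proof. by rewrite cnormE /= expr0n /= add0r expr1n sqrtr1. Qed.
Lemma cnorm_eq0 z : (cnorm z == 0) = (z == 0).
Proof.
apply/eqP/eqP => [/ComplexField.Normc.eq0_normc //|->]; exact: cnorm0.
Qed.
Lemma cnorm_gt0 z : (0 < cnorm z) = (z != 0).
Proof. by rewrite lt_def cnorm_ge0 andbT cnorm_eq0. Qed.

Lemma cnorm_Re z : `|complex.Re z| <= cnorm z.
Proof.
by rewrite cnormE -sqrtr_sqr ler_sqrt ?addr_ge0 ?sqr_ge0 // lerDl sqr_ge0.
Qed.
Lemma cnorm_Im z : `|complex.Im z| <= cnorm z.
Proof.
by rewrite cnormE -sqrtr_sqr ler_sqrt ?addr_ge0 ?sqr_ge0 // lerDr sqr_ge0.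
Qed.
Lemma cnorm_ReIm z : cnorm z <= `|complex.Re z| + `|complex.Im z|.
Proof.
rewrite {1}(complexE z) (le_trans (cnormD _ _)) //.
by rewrite cnormM cnormi mul1r !cnorm_real.
Qed.

Lemma cnorm_sum (I : finType) (f : I -> C) : cnorm (\sum_i f i) <= \sum_i cnorm (f i).
Proof.
elim/big_ind2: _ => // [|x1 x2 y1 y2 H1 H2]; first by rewrite cnorm0.
by rewrite (le_trans (cnormD _ _)) // lerD.
Qed.

Lemma disc_center z (r : R) : 0 < r -> disc z r z.
Proof. by rewrite /disc /= subrr cnorm0. Qed.

Lemma disc_sub z (r s : R) : r <= s -> disc z r `<=` disc z s.
Proof. by move=> rs w /lt_le_trans; apply. Qed.

Lemma disc_disc z w (r : R) : disc z r w -> disc w (r - cnorm (w - z)) `<=` disc z r.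
Proof.
move=> H v /=; rewrite /disc /= ltrBrDr; apply: le_lt_trans.
by rewrite -(subrKA w v) cnormD.
Qed.

End Cnorm.

Section ComplexCalculus.
Context {R : realType}.
Local Notation C := R[i].
Local Notation II := (@Complex R 0 1).
Local Notation cj := (@conjc R).
Implicit Types (f g : C -> C) (z w : C) (U V : set C).

Lemma toC_K p : @ofC R (toC p) = p. Proof. by case: p. Qed.
Lemma ofC_K z : toC (ofC z) = z. Proof. by case: z. Qed.
Lemma toCB p q : @toC R p - toC q = toC (p - q). Proof. by case: p; case: q. Qed.
Lemma cnorm_toC (p : R * R) : cnorm (toC p) <= `|p| + `|p|.
Proof.
apply: (le_trans (cnorm_ReIm _)); apply: lerD; [exact: normp_fst | exact: normp_snd].
Qed.
Lemma normp_ofC z : `|ofC z| <= cnorm z.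
Proof. by rewrite normp_le cnorm_Re cnorm_Im. Qed.
Lemma ofCB z w : ofC z - ofC w = ofC (z - w). Proof. by case: z; case: w. Qed.

Definition copen U := open (@toC R @^-1` U).

Lemma nbhs_cP z (A : set (R * R)) : nbhs (ofC z) A <->
  exists2 e : R, 0 < e & forall w, cnorm (w - z) < e -> A (ofC w).
Proof.
split=> [/nbhs_pP[e e0 H]|[e e0 H]].
  exists e => // w Hw; apply: H; rewrite ofCB; exact: le_lt_trans (normp_ofC _) Hw.
apply/nbhs_pP; exists (e / 2) => [|q Hq]; first by rewrite divr_gt0.
rewrite -(toC_K q); apply: H; rewrite -[z]ofC_K toCB.
by apply: le_lt_trans (cnorm_toC _) _; rewrite [e]splitr ltrD.
Qed.

Lemma copenP U : copen U <-> forall z, U z -> exists2 e : R, 0 < e & disc z e `<=` U.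
Proof.
rewrite /copen openE /interior; split=> [H z Uz|H p Up].
  have /H : (@toC R @^-1` U) (ofC z) by rewrite /preimage /= ofC_K.
  move=> /nbhs_cP [e e0 He]; exists e => // w Hw.
  by have := He w Hw; rewrite /preimage /= ofC_K.
have [e e0 He] := H (toC p) Up.
rewrite -(toC_K p); apply/nbhs_cP; exists e => // w Hw.
by rewrite /preimage /= ofC_K; apply: He.
Qed.

Lemma copen_disc z (r : R) : copen (disc z r).
Proof.
apply/copenP => w Hw; exists (r - cnorm (w - z)); first by rewrite subr_gt0.
exact: disc_disc.
Qed.

Lemma copenT : copen setT. Proof. exact: openT. Qed.

Lemma near_eq U f g z : copen U -> U z -> (forall w, U w -> f w = g w) ->
  (\forall p \near ofC z, rpart f p = rpart g p) /\
  (\forall p \near ofC z, ipart f p = ipart g p).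
Proof.
move=> /copenP oU /oU [e e0 He] E.
by split; apply/nbhs_cP; exists e => // w /He Uw; rewrite /rpart /ipart ofC_K E.
Qed.

Definition cdiff f z := differentiable (rpart f) (ofC z) /\ differentiable (ipart f) (ofC z).

Definition cd (b : bool) f : C -> C := fun z =>
  'D_(dir b) (rpart f) (ofC z) +i* 'D_(dir b) (ipart f) (ofC z).

(** Both Wirtinger derivatives at once, so that each rule is proved once. *)
Definition W (s : bool) f : C -> C := if s then delbar f else del f.

Lemma rpart_cd b f : rpart (cd b f) = 'D_(dir b) (rpart f).
Proof. by apply/funext => p; rewrite /rpart /cd /= toC_K. Qed.
Lemma ipart_cd b f : ipart (cd b f) = 'D_(dir b) (ipart f).
Proof. by apply/funext => p; rewrite /ipart /cd /= toC_K. Qed.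

Lemma WE s f z : W s f z = (cd false f z + (if s then II else - II) * cd true f z) / 2.
Proof. by case: s => //; rewrite /W /del mulNr. Qed.

Lemma i2 : II * II = -1. Proof. by rewrite -expr2 sqr_i. Qed.

Lemma two_neq0 : (2 : C) != 0. Proof. by rewrite pnatr_eq0. Qed.

Lemma cdE b f z : cd b f z = (if b then II else 1) *
  (del f z + (if b then -1 else 1) * delbar f z).
Proof.
rewrite -[del f z]/(W false f z) -[delbar f z]/(W true f z) !WE.
have E := i2.
have F := two_neq0.
case: b; last by field.
by transitivity (- (II * II) * cd true f z); [rewrite E opprK mul1r | field].
Qed.

Lemma cd_eq U b f g z : copen U -> U z -> (forall w, U w -> f w = g w) -> cd b f z = cd b g z.
Proof.
move=> oU Uz E; have [N1 N2] := near_eq oU Uz E.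
by rewrite /cd (near_eq_derive _ N1) (near_eq_derive _ N2).
Qed.

Lemma W_eq U s f g z : copen U -> U z -> (forall w, U w -> f w = g w) -> W s f z = W s g z.
Proof. by move=> oU Uz E; rewrite !WE !(cd_eq _ oU Uz E). Qed.

Lemma cdiffD f g z : cdiff f z -> cdiff g z -> cdiff (fun w => f w + g w) z.
Proof.
move=> [f1 f2] [g1 g2]; split.
  rewrite (_ : rpart _ = rpart f + rpart g); first exact: differentiableD.
  by apply/funext => p; rewrite /rpart ReD.
rewrite (_ : ipart _ = ipart f + ipart g); first exact: differentiableD.
by apply/funext => p; rewrite /ipart ImD.
Qed.

Lemma cdD b f g z : cdiff f z -> cdiff g z -> cd b (fun w => f w + g w) z = cd b f z + cd b g z.
Proof.
move=> [f1 f2] [g1 g2]; rewrite /cd.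
rewrite (_ : rpart _ = rpart f + rpart g); last first.
  by apply/funext => p; rewrite /rpart ReD.
rewrite (_ : ipart _ = ipart f + ipart g); last first.
  by apply/funext => p; rewrite /ipart ImD.
by rewrite !deriveD //; apply: diff_derivable.
Qed.

Lemma rpartM f g : rpart (fun w => f w * g w) = rpart f * rpart g - ipart f * ipart g.
Proof. by apply/funext => p; rewrite /rpart ReM. Qed.
Lemma ipartM f g : ipart (fun w => f w * g w) = rpart f * ipart g + ipart f * rpart g.
Proof. by apply/funext => p; rewrite /ipart ImM. Qed.

Lemma cdiffM f g z : cdiff f z -> cdiff g z -> cdiff (fun w => f w * g w) z.
Proof.
move=> [f1 f2] [g1 g2]; split.
  by rewrite rpartM; apply: differentiableB; apply: differentiableM.
by rewrite ipartM; apply: differentiableD; apply: differentiableM.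
Qed.

Lemma derive_mul_pm (F G H K : R * R -> R) p v :
  differentiable F p -> differentiable G p -> differentiable H p -> differentiable K p ->
  'D_v (F * G - H * K) p = F p * 'D_v G p + G p * 'D_v F p - (H p * 'D_v K p + K p * 'D_v H p) /\
  'D_v (F * G + H * K) p = F p * 'D_v G p + G p * 'D_v F p + (H p * 'D_v K p + K p * 'D_v H p).
Proof.
move=> /(@diff_derivable _ _ _ _ _ v) f /(@diff_derivable _ _ _ _ _ v) g.
move=> /(@diff_derivable _ _ _ _ _ v) h /(@diff_derivable _ _ _ _ _ v) k.
have E1 := deriveM f g; have E2 := deriveM h k.
have D1 := derivableM f g; have D2 := derivableM h k.
by split; [rewrite (deriveB D1 D2) | rewrite (deriveD D1 D2)]; rewrite E1 E2.
Qed.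

Lemma cdM b f g z : cdiff f z -> cdiff g z ->
  cd b (fun w => f w * g w) z = cd b f z * g z + f z * cd b g z.
Proof.
move=> [f1 f2] [g1 g2].
rewrite /cd rpartM ipartM.
have [-> _] := derive_mul_pm (dir b) f1 g1 f2 g2.
have [_ ->] := derive_mul_pm (dir b) f1 g2 f2 g1.
move: ('D_(dir b) (rpart f) (ofC z)) ('D_(dir b) (ipart f) (ofC z))
  ('D_(dir b) (rpart g) (ofC z)) ('D_(dir b) (ipart g) (ofC z)) => a1 a2 a3 a4.
rewrite /rpart /ipart ofC_K.
by apply: complex_ext; rewrite ?ReD ?ImD ?ReM ?ImM /=; ring.
Qed.

Lemma cdiff_cst (c : C) z : cdiff (fun=> c) z.
Proof. by split; exact: differentiable_cst. Qed.

Lemma cd_cst b (c : C) z : cd b (fun=> c) z = 0.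
Proof.
rewrite /cd (_ : rpart _ = cst (complex.Re c)) // (_ : ipart _ = cst (complex.Im c)) //.
by rewrite !derive_cst.
Qed.

Lemma rpart_id : rpart (fun w : C => w) = lform 1 0.
Proof. by apply/funext => p; rewrite /rpart /lform /= mul1r mul0r addr0. Qed.
Lemma ipart_id : ipart (fun w : C => w) = lform 0 1.
Proof. by apply/funext => p; rewrite /ipart /lform /= mul1r mul0r add0r. Qed.

Lemma cdiff_id z : cdiff (fun w => w) z.
Proof. by split; rewrite ?rpart_id ?ipart_id; exact: lform_diff. Qed.

Lemma cd_id b z : cd b (fun w => w) z = if b then II else 1.
Proof.
rewrite /cd rpart_id ipart_id !derive_lform /lform /dir; case: b => /=;
by rewrite ?mul0r ?mulr0 ?mul1r ?addr0 ?add0r.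
Qed.

Lemma ipartJ f : ipart (fun w => cj (f w)) = - ipart f.
Proof. by apply/funext => p; change (complex.Im (cj (f (toC p))) = - complex.Im (f (toC p))); case: (f _). Qed.
Lemma rpartJ f : rpart (fun w => cj (f w)) = rpart f.
Proof. by apply/funext => p; rewrite /rpart; case: (f _). Qed.

Lemma cdiffJ f z : cdiff f z -> cdiff (fun w => cj (f w)) z.
Proof. by move=> [f1 f2]; split; rewrite ?rpartJ ?ipartJ //; exact: differentiableN. Qed.

Lemma cdJ b f z : cdiff f z -> cd b (fun w => cj (f w)) z = cj (cd b f z).
Proof.
move=> [f1 f2]; rewrite /cd rpartJ ipartJ deriveN //; exact: diff_derivable.
Qed.

Lemma cd_comp b f g z : cdiff g z -> cdiff f (g z) ->
  cdiff (fun w => f (g w)) z /\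
  cd b (fun w => f (g w)) z = del f (g z) * cd b g z + delbar f (g z) * cj (cd b g z).
Proof.
move=> [g1 g2] [f1 f2].
have Er : rpart (fun w => f (g w)) = fun p => rpart f (rpart g p, ipart g p).
  by apply/funext => p; rewrite /rpart /ipart /toC /=; congr (complex.Re (f _)); case: (g _).
have Ei : ipart (fun w => f (g w)) = fun p => ipart f (rpart g p, ipart g p).
  by apply/funext => p; rewrite /rpart /ipart /toC /=; congr (complex.Im (f _)); case: (g _).
have Eg : (rpart g (ofC z), ipart g (ofC z)) = ofC (g z) by rewrite /rpart /ipart ofC_K.
rewrite -Eg in f1 f2.
have [D1 E1] := derive_pair_comp (dir b) g1 g2 f1.
have [D2 E2] := derive_pair_comp (dir b) g1 g2 f2.
split; first by split; rewrite ?Er ?Ei.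
rewrite {1}/cd Er Ei E1 E2 Eg.
have Hd c : 'D_(dir c) (rpart f) (ofC (g z)) +i* 'D_(dir c) (ipart f) (ofC (g z)) = cd c f (g z) by [].
set u := cd b g z.
have Eu1 : 'D_(dir b) (rpart g) (ofC z) = complex.Re u by [].
have Eu2 : 'D_(dir b) (ipart g) (ofC z) = complex.Im u by [].
rewrite Eu1 Eu2.
have E0 := cdE false f (g z); have E1' := cdE true f (g z).
rewrite /= mul1r mul1r in E0; rewrite /= mulN1r in E1'.
transitivity (cd false f (g z) * (complex.Re u)%:C + cd true f (g z) * (complex.Im u)%:C).
  rewrite -!Hd; move: ('D_(dir false) _ _) ('D_(dir false) _ _) ('D_(dir true) _ _) ('D_(dir true) _ _) => a1 a2 a3 a4.
  by apply: complex_ext; rewrite ?ReD ?ImD ?ReM ?ImM /=; ring.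
rewrite E0 E1'.
have -> : cj u = (complex.Re u)%:C - II * (complex.Im u)%:C.
  by case: (u) => x y; apply: complex_ext; rewrite ?ReD ?ImD ?ReN ?ImN ?ReM ?ImM /=; ring.
rewrite {3}(complexE u); ring.
Qed.

Lemma WD s f g z : cdiff f z -> cdiff g z -> W s (fun w => f w + g w) z = W s f z + W s g z.
Proof.
move=> f1 g1; rewrite !WE !cdD //.
move: (cd _ f z) (cd _ f z) (cd _ g z) (cd _ g z) (if s then _ else _) (2 : C)^-1 => A B A' B' S h.
by rewrite mulrDr addrACA mulrDl.
Qed.

Lemma WM s f g z : cdiff f z -> cdiff g z ->
  W s (fun w => f w * g w) z = W s f z * g z + f z * W s g z.
Proof.
move=> f1 g1; rewrite !WE !cdM //.
move: (cd _ f z) (cd _ f z) (cd _ g z) (cd _ g z) (if s then _ else _) (2 : C)^-1 (f z) (g z).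
move=> A B A' B' S h x y; rewrite mulrDr addrACA mulrDl.
congr (_ + _); first by rewrite mulrA -mulrDl mulrAC.
by rewrite mulrCA -mulrDr mulrA.
Qed.

Lemma W_cst s c z : W s (fun=> c) z = 0.
Proof. by rewrite WE !cd_cst mulr0 addr0 mul0r. Qed.

Lemma WZ s (c : C) f z : cdiff f z -> W s (fun w => c * f w) z = c * W s f z.
Proof. by move=> D; rewrite WM ?W_cst ?mul0r ?add0r //; exact: cdiff_cst. Qed.

Lemma cdiffZ (c : C) f z : cdiff f z -> cdiff (fun w => c * f w) z.
Proof. by move=> D; apply: cdiffM => //; exact: cdiff_cst. Qed.

Lemma W_id s z : W s (fun w => w) z = if s then 0 else 1.
Proof.
rewrite WE !cd_id; case: s; rewrite ?mulNr i2 ?subrr ?mul0r // opprK.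
by field.
Qed.

Lemma conj_half : cj 2^-1 = 2^-1.
Proof. by rewrite conjc_inv conjc_nat. Qed.

Lemma WJ s f z : cdiff f z -> W s (fun w => cj (f w)) z = cj (W (~~ s) f z).
Proof.
move=> D; rewrite !WE !cdJ // cjM cjD cjM conj_half.
by congr ((_ + _ * _) / _); case: s => /=; apply: complex_ext => /=; ring.
Qed.

(** A real-linear endomorphism of C is u |-> p u + q (conj u); these are the coefficients of
    the composite of two such maps. *)
Lemma W_comp s f g z : cdiff g z -> cdiff f (g z) ->
  W s (fun w => f (g w)) z = del f (g z) * W s g z + delbar f (g z) * cj (W (~~ s) g z).
Proof.
move=> D1 D2; rewrite !WE.
have [_ ->] := cd_comp false D1 D2; have [_ ->] := cd_comp true D1 D2.
rewrite cjM cjD cjM conj_half.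
have -> : cj (if ~~ s then II else - II) = (if s then II else - II) :> C.
  by case: s => /=; apply: complex_ext => /=; ring.
have alg (K : comPzRingType) (p q x y x' y' S h : K) :
  (p * x + q * x' + S * (p * y + q * y')) * h = p * ((x + S * y) * h) + q * ((x' + S * y') * h) by ring.
exact: alg.
Qed.

Lemma cdiff_comp f g z : cdiff g z -> cdiff f (g z) -> cdiff (fun w => f (g w)) z.
Proof. by move=> D1 D2; have [] := cd_comp false D1 D2. Qed.

End ComplexCalculus.

#[global] Arguments del : simpl never.
#[global] Arguments delbar : simpl never.
#[global] Arguments W : simpl never.
#[global] Arguments cd : simpl never.
#[global] Arguments cnorm : simpl never.
#[global] Arguments dir : simpl never.
#[global] Arguments rpart : simpl never.
#[global] Arguments ipart : simpl never.
#[global] Opaque derive cnorm.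

(** * Smooth complex-valued functions *)

Section RealSmoothOps.
Context {R : realType}.
Implicit Types (F G : R * R -> R) (U V : set (R * R)).

Lemma rsmoothD U F G : open U -> rsmooth_on U F -> rsmooth_on U G ->
  rsmooth_on U (fun p => F p + G p).
Proof. by move=> oU f g; apply: Sm_rsmooth => k; apply: (SmD oU); exact: (rsmooth_Sm oU). Qed.
Lemma rsmoothM U F G : open U -> rsmooth_on U F -> rsmooth_on U G ->
  rsmooth_on U (fun p => F p * G p).
Proof. by move=> oU f g; apply: Sm_rsmooth => k; apply: (SmM oU); exact: (rsmooth_Sm oU). Qed.
Lemma rsmooth_cst U (c : R) : rsmooth_on U (fun=> c).
Proof. by apply: Sm_rsmooth => k; exact: Sm_cst. Qed.
Lemma rsmoothN U F : open U -> rsmooth_on U F -> rsmooth_on U (fun p => - F p).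
Proof.
move=> oU f; have K := rsmoothM oU (@rsmooth_cst U (-1)) f.
by apply: (rsmooth_eq oU _ K) => p _; rewrite mulN1r.
Qed.
Lemma rsmoothV U F : open U -> (forall p, U p -> F p != 0) -> rsmooth_on U F ->
  rsmooth_on U (fun p => (F p)^-1).
Proof. by move=> oU nz f; apply: Sm_rsmooth => k; apply: (SmV oU nz); exact: (rsmooth_Sm oU). Qed.
Lemma rsmooth_comp U V F G1 G2 : open U -> open V ->
  (forall p, V p -> U (G1 p, G2 p)) -> rsmooth_on U F -> rsmooth_on V G1 -> rsmooth_on V G2 ->
  rsmooth_on V (fun p => F (G1 p, G2 p)).
Proof.
move=> oU oV UV f g1 g2; apply: Sm_rsmooth => k.
by apply: (Sm_comp oU oV UV); [exact: (rsmooth_Sm oU) | exact: (rsmooth_Sm oV) | exact: (rsmooth_Sm oV)].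
Qed.
End RealSmoothOps.

Section ComplexSmooth.
Context {R : realType}.
Local Notation C := R[i].
Local Notation II := (@Complex R 0 1).
Local Notation cj := (@conjc R).
Implicit Types (f g : C -> C) (z w : C) (U V : set C).

Lemma csmooth_sub U V f : U `<=` V -> csmooth_on V f -> csmooth_on U f.
Proof. by move=> UV [f1 f2]; split; [apply: rsmooth_sub f1 | apply: rsmooth_sub f2] => p /UV. Qed.

Lemma csmooth_local U f :
  (forall z, U z -> exists2 V : set C, V z & csmooth_on V f) -> csmooth_on U f.
Proof.
move=> H; split=> l p Up.
  by have [V Vp [sf _]] := H _ Up; exact: sf.
by have [V Vp [_ sf]] := H _ Up; exact: sf.
Qed.

Lemma csmooth_eq U f g : copen U -> (forall z, U z -> f z = g z) ->
  csmooth_on U f -> csmooth_on U g.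
Proof.
move=> oU E [f1 f2]; split.
  by apply: (rsmooth_eq oU _ f1) => p Up; rewrite /rpart E.
by apply: (rsmooth_eq oU _ f2) => p Up; rewrite /ipart E.
Qed.

Lemma csmooth_cdiff U f z : copen U -> csmooth_on U f -> U z -> cdiff f z.
Proof.
move=> oU [f1 f2] Uz.
by split; [apply: rsmooth_diff oU f1 _ | apply: rsmooth_diff oU f2 _]; rewrite /preimage /= ofC_K.
Qed.

Lemma csmooth_cst U (c : C) : csmooth_on U (fun=> c).
Proof. by split; exact: rsmooth_cst. Qed.

Lemma csmooth_id U : csmooth_on U (fun z => z).
Proof.
by split; rewrite ?rpart_id ?ipart_id; apply: Sm_rsmooth => k; exact: Sm_lform.
Qed.

Lemma csmoothD U f g : copen U -> csmooth_on U f -> csmooth_on U g ->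
  csmooth_on U (fun z => f z + g z).
Proof.
move=> oU [f1 f2] [g1 g2]; split.
  by apply: (rsmooth_eq oU _ (rsmoothD oU f1 g1)) => p _; rewrite /rpart ReD.
by apply: (rsmooth_eq oU _ (rsmoothD oU f2 g2)) => p _; rewrite /ipart ImD.
Qed.

Lemma csmoothM U f g : copen U -> csmooth_on U f -> csmooth_on U g ->
  csmooth_on U (fun z => f z * g z).
Proof.
move=> oU [f1 f2] [g1 g2]; split.
  apply: (rsmooth_eq oU _ (rsmoothD oU (rsmoothM oU f1 g1) (rsmoothN oU (rsmoothM oU f2 g2)))).
  by move=> p _; rewrite /rpart ReM.
apply: (rsmooth_eq oU _ (rsmoothD oU (rsmoothM oU f1 g2) (rsmoothM oU f2 g1))).
by move=> p _; rewrite /ipart ImM.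
Qed.

Lemma csmoothZ U (c : C) f : copen U -> csmooth_on U f -> csmooth_on U (fun z => c * f z).
Proof. by move=> oU sf; exact: (csmoothM oU (@csmooth_cst U c) sf). Qed.

Lemma csmoothN U f : copen U -> csmooth_on U f -> csmooth_on U (fun z => - f z).
Proof.
by move=> oU sf; apply: (csmooth_eq oU _ (csmoothZ (-1) oU sf)) => z _; rewrite mulN1r.
Qed.

Lemma csmoothJ U f : copen U -> csmooth_on U f -> csmooth_on U (fun z => cj (f z)).
Proof.
move=> oU [f1 f2]; split; first by rewrite rpartJ.
by rewrite ipartJ; apply: rsmoothN.
Qed.

Lemma csmooth_sum U (I : Type) (r : seq I) (P : pred I) (f : I -> C -> C) : copen U ->
  (forall i, P i -> csmooth_on U (f i)) -> csmooth_on U (fun z => \sum_(i <- r | P i) f i z).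
Proof.
move=> oU sf; elim: r => [|i r IH].
  by apply: (csmooth_eq oU _ (csmooth_cst U 0)) => z _; rewrite big_nil.
case: (boolP (P i)) => Pi.
  by apply: (csmooth_eq oU _ (csmoothD oU (sf i Pi) IH)) => z _; rewrite big_cons Pi.
by apply: (csmooth_eq oU _ IH) => z _; rewrite big_cons (negbTE Pi).
Qed.

Lemma csmooth_prod U (I : Type) (r : seq I) (P : pred I) (f : I -> C -> C) : copen U ->
  (forall i, P i -> csmooth_on U (f i)) -> csmooth_on U (fun z => \prod_(i <- r | P i) f i z).
Proof.
move=> oU sf; elim: r => [|i r IH].
  by apply: (csmooth_eq oU _ (csmooth_cst U 1)) => z _; rewrite big_nil.
case: (boolP (P i)) => Pi.
  by apply: (csmooth_eq oU _ (csmoothM oU (sf i Pi) IH)) => z _; rewrite big_cons Pi.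
by apply: (csmooth_eq oU _ IH) => z _; rewrite big_cons (negbTE Pi).
Qed.

Lemma csmoothX U f k : copen U -> csmooth_on U f -> csmooth_on U (fun z => f z ^+ k).
Proof.
move=> oU sf; elim: k => [|k IH]; first exact: csmooth_cst.
by apply: (csmooth_eq oU _ (csmoothM oU sf IH)) => z _; rewrite exprS.
Qed.

Lemma csmoothV U f : copen U -> (forall z, U z -> f z != 0) -> csmooth_on U f ->
  csmooth_on U (fun z => (f z)^-1).
Proof.
move=> oU nz [f1 f2].
pose N p := rpart f p * rpart f p + ipart f p * ipart f p.
have sN : rsmooth_on (@toC R @^-1` U) N.
  by apply: (rsmoothD oU); apply: (rsmoothM oU).
have N0 p : U (toC p) -> N p != 0.
  move=> /nz; rewrite -cnorm_gt0 => H.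
  by rewrite /N /rpart /ipart -!expr2 -cnorm_sqr expf_neq0 // gt_eqF.
have sNV := rsmoothV oU N0 sN.
split.
  apply: (rsmooth_eq oU _ (rsmoothM oU f1 sNV)) => p _.
  by rewrite /N /rpart /ipart; case: (f _) => a b /=; rewrite -!expr2.
apply: (rsmooth_eq oU _ (rsmoothN oU (rsmoothM oU f2 sNV))) => p _.
by rewrite /N /rpart /ipart; case: (f _) => a b /=; rewrite -!expr2.
Qed.

Lemma csmooth_comp U V f g : copen U -> copen V -> (forall z, V z -> U (g z)) ->
  csmooth_on U f -> csmooth_on V g -> csmooth_on V (fun z => f (g z)).
Proof.
move=> oU oV UV [f1 f2] [g1 g2].
have UV' p : (@toC R @^-1` V) p -> (@toC R @^-1` U) (rpart g p, ipart g p).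
  by rewrite /preimage /= => /UV; rewrite /rpart /ipart /toC /=; case: (g _).
split.
  apply: (rsmooth_eq oV _ (rsmooth_comp oU oV UV' f1 g1 g2)) => p Vp.
  by rewrite /rpart /ipart /toC /=; congr (complex.Re (f _)); case: (g _).
apply: (rsmooth_eq oV _ (rsmooth_comp oU oV UV' f2 g1 g2)) => p Vp.
by rewrite /rpart /ipart /toC /=; congr (complex.Im (f _)); case: (g _).
Qed.

Lemma csmooth_cd U b f : csmooth_on U f -> csmooth_on U (cd b f).
Proof. by move=> [f1 f2]; split; rewrite ?rpart_cd ?ipart_cd; exact: rsmooth_partial. Qed.

Lemma csmoothW U s f : copen U -> csmooth_on U f -> csmooth_on U (W s f).
Proof.
move=> oU sf; pose e := if s then II else - II.
have K := csmoothZ (2^-1) oU (csmoothD oU (csmooth_cd false sf) (csmoothZ e oU (csmooth_cd true sf))).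
by apply: (csmooth_eq oU _ K) => z _; rewrite WE mulrC.
Qed.

Lemma cd_def b f z : cd b f z =
  'D_(dir b) (rpart f) (ofC z) +i* 'D_(dir b) (ipart f) (ofC z).
Proof. by []. Qed.

Lemma cd_swap U b c f z : copen U -> csmooth_on U f -> U z -> cd b (cd c f) z = cd c (cd b f) z.
Proof.
move=> oU [f1 f2] Uz.
have Uz' : (@toC R @^-1` U) (ofC z) by rewrite /preimage /= ofC_K.
have S F : rsmooth_on (@toC R @^-1` U) F ->
    'D_(dir b) ('D_(dir c) F) (ofC z) = 'D_(dir c) ('D_(dir b) F) (ofC z).
  move=> sF; have E := schwarz oU sF Uz'.
  by case: b; case: c; [reflexivity | exact: E | exact: esym E | reflexivity].
have E b' c' : cd b' (cd c' f) z = 'D_(dir b') ('D_(dir c') (rpart f)) (ofC z) +i*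
    'D_(dir b') ('D_(dir c') (ipart f)) (ofC z).
  by rewrite [LHS]cd_def rpart_cd ipart_cd.
by rewrite !E (S _ f1) (S _ f2).
Qed.

Lemma cdW U b s f z : copen U -> csmooth_on U f -> U z -> cd b (W s f) z = W s (cd b f) z.
Proof.
move=> oU sf Uz; pose e := if s then II else - II.
have s0 := csmooth_cd false sf; have s1 := csmooth_cd true sf.
have d0 := csmooth_cdiff oU s0 Uz; have d1 := csmooth_cdiff oU s1 Uz.
have dc c := cdiff_cst c z.
have E : W s f = fun w => 2^-1 * (cd false f w + e * cd true f w).
  by apply/funext => w; rewrite WE mulrC.
rewrite E cdM ?cd_cst; [|exact: dc|by apply: cdiffD => //; apply: cdiffZ].
rewrite mul0r add0r cdD //; last exact: cdiffZ.
rewrite cdM ?cd_cst ?mul0r ?add0r //.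
by rewrite WE mulrC (cd_swap b false oU sf Uz) (cd_swap b true oU sf Uz).
Qed.

(** From the commutation of real partial derivatives, by linearity. *)
Lemma W_swap U s t f z : copen U -> csmooth_on U f -> U z -> W s (W t f) z = W t (W s f) z.
Proof.
move=> oU sf Uz; rewrite [LHS]WE !(cdW _ _ oU sf Uz).
pose e := if s then II else - II.
have s0 := csmooth_cd false sf; have s1 := csmooth_cd true sf.
have d0 := csmooth_cdiff oU s0 Uz; have d1 := csmooth_cdiff oU s1 Uz.
have E : W s f = fun w => 2^-1 * (cd false f w + e * cd true f w).
  by apply/funext => w; rewrite WE mulrC.
rewrite E WZ; last by apply: cdiffD => //; apply: cdiffZ.
by rewrite WD //; [rewrite WZ // mulrC | apply: cdiffZ].
Qed.

Lemma csmooth_cont U f z : copen U -> csmooth_on U f -> U z ->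
  forall e : R, 0 < e -> exists2 d : R, 0 < d & forall w, cnorm (w - z) < d -> cnorm (f w - f z) < e.
Proof.
move=> oU sf Uz e e0.
have [/differentiable_continuous f1 /differentiable_continuous f2] := csmooth_cdiff oU sf Uz.
have e20 : 0 < e / 2 by rewrite divr_gt0.
have /cvgrPdist_lt /(_ _ e20) /nbhs_cP [d1 d10 H1] := f1.
have /cvgrPdist_lt /(_ _ e20) /nbhs_cP [d2 d20 H2] := f2.
exists (Num.min d1 d2) => [|w]; first by rewrite lt_min d10.
rewrite lt_min => /andP[/H1 K1 /H2 K2].
rewrite cnorm_dist; apply: le_lt_trans (cnorm_ReIm _) _.
rewrite ReD ImD ReN ImN [e]splitr.
by move: K1 K2; rewrite /rpart /ipart !ofC_K => K1 K2; rewrite ltrD.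
Qed.

Lemma cnorm_cd b f z : cnorm (cd b f z) <= cnorm (del f z) + cnorm (delbar f z).
Proof.
rewrite cdE cnormM; case: b => /=; rewrite ?cnormi ?cnorm1 mul1r; last first.
  by rewrite mul1r cnormD.
by rewrite mulN1r cnormB.
Qed.

(** The factor 8: two components, two real partial derivatives, each of them a combination
    of two Wirtinger derivatives. *)
Lemma mvt_disc f z (r : R) (K : R) : csmooth_on (disc z r) f ->
  (forall w, disc z r w -> forall s, cnorm (W s f w) <= K) ->
  forall w, disc z r w -> cnorm (f w - f z) <= 8 * K * cnorm (w - z).
Proof.
move=> sf HK w Hw.
have oD := @copen_disc R z r.
have seg (s : R) : 0 <= s <= 1 -> disc z r (toC (ofC z + s *: ofC (w - z))).
  move=> /andP[s0 s1]; rewrite /disc /=.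
  have -> : toC (ofC z + s *: ofC (w - z)) - z = s%:C * (w - z).
    case: (z) => a b; case: (w) => c d; apply: complex_ext;
    rewrite ?ReD ?ImD ?ReN ?ImN ?ReM ?ImM /= ?ReD ?ImD ?ReN ?ImN /=;
    rewrite /GRing.scale /=; ring.
  rewrite cnormM cnorm_real ger0_norm //; apply: le_lt_trans Hw.
  by rewrite ler_piMl ?cnorm_ge0.
have r0 : 0 < r by apply: le_lt_trans Hw; exact: cnorm_ge0.
have K0 : 0 <= K by apply: le_trans (HK z (disc_center z r0) false); exact: cnorm_ge0.
have main (F : R * R -> R) : (forall p, disc z r (toC p) -> differentiable F p /\
     forall b, `|'D_(dir b) F p| <= 2 * K) ->
    `|F (ofC w) - F (ofC z)| <= 4 * K * cnorm (w - z).
  move=> HF.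
  have [s Hs|s Hs] := @mvt01 R F (ofC z) (ofC (w - z)).
    by have [D _] := HF _ (seg s Hs); apply: diff_derivable.
  have [D B] := HF _ (seg s Hs).
  have -> : ofC z + ofC (w - z) = ofC w.
    by rewrite -ofCB addrC subrK.
  move=> ->; rewrite (deriveE _ D) diff_dir //= (le_trans (ler_normD _ _)) // !normrM.
  have := cnorm_Re (w - z); have := cnorm_Im (w - z).
  have := B false; have := B true.
  set a := `|'D_(dir false) _ _|; set b := `|'D_(dir true) _ _| => b1 a1.
  move=> i1 r1.
  have -> : 4 * K * cnorm (w - z) = cnorm (w - z) * (2 * K) + cnorm (w - z) * (2 * K) by ring.
  apply: lerD; first exact: (ler_pM (normr_ge0 _) (normr_ge0 _) r1 a1).
  exact: (ler_pM (normr_ge0 _) (normr_ge0 _) i1 b1).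
have Hcd b p : disc z r (toC p) -> cnorm (cd b f (toC p)) <= 2 * K.
  move=> Hp; apply: le_trans (cnorm_cd _ _ _) _.
  have := HK _ Hp false; have := HK _ Hp true.
  by move: (cnorm _) (cnorm _) => x y; lra.
have A1 : `|rpart f (ofC w) - rpart f (ofC z)| <= 4 * K * cnorm (w - z).
  apply: main => p Hp; have [D _] := csmooth_cdiff oD sf Hp.
  split; first by rewrite -[p]toC_K.
  move=> b; apply: le_trans (Hcd b p Hp); apply: le_trans (cnorm_Re _).
  by rewrite /cd /= toC_K.
have A2 : `|ipart f (ofC w) - ipart f (ofC z)| <= 4 * K * cnorm (w - z).
  apply: main => p Hp; have [_ D] := csmooth_cdiff oD sf Hp.
  split; first by rewrite -[p]toC_K.
  move=> b; apply: le_trans (Hcd b p Hp); apply: le_trans (cnorm_Im _).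
  by rewrite /cd /= toC_K.
apply: le_trans (cnorm_ReIm _) _; rewrite ReD ImD ReN ImN.
move: A1 A2; rewrite /rpart /ipart !ofC_K.
by move: (cnorm _) `|_| `|_| => x y t; lra.
Qed.

End ComplexSmooth.

#[global] Opaque csmooth_on.

(** * Flat germs *)

Section Flat.
Context {R : realType}.
Local Notation C := R[i].
Local Notation II := (@Complex R 0 1).
Local Notation cj := (@conjc R).
Implicit Types (f g : C -> C) (z w : C) (U V : set C) (l : seq bool).

Definition Wword l f : C -> C := foldr W f l.

Lemma Wword_rcons l s f : Wword (rcons l s) f = Wword l (W s f).
Proof. by rewrite /Wword foldr_rcons. Qed.

Lemma csmooth_Wword U l f : copen U -> csmooth_on U f -> csmooth_on U (Wword l f).
Proof. by move=> oU sf; elim: l => [|s l IH]; [exact: sf | exact: (csmoothW s oU IH)]. Qed.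

Lemma Wword_eq U l f g : copen U -> (forall z, U z -> f z = g z) ->
  forall z, U z -> Wword l f z = Wword l g z.
Proof.
move=> oU E; elim: l => [|s l IH] z Uz; first exact: E.
exact: (W_eq s oU Uz IH).
Qed.

Lemma WwordD U l f g : copen U -> csmooth_on U f -> csmooth_on U g ->
  forall z, U z -> Wword l (fun w => f w + g w) z = Wword l f z + Wword l g z.
Proof.
move=> oU sf sg; elim: l => //= s l IH z Uz.
rewrite (W_eq s oU Uz IH) WD; [by []| exact: (csmooth_cdiff oU (csmooth_Wword l oU sf) Uz) | exact: (csmooth_cdiff oU (csmooth_Wword l oU sg) Uz)].
Qed.

Lemma WwordZ U l (c : C) f : copen U -> csmooth_on U f ->
  forall z, U z -> Wword l (fun w => c * f w) z = c * Wword l f z.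
Proof.
move=> oU sf; elim: l => //= s l IH z Uz.
rewrite (W_eq s oU Uz IH) WZ; [by []| exact: (csmooth_cdiff oU (csmooth_Wword l oU sf) Uz)].
Qed.

Definition germ_smooth f := exists2 r : R, 0 < r & csmooth_on (disc 0 r) f.

Lemma germ2 f g : germ_smooth f -> germ_smooth g ->
  exists r : R, [/\ 0 < r, csmooth_on (disc 0 r) f & csmooth_on (disc 0 r) g].
Proof.
move=> [r r0 sf] [s s0 sg]; exists (Num.min r s); split; first by rewrite lt_min r0.
  by apply: csmooth_sub sf; apply: disc_sub; rewrite ge_min lexx.
by apply: csmooth_sub sg; apply: disc_sub; rewrite ge_min lexx orbT.
Qed.

Lemma germ_smoothD f g : germ_smooth f -> germ_smooth g -> germ_smooth (fun z => f z + g z).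
Proof.
move=> F G; have [r [r0 sf sg]] := germ2 F G.
by exists r; [exact: r0 | exact: (csmoothD (@copen_disc _ _ _) sf sg)].
Qed.
Lemma germ_smoothM f g : germ_smooth f -> germ_smooth g -> germ_smooth (fun z => f z * g z).
Proof.
move=> F G; have [r [r0 sf sg]] := germ2 F G.
by exists r; [exact: r0 | exact: (csmoothM (@copen_disc _ _ _) sf sg)].
Qed.
Lemma germ_smooth_cst (c : C) : germ_smooth (fun=> c).
Proof. by exists 1; [|exact: csmooth_cst]. Qed.
Lemma germ_smoothW s f : germ_smooth f -> germ_smooth (W s f).
Proof. by move=> [r r0 sf]; exists r; [exact: r0 | exact: (csmoothW s (@copen_disc _ _ _) sf)]. Qed.
(** All words in the two derivatives are allowed, so that flat functions are visibly closed
    under differentiation. *)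
Definition flat f := germ_smooth f /\ forall l, Wword l f 0 = 0.

Lemma flat0 f : flat f -> f 0 = 0. Proof. by move=> [_ /(_ [::])]. Qed.

Lemma flatW s f : flat f -> flat (W s f).
Proof.
by move=> [sf H]; split=> [|l]; [exact: germ_smoothW | rewrite -Wword_rcons H].
Qed.

Lemma flat_eq f g (r : R) : 0 < r -> (forall z, disc 0 r z -> f z = g z) -> flat f -> flat g.
Proof.
move=> r0 E [[s s0 sf] H].
have m0 : 0 < Num.min r s by rewrite lt_min r0.
have E' z : disc 0 (Num.min r s) z -> f z = g z.
  by move=> Hz; apply: E; apply: disc_sub Hz; rewrite ge_min lexx.
split.
  exists (Num.min r s); first exact: m0.
  apply: (csmooth_eq (@copen_disc _ _ _) E').
  by apply: csmooth_sub sf; apply: disc_sub; rewrite ge_min lexx orbT.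
by move=> l; rewrite -(Wword_eq l (@copen_disc _ _ _) E' (disc_center 0 m0)).
Qed.

Lemma flatD f g : flat f -> flat g -> flat (fun z => f z + g z).
Proof.
move=> [F Hf] [G Hg]; split; first exact: germ_smoothD.
have [r [r0 sf sg]] := germ2 F G => l.
by rewrite (WwordD l (@copen_disc _ _ _) sf sg (disc_center 0 r0)) Hf Hg addr0.
Qed.

(** By Leibniz' rule every word applied to f g is a sum of products with a derivative of f. *)
Lemma flatM f g : flat f -> germ_smooth g -> flat (fun z => f z * g z).
Proof.
move=> [F Hf] G; split; first exact: germ_smoothM.
have [r [r0 sf sg]] := germ2 F G => l.
have oD := @copen_disc R 0 r.
have D0 := @disc_center R 0 r r0.
elim/last_ind: l f g F G Hf sf sg => [|l s IH] f g F G Hf sf sg.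
  by rewrite /Wword /=; have := Hf [::]; rewrite /Wword /= => ->; rewrite mul0r.
rewrite Wword_rcons.
have E z : disc 0 r z -> W s (fun w => f w * g w) z = W s f z * g z + f z * W s g z.
  by move=> Hz; apply: WM; exact: csmooth_cdiff oD _ Hz.
rewrite (Wword_eq l oD E D0).
have sf' := csmoothW s oD sf; have sg' := csmoothW s oD sg.
rewrite (WwordD l oD (csmoothM oD sf' sg) (csmoothM oD sf sg') D0).
rewrite (IH _ _ (germ_smoothW s F) G _ sf' sg) => [|l']; last by rewrite -Wword_rcons Hf.
by rewrite (IH _ _ F (germ_smoothW s G) Hf sf sg') addr0.
Qed.

Lemma flatMl f g : flat f -> germ_smooth g -> flat (fun z => g z * f z).
Proof.
by move=> Ff Gg; apply: (flat_eq ltr01) (flatM Ff Gg) => z _; rewrite mulrC.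
Qed.

Lemma flatZ (c : C) f : flat f -> flat (fun z => c * f z).
Proof. by move=> Ff; apply: flatMl Ff _; exact: germ_smooth_cst. Qed.

Lemma flat_zero : flat (fun=> 0).
Proof.
split; first exact: germ_smooth_cst.
move=> l; have := @WwordZ setT l 0 (fun=> 0) (@copenT R) (csmooth_cst _ 0) 0 I.
by rewrite !mul0r.
Qed.

Lemma flat_sum (I : Type) (r : seq I) (f : I -> C -> C) :
  (forall i, flat (f i)) -> flat (fun z => \sum_(i <- r) f i z).
Proof.
move=> sf; elim: r => [|i r IH].
  by apply: (flat_eq ltr01) flat_zero => z _; rewrite big_nil.
by apply: (flat_eq ltr01) (flatD (sf i) IH) => z _; rewrite big_cons.
Qed.

(** Induction on N: the derivatives of f are O(|z|^N), hence f is O(|z|^(N+1)) by the mean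
    value estimate. *)
Lemma flat_bound f N : flat f -> exists r K : R, [/\ 0 < r, 0 <= K &
  forall z, disc 0 r z -> cnorm (f z) <= K * cnorm z ^+ N].
Proof.
elim: N f => [|N IH] f Ff.
  have [[r r0 sf] _] := Ff; have f0 := flat0 Ff.
  have [d d0 Hd] := csmooth_cont (@copen_disc _ _ _) sf (disc_center 0 r0) ltr01.
  exists d, 1; split=> // z /Hd; rewrite f0 subr0 expr0 mulr1; exact: ltW.
have [r1 [K1 [r10 K10 H1]]] := IH _ (flatW false Ff).
have [r2 [K2 [r20 K20 H2]]] := IH _ (flatW true Ff).
have [[r3 r30 sf] _] := Ff; have f0 := flat0 Ff.
pose r := Num.min r1 (Num.min r2 r3).
have r0 : 0 < r by rewrite !lt_min r10 r20.
have m1 : r <= r1 by rewrite ge_min lexx.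
have m2 : r <= r2 by rewrite !ge_min lexx orbT.
have m3 : r <= r3 by rewrite !ge_min lexx !orbT.
exists (r / 2), (8 * ((K1 + K2) * 2 ^+ N)); split.
- by rewrite divr_gt0.
- by rewrite !mulr_ge0 // ?addr_ge0 // exprn_ge0.
move=> z Hz; rewrite /disc /= subr0 in Hz.
have [->|z0] := eqVneq z 0; first by rewrite f0 cnorm0 expr0n /= mulr0.
have zp : 0 < cnorm z by rewrite cnorm_gt0.
have Zr : cnorm z * 2 < r by move: Hz; rewrite ltr_pdivlMr.
have Hd : disc 0 (cnorm z * 2) z by rewrite /disc /= subr0 ltr_pMr // ltr1n.
have sub : disc 0 (cnorm z * 2) `<=` (disc 0 r : set C) by apply: disc_sub; exact: ltW.
have := @mvt_disc R f 0 (cnorm z * 2) ((K1 + K2) * (cnorm z * 2) ^+ N) _ _ z Hd.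
rewrite f0 !subr0 => /(_ _ _)/le_trans; apply.
- apply: csmooth_sub sf; apply: (subset_trans sub); exact: disc_sub.
- move=> w Hw s; have Hw' := sub _ Hw.
  rewrite /disc /= subr0 in Hw.
  have Le : cnorm w ^+ N <= (cnorm z * 2) ^+ N.
    by apply: lerXn2r; rewrite ?nnegrE ?cnorm_ge0 ?mulr_ge0 ?cnorm_ge0 // ltW.
  have P0 : 0 <= cnorm w ^+ N by rewrite exprn_ge0 // cnorm_ge0.
  case: s.
    apply: (le_trans (H2 _ (disc_sub m2 Hw'))).
    by apply: ler_pM => //; rewrite lerDr.
  apply: (le_trans (H1 _ (disc_sub m1 Hw'))).
  by apply: ler_pM => //; rewrite lerDl.
by rewrite exprMn exprS; move: (cnorm z) (K1 + K2) => a b; rewrite le_eqVlt; apply/orP; left; apply/eqP; ring.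
Qed.

Definition ordered_word p q := nseq p false ++ nseq q true.

Lemma Wword_cat l l' f : Wword (l ++ l') f = Wword l (Wword l' f).
Proof. by rewrite /Wword foldr_cat. Qed.

(** The Taylor coefficients only see derivatives taken in one fixed order; the
   other orders follow because Wirtinger derivatives commute. *)
Lemma taylor0_flat f : germ_smooth f -> (forall p q, Wword (ordered_word p q) f 0 = 0) -> flat f.
Proof.
move=> G H; split=> [//|l].
elim/last_ind: l f G H => [|l s IH] f G H; first exact: (H 0%N 0%N).
rewrite Wword_rcons; apply: IH; first exact: germ_smoothW.
have [r r0 sf] := G; have oD := @copen_disc R 0 r; have D0 := @disc_center R 0 r r0.
case: s => p q.
  have := H p q.+1; rewrite /ordered_word !Wword_cat.
  by rewrite -addn1 nseqD cats1 Wword_rcons.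
have E z : disc 0 r z -> Wword (nseq q true) (W false f) z = W false (Wword (nseq q true) f) z.
  elim: q z => //= q IHq z Hz.
  rewrite (W_eq true oD Hz IHq); exact: (W_swap true false oD (csmooth_Wword _ oD sf) Hz).
rewrite /ordered_word Wword_cat (Wword_eq (nseq p false) oD E D0) -Wword_rcons -cats1 -(nseqD p 1) addn1.
by have := H p.+1 q; rewrite /ordered_word Wword_cat.
Qed.

End Flat.

(** * Matrix-valued functions *)

Section MatrixNorm.
Context {R : realType}.
Local Notation C := R[i].

Definition mnorm {p q} (A : 'M[C]_(p, q)) : R := \sum_i \sum_j cnorm (A i j).

Lemma mnorm_ge0 p q (A : 'M[C]_(p, q)) : 0 <= mnorm A.
Proof. by apply: sumr_ge0 => i _; apply: sumr_ge0 => j _; exact: cnorm_ge0. Qed.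

Lemma mnorm_entry p q (A : 'M[C]_(p, q)) i j : cnorm (A i j) <= mnorm A.
Proof.
rewrite /mnorm (bigD1 i) //= (bigD1 j) //= -addrA lerDl addr_ge0 //.
  by apply: sumr_ge0 => k _; exact: cnorm_ge0.
by apply: sumr_ge0 => k _; apply: sumr_ge0 => l _; exact: cnorm_ge0.
Qed.

Lemma mnormD p q (A B : 'M[C]_(p, q)) : mnorm (A + B) <= mnorm A + mnorm B.
Proof.
rewrite /mnorm -big_split /=; apply: ler_sum => i _.
rewrite -big_split /=; apply: ler_sum => j _; rewrite mxE; exact: cnormD.
Qed.

Lemma mnormZ p q (c : C) (A : 'M[C]_(p, q)) : mnorm (c *: A) = cnorm c * mnorm A.
Proof.
rewrite /mnorm mulr_sumr; apply: eq_bigr => i _; rewrite mulr_sumr.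
by apply: eq_bigr => j _; rewrite mxE cnormM.
Qed.

Lemma mnormN p q (A : 'M[C]_(p, q)) : mnorm (- A) = mnorm A.
Proof. by rewrite -scaleN1r mnormZ cnormN cnorm1 mul1r. Qed.

Lemma mnormB p q (A B : 'M[C]_(p, q)) : mnorm (A - B) <= mnorm A + mnorm B.
Proof. by rewrite -(mnormN B) mnormD. Qed.

Lemma mnormM p q r (A : 'M[C]_(p, q)) (B : 'M[C]_(q, r)) : mnorm (A *m B) <= mnorm A * mnorm B.
Proof.
rewrite {1}/mnorm.
have H i : \sum_j cnorm ((A *m B) i j) <= (\sum_j cnorm (A i j)) * mnorm B.
  have L j : cnorm ((A *m B) i j) <= \sum_k cnorm (A i k) * cnorm (B k j).
    rewrite mxE; apply: le_trans (cnorm_sum _) _.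
    by apply: ler_sum => k _; rewrite cnormM.
  apply: (@le_trans _ _ (\sum_j \sum_k cnorm (A i k) * cnorm (B k j))).
    by apply: ler_sum => j _; exact: L.
  rewrite exchange_big /= mulr_suml; apply: ler_sum => k _.
  rewrite -mulr_sumr; apply: ler_wpM2l; first exact: cnorm_ge0.
  rewrite /mnorm (bigD1 k) //= lerDl; apply: sumr_ge0 => l _; apply: sumr_ge0 => j _.
  exact: cnorm_ge0.
apply: le_trans (ler_sum _ (fun i _ => H i)) _.
by rewrite -mulr_suml.
Qed.

Lemma mnorm_tr p (A : 'M[C]_p) : cnorm (\tr A) <= mnorm A.
Proof.
rewrite /mxtrace; apply: le_trans (cnorm_sum _) _; apply: ler_sum => i _.
rewrite (bigD1 i) //= lerDl; apply: sumr_ge0 => j _; exact: cnorm_ge0.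
Qed.

Lemma mnorm_le p q (A : 'M[C]_(p, q)) (e : R) : (forall i j, cnorm (A i j) <= e) ->
  mnorm A <= (p * q)%:R * e.
Proof.
move=> H; apply: (@le_trans _ _ (\sum_(i < p) \sum_(j < q) e)).
  by apply: ler_sum => i _; apply: ler_sum => j _; exact: H.
by rewrite !sumr_const !card_ord -mulrnA mulr_natl mulnC.
Qed.

End MatrixNorm.

Section MatrixCalculus.
Context {R : realType} {n : nat}.
Local Notation C := R[i].
Local Notation M := 'M[C]_n.
Local Notation cj := (@conjc R).
Implicit Types (h k : C -> M) (f g : C -> C) (z w : C) (U V : set C).

Definition MW (s : bool) h : C -> M := if s then mxdelbar h else mxdel h.
Definition mxcdiff h z := forall i j, cdiff (fun w => h w i j) z.

Lemma MWE s h z i j : MW s h z i j = W s (fun w => h w i j) z.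
Proof. by case: s; rewrite mxE. Qed.

Lemma mxsmooth_cdiff U h z : copen U -> mxsmooth_on U h -> U z -> mxcdiff h z.
Proof. by move=> oU sh Uz i j; exact: (csmooth_cdiff oU (sh i j) Uz). Qed.

Lemma mxsmooth_sub U V h : U `<=` V -> mxsmooth_on V h -> mxsmooth_on U h.
Proof. by move=> UV sh i j; exact: (csmooth_sub UV (sh i j)). Qed.

Lemma mxsmooth_local U h :
  (forall z, U z -> exists2 V : set C, V z & mxsmooth_on V h) -> mxsmooth_on U h.
Proof.
move=> H i j; apply: csmooth_local => z /H[V Vz sh]; exists V; first exact: Vz.
exact: sh.
Qed.

Lemma mxsmooth_eq U h k : copen U -> (forall z, U z -> h z = k z) -> mxsmooth_on U h -> mxsmooth_on U k.
Proof.
move=> oU E sh i j; apply: (csmooth_eq oU _ (sh i j)) => z Uz.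
by rewrite E.
Qed.

Lemma mxsmooth_cst U (A : M) : mxsmooth_on U (fun=> A).
Proof. by move=> i j; exact: csmooth_cst. Qed.

Lemma mxsmoothD U h k : copen U -> mxsmooth_on U h -> mxsmooth_on U k ->
  mxsmooth_on U (fun z => h z + k z).
Proof.
move=> oU sh sk i j; apply: (csmooth_eq oU _ (csmoothD oU (sh i j) (sk i j))) => z _.
by rewrite mxE.
Qed.

Lemma mxsmoothZ U f h : copen U -> csmooth_on U f -> mxsmooth_on U h ->
  mxsmooth_on U (fun z => f z *: h z).
Proof.
move=> oU sf sh i j; apply: (csmooth_eq oU _ (csmoothM oU sf (sh i j))) => z _.
by rewrite mxE.
Qed.

Lemma mxsmoothN U h : copen U -> mxsmooth_on U h -> mxsmooth_on U (fun z => - h z).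
Proof.
move=> oU sh i j; apply: (csmooth_eq oU _ (csmoothN oU (sh i j))) => z _.
by rewrite mxE.
Qed.

Lemma mxsmoothM U h k : copen U -> mxsmooth_on U h -> mxsmooth_on U k ->
  mxsmooth_on U (fun z => h z *m k z).
Proof.
move=> oU sh sk i j.
apply: (csmooth_eq (f := fun z => \sum_l h z i l * k z l j) oU) => [z _|].
  by rewrite mxE.
exact: (@csmooth_sum R U 'I_n (index_enum 'I_n) xpredT (fun l z => h z i l * k z l j) oU
  (fun l _ => csmoothM oU (sh i l) (sk l j))).
Qed.

Lemma mxsmooth_comp U V h g : copen U -> copen V -> (forall z, V z -> U (g z)) ->
  mxsmooth_on U h -> csmooth_on V g -> mxsmooth_on V (fun z => h (g z)).
Proof. by move=> oU oV UV sh sg i j; exact: (csmooth_comp oU oV UV (sh i j) sg). Qed.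

Lemma mxsmoothMW U s h : copen U -> mxsmooth_on U h -> mxsmooth_on U (MW s h).
Proof.
move=> oU sh i j; apply: (csmooth_eq oU _ (csmoothW s oU (sh i j))) => z _.
by rewrite MWE.
Qed.

Lemma csmooth_tr U h : copen U -> mxsmooth_on U h -> csmooth_on U (fun z => \tr (h z)).
Proof. move=> oU sh.
exact: (@csmooth_sum R U 'I_n (index_enum 'I_n) xpredT (fun i z => h z i i) oU (fun i _ => sh i i)). Qed.

Lemma csmooth_det U p (h : C -> 'M[C]_p) : copen U -> (forall i j, csmooth_on U (fun z => h z i j)) ->
  csmooth_on U (fun z => \det (h z)).
Proof.
move=> oU sh.
have H (s : {perm 'I_p}) : csmooth_on U (fun z => (-1) ^+ s * \prod_i h z i (s i)).
  have K := @csmooth_prod R U 'I_p (index_enum 'I_p) xpredT (fun i z => h z i (s i)) oU (fun i _ => sh i (s i)).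
  exact: (csmoothM oU (@csmooth_cst R U ((-1) ^+ s)) K).
exact: (@csmooth_sum R U _ (index_enum {perm 'I_p}) xpredT _ oU (fun s _ => H s)).
Qed.

(** Cramer's rule. *)
Lemma mxsmooth_inv U h : copen U -> (forall z, U z -> h z \in unitmx) -> mxsmooth_on U h ->
  mxsmooth_on U (fun z => invmx (h z)).
Proof.
move=> oU uh sh i j.
have sdet := csmooth_det oU sh.
have sdetV : csmooth_on U (fun z => (\det (h z))^-1).
  by apply: (csmoothV oU _ sdet) => z /uh; rewrite unitmxE unitfE.
have scof : csmooth_on U (fun z => cofactor (h z) j i).
  apply: (csmoothM oU); first exact: csmooth_cst.
  apply: (csmooth_det oU) => p q.
  by apply: (csmooth_eq oU _ (sh (lift j p) (lift i q))) => z _; rewrite !mxE.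
apply: (csmooth_eq oU _ (csmoothM oU sdetV scof)) => z /uh uz.
by rewrite /invmx uz !mxE.
Qed.

Lemma MW_eq U s h k z : copen U -> U z -> (forall w, U w -> h w = k w) -> MW s h z = MW s k z.
Proof.
move=> oU Uz E; apply/matrixP => i j; rewrite !MWE.
by apply: (W_eq s oU Uz) => w Uw; rewrite E.
Qed.

Lemma MW_cst s (A : M) z : MW s (fun=> A) z = 0.
Proof. by apply/matrixP => i j; rewrite MWE W_cst mxE. Qed.

Lemma MWD s h k z : mxcdiff h z -> mxcdiff k z -> MW s (fun w => h w + k w) z = MW s h z + MW s k z.
Proof.
move=> dh dk; apply/matrixP => i j; rewrite mxE !MWE -WD; [|exact: dh|exact: dk].
by congr (W s _ z); apply/funext => w; rewrite mxE.
Qed.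

Lemma MWZ s f h z : cdiff f z -> mxcdiff h z ->
  MW s (fun w => f w *: h w) z = W s f z *: h z + f z *: MW s h z.
Proof.
move=> df dh; apply/matrixP => i j; rewrite !mxE !MWE -WM; [|exact: df|exact: dh].
by congr (W s _ z); apply/funext => w; rewrite mxE.
Qed.

Lemma MWZc s (c : C) h z : mxcdiff h z -> MW s (fun w => c *: h w) z = c *: MW s h z.
Proof. by move=> dh; rewrite MWZ ?W_cst ?scale0r ?add0r //; exact: cdiff_cst. Qed.

Lemma mxcdiffD h k z : mxcdiff h z -> mxcdiff k z -> mxcdiff (fun w => h w + k w) z.
Proof.
move=> dh dk i j; have := cdiffD (dh i j) (dk i j).
by congr (cdiff _ z); apply/funext => w; rewrite mxE.
Qed.

Lemma mxcdiffZ f h z : cdiff f z -> mxcdiff h z -> mxcdiff (fun w => f w *: h w) z.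
Proof.
move=> df dh i j; have := cdiffM df (dh i j).
by congr (cdiff _ z); apply/funext => w; rewrite mxE.
Qed.

Lemma cdiff_sum (I : Type) (r : seq I) (f : I -> C -> C) z : (forall i, cdiff (f i) z) ->
  cdiff (fun w => \sum_(i <- r) f i w) z.
Proof.
move=> df; elim: r => [|i r IH].
  by rewrite (_ : (fun _ => _) = fun=> 0); [exact: cdiff_cst | apply/funext => w; rewrite big_nil].
rewrite (_ : (fun _ => _) = fun w => f i w + \sum_(j <- r) f j w); last first.
  by apply/funext => w; rewrite big_cons.
exact: cdiffD.
Qed.

Lemma W_sum s (I : Type) (r : seq I) (f : I -> C -> C) z : (forall i, cdiff (f i) z) ->
  W s (fun w => \sum_(i <- r) f i w) z = \sum_(i <- r) W s (f i) z.
Proof.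
move=> df; elim: r => [|i r IH].
  rewrite big_nil (_ : (fun _ => _) = fun=> 0) ?W_cst //.
  by apply/funext => w; rewrite big_nil.
rewrite big_cons -IH -WD; [|exact: df|exact: cdiff_sum].
by congr (W s _ z); apply/funext => w; rewrite big_cons.
Qed.

Lemma mxcdiffM h k z : mxcdiff h z -> mxcdiff k z -> mxcdiff (fun w => h w *m k w) z.
Proof.
move=> dh dk i j.
rewrite (_ : (fun _ => _) = fun w => \sum_l h w i l * k w l j); last first.
  by apply/funext => w; rewrite mxE.
by apply: cdiff_sum => l; exact: (cdiffM (dh i l) (dk l j)).
Qed.

Lemma MWM s h k z : mxcdiff h z -> mxcdiff k z ->
  MW s (fun w => h w *m k w) z = MW s h z *m k z + h z *m MW s k z.
Proof.
move=> dh dk; apply/matrixP => i j; rewrite mxE MWE !mxE -big_split /=.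
rewrite (_ : (fun _ => _) = fun w => \sum_l h w i l * k w l j); last first.
  by apply/funext => w; rewrite mxE.
rewrite W_sum; last by move=> l; exact: (cdiffM (dh i l) (dk l j)).
by apply: eq_bigr => l _; rewrite (WM s (dh i l) (dk l j)) !MWE.
Qed.

Lemma W_tr s h z : mxcdiff h z -> W s (fun w => \tr (h w)) z = \tr (MW s h z).
Proof.
by move=> dh; rewrite /mxtrace W_sum //; apply: eq_bigr => i _; rewrite MWE.
Qed.

Lemma MW_swap U s t h z : copen U -> mxsmooth_on U h -> U z -> MW s (MW t h) z = MW t (MW s h) z.
Proof.
move=> oU sh Uz; apply/matrixP => i j; rewrite !MWE.
have E b : (fun w => MW b h w i j) = W b (fun w => h w i j).
  by apply/funext => w; rewrite MWE.
by rewrite !E; exact: (W_swap s t oU (sh i j) Uz).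
Qed.

(** Differentiate h h^-1 = 1. *)
Lemma MW_inv U s h z : copen U -> (forall w, U w -> h w \in unitmx) -> mxsmooth_on U h -> U z ->
  MW s (fun w => invmx (h w)) z = - (invmx (h z) *m MW s h z *m invmx (h z)).
Proof.
move=> oU uh sh Uz.
have dh := mxsmooth_cdiff oU sh Uz.
have di := mxsmooth_cdiff oU (mxsmooth_inv oU uh sh) Uz.
have E : MW s (fun w => h w *m invmx (h w)) z = 0.
  rewrite (MW_eq s oU Uz (k := fun=> 1%:M)) ?MW_cst // => w Uw.
  by rewrite mulmxV // uh.
have := congr1 (fun A => invmx (h z) *m A) E.
rewrite MWM // mulmxDr mulmx0 !mulmxA mulVmx ?uh // mul1mx => /eqP.
by rewrite addrC addr_eq0 => /eqP.
Qed.

Lemma MW_comp s h g z : cdiff g z -> mxcdiff h (g z) -> delbar g z = 0 ->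
  MW s (fun w => h (g w)) z = (if s then cj (del g z) else del g z) *: MW s h (g z).
Proof.
move=> dg dh hg; apply/matrixP => i j; rewrite mxE !MWE.
rewrite (W_comp s dg (dh i j)).
have hg' : W true g z = 0 by [].
case: s; first by rewrite hg' mulr0 add0r mulrC.
by rewrite -[~~ false]/true hg' conjc0 mulr0 addr0 mulrC.
Qed.

Lemma mxcdiff_comp h g z : cdiff g z -> mxcdiff h (g z) -> mxcdiff (fun w => h (g w)) z.
Proof. by move=> dg dh i j; exact: (cdiff_comp dg (dh i j)). Qed.


Definition mxgerm h := forall i j, germ_smooth (fun z => h z i j).
Definition mxflat h := forall i j, flat (fun z => h z i j).

Lemma mxgermP h : mxgerm h <-> exists2 r : R, 0 < r & mxsmooth_on (disc 0 r) h.
Proof.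
split=> [H|[r r0 sh] i j]; last by exists r; [exact: r0 | exact: sh].
have H' (ij : 'I_n * 'I_n) : exists r : R, 0 < r /\ csmooth_on (disc 0 r) (fun z => h z ij.1 ij.2).
  by have [r r0 sr] := H ij.1 ij.2; exists r; split; [exact: r0 | exact: sr].
have [r Hr] := choice H'.
pose m := \big[Num.min/1]_ij r ij.
exists m.
  by rewrite /m; elim/big_rec: _ => // i x _ x0; rewrite lt_min x0 andbT; have [] := Hr i.
move=> i j; have [_ sr] := Hr (i, j); apply: csmooth_sub sr; apply: disc_sub.
exact: (bigmin_le _ (i, j)).
Qed.

Lemma mxflat_germ h : mxflat h -> mxgerm h.
Proof. by move=> F i j; have [] := F i j. Qed.

Lemma mxflat0 h : mxflat h -> h 0 = 0.
Proof. by move=> F; apply/matrixP => i j; rewrite mxE (flat0 (F i j)). Qed.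

Lemma mxflat_eq h k (r : R) : 0 < r -> (forall z, disc 0 r z -> h z = k z) -> mxflat h -> mxflat k.
Proof.
by move=> r0 E F i j; apply: (flat_eq r0) (F i j) => z Hz; rewrite E.
Qed.

Lemma mxflatD h k : mxflat h -> mxflat k -> mxflat (fun z => h z + k z).
Proof.
by move=> F G i j; apply: (flat_eq ltr01) (flatD (F i j) (G i j)) => z _; rewrite mxE.
Qed.

Lemma mxflatZ (g : C -> C) h : germ_smooth g -> mxflat h -> mxflat (fun z => g z *: h z).
Proof.
by move=> G F i j; apply: (flat_eq ltr01) (flatMl (F i j) G) => z _; rewrite mxE.
Qed.

Lemma mxflatN h : mxflat h -> mxflat (fun z => - h z).
Proof.
by move=> F i j; apply: (flat_eq ltr01) (flatZ (-1) (F i j)) => z _; rewrite mxE mulN1r.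
Qed.

Lemma mxflatM h k : mxflat h -> mxgerm k -> mxflat (fun z => h z *m k z).
Proof.
move=> F G i j; apply: (flat_eq (f := fun z => \sum_l h z i l * k z l j) ltr01) => [z _|].
  by rewrite mxE.
by apply: flat_sum => l; exact: flatM (F i l) (G l j).
Qed.

Lemma mxflatMl h k : mxgerm k -> mxflat h -> mxflat (fun z => k z *m h z).
Proof.
move=> G F i j; apply: (flat_eq (f := fun z => \sum_l k z i l * h z l j) ltr01) => [z _|].
  by rewrite mxE.
by apply: flat_sum => l; exact: flatMl (F l j) (G i l).
Qed.

Lemma mxflatMW s h : mxflat h -> mxflat (MW s h).
Proof.
by move=> F i j; apply: (flat_eq ltr01) (flatW s (F i j)) => z _; rewrite MWE.
Qed.

Lemma mxgermD h k : mxgerm h -> mxgerm k -> mxgerm (fun z => h z + k z).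
Proof.
move=> F G i j; have [r r0 s] := germ_smoothD (F i j) (G i j); exists r; first exact: r0.
by apply: (csmooth_eq (@copen_disc _ _ _) _ s) => z _; rewrite mxE.
Qed.

Lemma mxflat_bound h N : mxflat h -> exists r K : R, [/\ 0 < r, 0 <= K &
  forall z, disc 0 r z -> mnorm (h z) <= K * cnorm z ^+ N].
Proof.
move=> F.
have H (ij : 'I_n * 'I_n) : exists rK : R * R, [/\ 0 < rK.1, 0 <= rK.2 &
    forall z, disc 0 rK.1 z -> cnorm (h z ij.1 ij.2) <= rK.2 * cnorm z ^+ N].
  by have [r [K [r0 K0 B]]] := flat_bound N (F ij.1 ij.2); exists (r, K).
have [rK HrK] := choice H.
exists (\big[Num.min/1]_ij (rK ij).1), (\sum_ij (rK ij).2); split.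
- by elim/big_rec: _ => // i x _ x0; rewrite lt_min x0 andbT; have [] := HrK i.
- by apply: sumr_ge0 => ij _; have [] := HrK ij.
move=> z Hz; rewrite mulr_suml /mnorm pair_big /=; apply: ler_sum => ij _.
have [_ _ B] := HrK ij; apply: B; apply: disc_sub Hz; exact: bigmin_le.
Qed.

Lemma iter_MW p s h z i j : iter p (MW s) h z i j = Wword (nseq p s) (fun w => h w i j) z.
Proof.
elim: p z => //= p IH z; rewrite MWE; congr (W s _ z).
by apply/funext => w; rewrite IH.
Qed.

Lemma taylorE h p q i j :
  taylor h p q i j = ((p`! * q`!)%:R)^-1 * Wword (ordered_word p q) (fun w => h w i j) 0.
Proof.
rewrite /taylor mxE (iter_MW p false); congr (_ * _).
rewrite /ordered_word Wword_cat; congr (Wword _ _ 0); apply/funext => w.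
exact: (iter_MW q true).
Qed.

Lemma taylor_lin h k (c : C) p q : mxgerm h -> mxgerm k ->
  taylor (fun z => h z + c *: k z) p q = taylor h p q + c *: taylor k p q.
Proof.
move=> gh gk; apply/matrixP => i j; rewrite !mxE -/(taylor h p q i j).
have [r [r0 sh sk]] := germ2 (gh i j) (gk i j).
have oD := @copen_disc R 0 r; have D0 := @disc_center R 0 r r0.
have := taylorE (fun z => h z + c *: k z) p q i j; rewrite /taylor !mxE => ->.
have := taylorE h p q i j; rewrite /taylor !mxE => ->.
have := taylorE k p q i j; rewrite /taylor !mxE => ->.
rewrite (_ : (fun w => (h w + c *: k w) i j) = fun w => h w i j + c * k w i j); last first.
  by apply/funext => w; rewrite !mxE.
rewrite (WwordD _ oD sh (csmoothZ c oD sk) D0) (WwordZ _ c oD sk D0).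
by rewrite mulrDr mulrCA.
Qed.

Lemma mxflat_taylor h p q : mxflat h -> taylor h p q = 0.
Proof. by move=> F; apply/matrixP => i j; rewrite taylorE mxE; have [_ ->] := F i j; rewrite mulr0. Qed.

Lemma taylor_mxflat h : mxgerm h -> (forall p q, taylor h p q = 0) -> mxflat h.
Proof.
move=> G H i j; apply: taylor0_flat (G i j) _ => p q.
have := taylorE h p q i j; rewrite H mxE => /esym/eqP; rewrite mulf_eq0 invr_eq0.
by rewrite pnatr_eq0 muln_eq0 !eqn0Ngt !fact_gt0 /= => /eqP.
Qed.

End MatrixCalculus.

(** * Charts and parametrizations of the sphere *)

Section Charts.
Context {R : realType}.
Local Notation C := R[i].
Local Notation cj := (@conjc R).
Implicit Types (c : C -> P1 R) (g : C -> C) (z w u v : C) (U V : set C) (b : bool).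

Lemma W_inv U s g z : copen U -> (forall w, U w -> g w != 0) -> csmooth_on U g -> U z ->
  W s (fun w => (g w)^-1) z = - (W s g z / g z ^+ 2).
Proof.
move=> oU nz sg Uz.
have dg := csmooth_cdiff oU sg Uz.
have di := csmooth_cdiff oU (csmoothV oU nz sg) Uz.
have E : W s (fun w => g w * (g w)^-1) z = 0.
  rewrite (@W_eq R U s _ (fun=> 1) z oU Uz) ?W_cst // => w Uw.
  by rewrite divff // nz.
move: E; rewrite (WM s dg di) => /eqP; rewrite addrC addr_eq0 => /eqP E.
apply: (mulfI (nz z Uz)); rewrite E mulrN; congr (- _).
by have := nz z Uz => nz0; field.
Qed.

Lemma holo_sub U V g : U `<=` V -> holo_on V g -> holo_on U g.
Proof.
move=> UV [sg hg]; split; first exact: (csmooth_sub UV sg).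
by move=> z /UV; exact: hg.
Qed.

Lemma holo_inv U g : copen U -> (forall w, U w -> g w != 0) -> holo_on U g ->
  holo_on U (fun w => (g w)^-1).
Proof.
move=> oU nz [sg hg]; split; first exact: (csmoothV oU nz sg).
move=> z Uz; have := W_inv true oU nz sg Uz; rewrite /W => ->.
by rewrite hg // mul0r oppr0.
Qed.

Lemma holo_id U : holo_on U (fun z => z).
Proof. by split; [exact: csmooth_id | move=> z _; exact: (W_id true z)]. Qed.

Lemma del_id z : del (fun w => w) z = 1. Proof. exact: (W_id false z). Qed.

(** [chart b] is inverse to [stdpar b] away from the point [miss b]. *)
Definition miss b : P1 R := if b then Some 0 else None.
Definition chart b : P1 R -> C := if b then affoo else aff0.

Lemma chart_stdpar b z : chart b (stdpar b z) = z.
Proof.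
case: b => //=; rewrite /paroo; case: eqP => [->//|_] /=; exact: invrK.
Qed.

Lemma stdpar_chart b p : p <> miss b -> stdpar b (chart b p) = p.
Proof.
case: b; case: p => [z|] //= H; rewrite /paroo ?eqxx //.
case: eqP => [/eqP|_]; first by rewrite invr_eq0 => /eqP z0; case: H; rewrite z0.
by rewrite invrK.
Qed.

Lemma stdpar_miss b z : stdpar b z <> miss b.
Proof.
case: b => //=; rewrite /paroo; case: eqP => [//|/eqP z0] [] /eqP.
by rewrite invr_eq0 (negbTE z0).
Qed.

Lemma chartV b p : chart (~~ b) p = (chart b p)^-1.
Proof. by case: b; case: p => [z|] /=; rewrite ?invrK ?invr0. Qed.

Lemma chart_eq0 b p : p <> miss b -> p <> miss (~~ b) -> chart b p != 0.
Proof.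
case: b; case: p => [z|] //= H1 H2; rewrite ?invr_eq0; apply/eqP => z0.
  by apply: H1; rewrite z0.
by apply: H2; rewrite z0.
Qed.

Lemma chart_neq0_miss b p : chart b p != 0 -> p <> miss b /\ p <> miss (~~ b).
Proof.
by case: b; case: p => [z|] //= /eqP H; split=> // -[E]; apply: H; rewrite ?E ?invr0.
Qed.

Lemma at_oo_miss p : p <> miss (at_oo p). Proof. by case: p. Qed.
Lemma stdcoordE p : stdcoord p = chart (at_oo p) p. Proof. by case: p. Qed.

(** [holoP1_on] gives holomorphy in one of the two affine charts; if it is not the wanted
    one, invert, which is legitimate where the image avoids both 0 and infinity. *)
Lemma holo_chart U c b u : copen U -> holoP1_on U c -> U u -> c u <> miss b ->
  exists e : R, [/\ 0 < e, disc u e `<=` U, forall v, disc u e v -> c v <> miss b &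
    holo_on (disc u e) (fun v => chart b (c v))].
Proof.
move=> /copenP oU hc Uu cu.
have [e1 e10 He1] := oU u Uu.
have [e2 [e20 H]] := hc u Uu.
pose e := Num.min e1 e2.
have e0 : 0 < e by rewrite lt_min e10.
have s1 : disc u e `<=` disc u e1 by apply: disc_sub; rewrite ge_min lexx.
have s2 : disc u e `<=` disc u e2 by apply: disc_sub; rewrite ge_min lexx orbT.
have : exists b0 : bool, (forall v, disc u e2 v -> c v <> miss b0) /\
    holo_on (disc u e2) (fun v => chart b0 (c v)).
  by case: H => -[H1 H2]; [exists false | exists true].
move=> [b0 [H1 H2]].
have [->|nb] := eqVneq b b0.
  exists e; split; first exact: e0.
  - exact: subset_trans s1 He1.
  - by move=> v /s2; exact: H1.
  - exact: holo_sub s2 H2.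
have nb' : b = ~~ b0 by case: b b0 nb {cu H1 H2} => [] [].
rewrite nb' in cu *.
have nz : chart b0 (c u) != 0.
  by apply: chart_eq0 cu; apply: H1; exact: disc_center.
have sH := H2.1.
have np : 0 < cnorm (chart b0 (c u)) by rewrite cnorm_gt0.
have [d d0 Hd] := csmooth_cont (@copen_disc _ _ _) sH (disc_center u e20) np.
pose e' := Num.min e d.
have e'0 : 0 < e' by rewrite lt_min e0.
have s3 : disc u e' `<=` disc u e by apply: disc_sub; rewrite ge_min lexx.
have nz' v : disc u e' v -> chart b0 (c v) != 0.
  move=> Hv; apply/eqP => E.
  have : cnorm (v - u) < d by apply: lt_le_trans Hv _; rewrite ge_min lexx orbT.
  by move=> /Hd; rewrite E sub0r cnormN ltxx.
exists e'; split; first exact: e'0.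
- exact: subset_trans s3 (subset_trans s1 He1).
- by move=> v /nz' /chart_neq0_miss [].
- have E : (fun v => chart (~~ b0) (c v)) = fun v => (chart b0 (c v))^-1.
    by apply/funext => v; exact: chartV.
  rewrite E; apply: holo_inv nz' _; first exact: copen_disc.
  exact: holo_sub (subset_trans s3 s2) H2.
Qed.

Lemma holo_stdpar b : @holoP1_on R setT (stdpar b).
Proof.
move=> u _; exists 1; split=> //; case: b; [right|left]; split.
- by move=> v _; exact: (@stdpar_miss true).
- have -> : affoo \o stdpar true = (fun z => z).
    by apply/funext => z; exact: (chart_stdpar true z).
  exact: holo_id.
- by move=> v _; exact: (@stdpar_miss false).
- exact: holo_id.
Qed.

(** [dparam] reads derivatives in the chart [at_oo] of the image point; for the coordinate
    1/z this is the affine coordinate, except at infinity.  See [dparam_stdpar]. *)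
Definition dstd b z : C := if b then (if z == 0 then 1 else - z ^- 2) else 1.

Lemma dstd_neq0 b z : dstd b z != 0.
Proof.
rewrite /dstd; case: b; last exact: oner_neq0.
have [_|z0] := eqVneq z 0; first exact: oner_neq0.
by rewrite oppr_eq0 invr_eq0 expf_neq0.
Qed.

Lemma copen_nz : copen (fun z : C => z != 0).
Proof.
apply/copenP => z z0; exists (cnorm z); first by rewrite cnorm_gt0.
by move=> w /=; rewrite /disc /=; apply: contraTneq => ->; rewrite sub0r cnormN ltxx.
Qed.

Lemma del_inv z : z != 0 -> del (fun w : C => w^-1) z = - z ^- 2.
Proof.
move=> z0; have := @W_inv (fun z : C => z != 0) false (fun w => w) z copen_nz.
rewrite /W del_id mul1r; apply=> //; exact: csmooth_id.
Qed.

Lemma dparam_stdpar b z : dparam (stdpar b) z = dstd b z.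
Proof.
rewrite /dparam /dstd; case: b => /=; last exact: del_id.
have E1 : aff0 \o paroo = (fun w : C => w^-1).
  apply/funext => w /=; rewrite /paroo; case: eqP => [->|_] //=; by rewrite invr0.
have E2 : affoo \o paroo = (fun w : C => w).
  by apply/funext => w; exact: (chart_stdpar true w).
rewrite E1 E2 {1}/paroo; case: eqP => [_|/eqP z0]; first exact: del_id.
exact: del_inv.
Qed.

Lemma dparam_chart c b V v : copen V -> V v -> (forall w, V w -> c w <> miss b) ->
  holo_on V (fun w => chart b (c w)) ->
  dparam c v = del (fun w => chart b (c w)) v * dstd b (chart b (c v)).
Proof.
move=> oV Vv cm [sg hg]; rewrite /dparam /dstd.
case: b cm sg hg => cm sg hg; last first.
  by case E : (c v) (cm v Vv) => [z|] // _; rewrite mulr1.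
case E : (c v) => [z|] /=; last by rewrite eqxx mulr1.
have z0 : z != 0 by apply/eqP => z0; apply: (cm v Vv); rewrite E z0.
rewrite invr_eq0 (negbTE z0).
have gv : chart true (c v) = z^-1 by rewrite E.
pose V' := V `&` (fun w => chart true (c w) != 0).
have oV' : copen V'.
  apply/copenP => w [Vw nw].
  have [e e0 He] := (copenP V).1 oV w Vw.
  have np : 0 < cnorm (chart true (c w)) by rewrite cnorm_gt0.
  have [d d0 Hd] := csmooth_cont oV sg Vw np.
  exists (Num.min e d); first by rewrite lt_min e0.
  move=> x Hx; split; first by apply: He; apply: disc_sub Hx; rewrite ge_min lexx.
  have : cnorm (x - w) < d by apply: lt_le_trans Hx _; rewrite ge_min lexx orbT.
  by move=> /Hd; apply: contraTneq => ->; rewrite sub0r cnormN ltxx.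
have V'v : V' v by split=> //; rewrite gv invr_eq0.
have sg' : csmooth_on V' (fun w => chart true (c w)) by apply: csmooth_sub sg; move=> w [].
have nz' w : V' w -> chart true (c w) != 0 by case.
have EE : aff0 \o c = fun w => (chart true (c w))^-1.
  by apply/funext => w; rewrite -(chartV true).
have := W_inv false oV' nz' sg' V'v; rewrite -EE gv /W => ->.
by rewrite mulrN.
Qed.

End Charts.

#[global] Arguments conjc : simpl never.
#[global] Arguments MW : simpl never.

(** * Pull-back and exterior derivative of one-forms *)

Section PullBack.
Context {R : realType} {n : nat}.
Local Notation C := R[i].
Local Notation M := 'M[C]_n.
Local Notation cj := (@conjc R).
Implicit Types (c : C -> P1 R) (g : C -> C) (z w u v : C) (U V : set C) (b : bool).
Implicit Types (O : set (P1 R)) (phi psi : form1 R n) (x : mxfun R n).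

(** s = false selects the du coefficient, s = true the d(conj u) coefficient. *)
Definition pulls (s : bool) c phi : C -> M := if s then pull01 c phi else pull10 c phi.
Definition comp (s : bool) phi (p : P1 R) : M := if s then (phi p).2 else (phi p).1.
(** How a holomorphic change of coordinate with derivative z acts on the du, resp. d(conj u),
    coefficient. *)
Definition cjs (s : bool) z : C := if s then cj z else z.

Lemma pullsE s c phi u : pulls s c phi u = cjs s (dparam c u) *: comp s phi (c u).
Proof. by case: s. Qed.

Lemma cjsM s z w : cjs s (z * w) = cjs s z * cjs s w.
Proof. by case: s => //=; exact: cjM. Qed.

Lemma cjs1 s : cjs s 1 = 1. Proof. by case: s => //; exact: conjc1. Qed.

Lemma cnorm_cjs s z : cnorm (cjs s z) = cnorm z.
Proof. by case: s => //=; exact: cnormJ. Qed.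

Lemma csmooth_cjs U s g : copen U -> csmooth_on U g -> csmooth_on U (fun z => cjs s (g z)).
Proof. by move=> oU sg; case: s; [exact: csmoothJ | exact: sg]. Qed.

Definition popen O := forall b, copen (stdpar b @^-1` O).
Definition fsmooth O phi := forall b s, mxsmooth_on (stdpar b @^-1` O) (pulls s (stdpar b) phi).

(** Coefficient of du /\ d(conj u) in the exterior derivative of
    P false du + P true d(conj u). *)
Definition D2 (P : bool -> C -> M) z : M := MW false (P true) z - MW true (P false) z.

Lemma D2_eq U (P Q : bool -> C -> M) z : copen U -> U z -> (forall s w, U w -> P s w = Q s w) ->
  D2 P z = D2 Q z.
Proof.
move=> oU Uz E; rewrite /D2 (MW_eq false oU Uz (E true)) (MW_eq true oU Uz (E false)) //.
Qed.

Lemma delbar_del U g z : copen U -> holo_on U g -> U z -> W true (W false g) z = 0.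
Proof.
move=> oU [sg hg] Uz; rewrite (W_swap true false oU sg Uz).
by rewrite (W_eq false oU Uz hg) W_cst.
Qed.

(** The derivatives of g' that occur vanish, as delbar (del g) = 0. *)
Lemma D2_comp U V g (P : bool -> C -> M) u : copen U -> copen V -> holo_on V g -> V u -> U (g u) ->
  (forall s, mxsmooth_on U (P s)) ->
  D2 (fun s v => cjs s (del g v) *: P s (g v)) u = (del g u * cj (del g u)) *: D2 P (g u).
Proof.
move=> oU oV hg Vu Ugu sP.
have [sg dg] := hg.
have cg := csmooth_cdiff oV sg Vu.
have sdg : csmooth_on V (W false g) := csmoothW false oV sg.
have cdg := csmooth_cdiff oV sdg Vu.
have cP s := mxsmooth_cdiff oU (sP s) Ugu.
have H := delbar_del oV hg Vu.
have hu := dg u Vu.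
have cPg s := mxcdiff_comp cg (cP s).
change (MW false (fun v => cj (del g v) *: P true (g v)) u -
  MW true (fun v => del g v *: P false (g v)) u = (del g u * cj (del g u)) *: D2 P (g u)).
rewrite /D2.
have -> : MW false (fun v => cj (del g v) *: P true (g v)) u =
   (cj (del g u) * del g u) *: MW false (P true) (g u).
  rewrite (MWZ false (cdiffJ cdg) (cPg true)).
  rewrite (WJ false cdg) [W (~~ false) _ u]H conjc0 scale0r add0r.
  by rewrite (MW_comp false cg (cP true) hu) scalerA.
have -> : MW true (fun v => del g v *: P false (g v)) u =
   (del g u * cj (del g u)) *: MW true (P false) (g u).
  rewrite (MWZ true cdg (cPg false)) [W true _ u]H scale0r add0r.
  by rewrite (MW_comp true cg (cP false) hu) scalerA.
by rewrite scalerBr [cj _ * _]mulrC.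
Qed.

Lemma pulls_chart c b V s phi v : copen V -> V v -> (forall w, V w -> c w <> miss b) ->
  holo_on V (fun w => chart b (c w)) ->
  pulls s c phi v = cjs s (del (fun w => chart b (c w)) v) *: pulls s (stdpar b) phi (chart b (c v)).
Proof.
move=> oV Vv cm hc; rewrite !pullsE scalerA -cjsM dparam_stdpar -(dparam_chart oV Vv cm hc).
by rewrite stdpar_chart //; exact: cm.
Qed.

Lemma dformE b phi z : dform phi (stdpar b z) =
  D2 (fun s => pulls s (stdpar (at_oo (stdpar b z))) phi) (stdcoord (stdpar b z)).
Proof. by []. Qed.

Lemma dform_stdpar O b phi z : popen O -> fsmooth O phi -> O (stdpar b z) ->
  D2 (fun s => pulls s (stdpar b) phi) z = (dstd b z * cj (dstd b z)) *: dform phi (stdpar b z).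
Proof.
move=> oO sphi Oz; rewrite dformE.
case: b Oz => Oz; last by rewrite /dstd conjc1 mulr1 scale1r.
have [z0|z0] := eqVneq z 0.
  by rewrite z0 /dstd eqxx conjc1 mulr1 scale1r /= /paroo eqxx.
have E : stdpar true z = Some z^-1 by rewrite /= /paroo (negbTE z0).
have oV : copen (fun w : C => w != 0) := copen_nz.
have E2 : D2 (fun s => pulls s (stdpar true) phi) z =
  D2 (fun s v => cjs s (del (fun w : C => w^-1) v) *: pulls s (stdpar false) phi v^-1) z.
  apply: (D2_eq oV z0) => s w w0.
  rewrite !pullsE scalerA -cjsM !dparam_stdpar (del_inv w0) /dstd (negbTE w0) mulr1.
  by rewrite /= /paroo (negbTE w0).
have hinv : holo_on (fun w : C => w != 0) (fun w : C => w^-1).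
  by apply: (holo_inv oV _ (holo_id _)) => w.
rewrite E2 (D2_comp (oO false) oV hinv z0 _ (sphi false)); last first.
  by rewrite /preimage /= /par0 -E.
by rewrite (del_inv z0) /dstd (negbTE z0) E.
Qed.

(** [dform] is computed in one chart; [D2_comp] makes the result independent of it. *)
Lemma dform_pull U O c phi u : copen U -> holoP1_on U c -> popen O -> fsmooth O phi ->
  U u -> O (c u) ->
  D2 (fun s => pulls s c phi) u = (dparam c u * cj (dparam c u)) *: dform phi (c u).
Proof.
move=> oU hc oO sphi Uu Ou.
pose b := at_oo (c u).
have [e [e0 sU cm hg]] := holo_chart oU hc Uu (@at_oo_miss R (c u)).
rewrite -/b in cm hg.
have oV := @copen_disc R u e; have Vu := @disc_center R u e e0.
rewrite (D2_eq (Q := fun s v => cjs s (del (fun w => chart b (c w)) v) *: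
   pulls s (stdpar b) phi (chart b (c v))) oV Vu); last first.
  by move=> s w Vw; exact: (pulls_chart s phi oV Vw cm hg).
have Ec : stdpar b (chart b (c u)) = c u by rewrite stdpar_chart //; exact: cm.
have Oz : O (stdpar b (chart b (c u))) by rewrite Ec.
rewrite (D2_comp (oO b) oV hg Vu Oz (sphi b)).
rewrite (dform_stdpar oO sphi Oz) Ec scalerA (dparam_chart oV Vu cm hg) cjM.
congr (_ *: _); ring.
Qed.

Lemma popen_pre U O c u : copen U -> holoP1_on U c -> popen O -> U u -> O (c u) ->
  exists e : R, [/\ 0 < e, disc u e `<=` U & forall v, disc u e v -> O (c v)].
Proof.
move=> oU hc oO Uu Ou.
pose b := at_oo (c u).
have [e [e0 sU cm [sg hg]]] := holo_chart oU hc Uu (@at_oo_miss R (c u)).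
rewrite -/b in cm sg hg.
have Ec v : disc u e v -> stdpar b (chart b (c v)) = c v by move=> /cm; exact: stdpar_chart.
have Oz : (stdpar b @^-1` O) (chart b (c u)) by rewrite /preimage /= Ec //; exact: disc_center.
have [d d0 Hd] := (copenP _).1 (oO b) _ Oz.
have [r r0 Hr] := csmooth_cont (@copen_disc _ _ _) sg (disc_center u e0) d0.
exists (Num.min e r); split; first by rewrite lt_min e0.
  by apply: subset_trans sU; apply: disc_sub; rewrite ge_min lexx.
move=> v Hv.
have Hve : disc u e v by apply: disc_sub Hv; rewrite ge_min lexx.
rewrite -(Ec v Hve); apply: Hd; apply: Hr.
by apply: lt_le_trans Hv _; rewrite ge_min lexx orbT.
Qed.

Lemma copen_pre U O c : copen U -> holoP1_on U c -> popen O -> copen (U `&` c @^-1` O).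
Proof.
move=> oU hc oO; apply/copenP => u [Uu Ou].
have [e [e0 sU sO]] := popen_pre oU hc oO Uu Ou.
by exists e => // v Hv; split; [exact: sU | exact: sO].
Qed.

Lemma mxsmooth_pulls U O c s phi : copen U -> holoP1_on U c -> popen O -> fsmooth O phi ->
  mxsmooth_on (U `&` c @^-1` O) (pulls s c phi).
Proof.
move=> oU hc oO sphi; apply: mxsmooth_local => u [Uu Ou].
have [e [e0 sU sO]] := popen_pre oU hc oO Uu Ou.
pose b := at_oo (c u).
have oD := @copen_disc R u e.
have hce : holoP1_on (disc u e) c by move=> v /sU; exact: hc.
have [d [d0 sd cm hg]] := holo_chart oD hce (disc_center u e0) (@at_oo_miss R (c u)).
rewrite -/b in cm hg.
exists (disc u d); first exact: disc_center.
have oV := @copen_disc R u d.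
have [sg _] := hg.
apply: (mxsmooth_eq (h := fun v => cjs s (del (fun w => chart b (c w)) v) *:
   pulls s (stdpar b) phi (chart b (c v))) oV).
  by move=> w Vw; exact: (esym (pulls_chart s phi oV Vw cm hg)).
apply: (mxsmoothZ oV).
  exact: (csmooth_cjs s oV (csmoothW false oV sg)).
apply: (mxsmooth_comp (oO b) oV _ (sphi b s) sg) => v Hv.
by rewrite /preimage /= stdpar_chart; [apply: sO; exact: sd | exact: cm].
Qed.

Lemma smooth_P1_comp U c x : copen U -> holoP1_on U c -> smooth_P1 x -> mxsmooth_on U (fun v => x (c v)).
Proof.
move=> oU hc sx; apply: mxsmooth_local => u Uu.
pose b := at_oo (c u).
have [d [d0 sd cm [sg _]]] := holo_chart oU hc Uu (@at_oo_miss R (c u)).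
rewrite -/b in cm sg.
exists (disc u d); first exact: disc_center.
have oV := @copen_disc R u d.
apply: (mxsmooth_eq (h := fun v => (x \o stdpar b) (chart b (c v))) oV).
  by move=> v Hv /=; rewrite stdpar_chart //; exact: cm.
exact: (mxsmooth_comp (@copenT R) oV (fun _ _ => Logic.I) (sx b) sg).
Qed.

Lemma dfun_stdpar b s x z : smooth_P1 x ->
  pulls s (stdpar b) (dfun x) z = MW s (fun v => x (stdpar b v)) z.
Proof.
move=> sx; rewrite pullsE dparam_stdpar /comp /dfun /=.
have -> : (if s then mxdelbar (x \o stdpar (at_oo (stdpar b z))) (stdcoord (stdpar b z))
   else mxdel (x \o stdpar (at_oo (stdpar b z))) (stdcoord (stdpar b z))) =
   MW s (x \o stdpar (at_oo (stdpar b z))) (stdcoord (stdpar b z)) by case: s.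
case: b; last first.
  by rewrite /dstd cjs1 scale1r.
rewrite /dstd; have [z0|z0] := eqVneq z 0.
  by rewrite z0 /= /paroo eqxx cjs1 scale1r.
have E : stdpar true z = Some z^-1 by rewrite /= /paroo (negbTE z0).
rewrite E.
have oV : copen (fun w : C => w != 0) := copen_nz.
have hinv : holo_on (fun w : C => w != 0) (fun w : C => w^-1).
  by apply: (holo_inv oV _ (holo_id _)) => w.
have cg := csmooth_cdiff oV hinv.1 z0.
have cx := mxsmooth_cdiff (@copenT R) (sx false) (Logic.I : setT (z^-1)).
have -> : MW s (fun v => x (stdpar true v)) z = MW s (fun v => (x \o stdpar false) v^-1) z.
  by apply: (MW_eq s oV z0) => w w0 /=; rewrite /paroo (negbTE w0).
rewrite (MW_comp s cg cx (hinv.2 z z0)) (del_inv z0).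
by case: s.
Qed.

Lemma dfun_pull U c s x u : copen U -> holoP1_on U c -> smooth_P1 x -> U u ->
  pulls s c (dfun x) u = MW s (fun v => x (c v)) u.
Proof.
move=> oU hc sx Uu.
pose b := at_oo (c u).
have [d [d0 sd cm hg]] := holo_chart oU hc Uu (@at_oo_miss R (c u)).
rewrite -/b in cm hg.
have oV := @copen_disc R u d; have Vu := @disc_center R u d d0.
rewrite (pulls_chart s _ oV Vu cm hg) dfun_stdpar //.
have cg := csmooth_cdiff oV hg.1 Vu.
have cx := mxsmooth_cdiff (@copenT R) (sx b) (Logic.I : setT (chart b (c u))).
have -> : MW s (fun v => x (c v)) u = MW s (fun v => (x \o stdpar b) (chart b (c v))) u.
  by apply: (MW_eq s oV Vu) => w Vw /=; rewrite stdpar_chart //; exact: cm.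
rewrite (MW_comp s cg cx (hg.2 u Vu)).
by case: s.
Qed.

End PullBack.

(** * Compactness and the local inverse of a holomorphic map *)

Section PlaneTopology.
Context {R : realType}.
Local Notation C := R[i].
Local Notation cj := (@conjc R).
Implicit Types (g : C -> C) (z w u v : C) (U V A : set C).

Lemma box_compact (p : R * R) (r : R) : compact [set q : R * R | `|q - p| <= r].
Proof.
have -> : [set q : R * R | `|q - p| <= r] =
    `[p.1 - r, p.1 + r]%classic `*` `[p.2 - r, p.2 + r]%classic.
  apply/seteqP; split=> [[x y]|[x y]] /=; rewrite normp_le /= !in_itv /=.
    by rewrite !ler_distl => /andP[].
  by rewrite !ler_distl => -[-> ->].
by apply: compact_setX; exact: segment_compact.
Qed.

(** By compactness of the closed disc; A restricts attention to part of it. *)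
Lemma loc_bounded (q : C -> R) A (r : R) :
  (forall u, cnorm u <= r -> exists2 e : R, 0 < e &
     exists K : R, forall v, disc u e v -> A v -> q v <= K) ->
  exists2 K : R, 0 <= K & forall v, cnorm v <= r -> A v -> q v <= K.
Proof.
move=> H.
have := @box_compact 0 r; rewrite compact_near_coveringP => NC.
have [] := NC R (pinfty_nbhs R)
  (fun K p => cnorm (toC p) <= r -> A (toC p) -> q (toC p) <= K) _.
  move=> p _.
  have [pr|pr] := leP (cnorm (toC p)) r.
    have [e e0 [K HK]] := H _ pr.
    exists ([set p' | disc (toC p) e (toC p')], [set K' | K < K']).
      split=> /=; last by exists K; split; [exact: num_real | move=> x].
      by rewrite -(toC_K p); apply/nbhs_cP; exists e => // w; rewrite toC_K /= ofC_K.
    move=> [p' K'] [/= H1 H2] _ Ap; apply: le_trans (ltW H2); exact: HK.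
  exists ([set p' | r < cnorm (toC p')], setT).
    split=> /=; last exact: filterT.
    rewrite -(toC_K p); apply/nbhs_cP; exists (cnorm (toC p) - r); first by rewrite subr_gt0.
    move=> w /=; rewrite ofC_K => Hw.
    have := cnormD (toC p - w) w; rewrite subrK cnorm_dist.
    by move: Hw; move: (cnorm _) (cnorm _) (cnorm _) => x y t; lra.
  by move=> [p' K'] [/= H1 _] H2; move: H1; rewrite ltNge H2.
move=> K0 [_ HK].
have K1 : K0 < Num.max 0 (K0 + 1) by rewrite lt_max ltrDl ltr01 orbT.
exists (Num.max 0 (K0 + 1)); first by rewrite le_max lexx.
move=> v vr Av.
have := HK _ K1 (ofC v); rewrite ofC_K; apply => //=.
by rewrite subr0 (le_trans (normp_ofC v)).
Qed.

Lemma local_min_derive (F : R * R -> R) (p v : R * R) (r : R) : 0 < r ->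
  (forall q, `|q - p| < r -> differentiable F q /\ F p <= F q) -> 'D_v F p = 0.
Proof.
move=> r0 H.
pose d := r / (`|v| + 1).
have v1 : 0 < `|v| + 1 by rewrite ltr_wpDl.
have d0 : 0 < d by rewrite divr_gt0.
have N (t : R) : t \in `]- d, d[%R -> `|p + t *: v - p| < r.
  rewrite in_itv /= -ltr_norml => td; rewrite addpK normrZ.
  apply: (@le_lt_trans _ _ (`|t| * (`|v| + 1))).
    by apply: ler_wpM2l => //; rewrite lerDl.
  by rewrite -ltr_pdivlMr.
have D (t : R) : t \in `]- d, d[%R -> is_derive t 1 (fun t => F (p + t *: v)) ('D_v F (p + t *: v)).
  by move=> /N /H [D _]; apply: is_derive_slice; exact: diff_derivable.
have c0 : (0 : R) \in `]- d, d[%R by rewrite in_itv /= oppr_lt0 d0.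
have lt : - d <= d by rewrite ge0_cp // ltW.
have K := @derive1_at_min R (fun t => F (p + t *: v)) (- d) d 0 lt.
have [t td|t td|_ E] := K _ c0.
- by have [] := D t td.
- by rewrite scale0r addr0; have [_] := H _ (N t td).
by have [_ E'] := D 0 c0; move: E'; rewrite scale0r addr0 E => <-.
Qed.

(** g(v) - g(u) - g'(u) (v - u) has small derivative near u, so it is at most half of
    |g'(u)| |v - u|. *)
Lemma holo_lower g u (e : R) : 0 < e -> holo_on (disc u e) g -> del g u != 0 ->
  exists r k : R, [/\ 0 < r, r <= e, 0 < k & forall v, disc u r v ->
     k * cnorm (v - u) <= cnorm (g v - g u)].
Proof.
move=> e0 [sg hg] d0.
have oD := @copen_disc R u e; have D0 := @disc_center R u e e0.
have sdg := csmoothW false oD sg.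
pose k0 := cnorm (del g u).
have k00 : 0 < k0 by rewrite cnorm_gt0.
(* 16 = 2 * 8, where 8 is the constant of the mean value estimate. *)
have k16 : 0 < k0 / 16 by rewrite divr_gt0.
have [d dd0 Hd] := csmooth_cont oD sdg D0 k16.
pose r := Num.min e d.
have r0 : 0 < r by rewrite lt_min e0.
have sub : disc u r `<=` disc u e by apply: disc_sub; rewrite ge_min lexx.
exists r, (k0 / 2); split; [exact: r0|by rewrite ge_min lexx|by rewrite divr_gt0|].
move=> v Hv.
pose h w := g w + (- del g u) * w.
have sid : csmooth_on (disc u e) (fun w => (- del g u) * w).
  exact: (csmoothZ _ oD (@csmooth_id R (disc u e))).
have sh : csmooth_on (disc u e) h by exact: (csmoothD oD sg sid).
have B w : disc u r w -> forall s, cnorm (W s h w) <= k0 / 16.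
  move=> Hw s; have Hwe := sub _ Hw.
  have cg := csmooth_cdiff oD sg Hwe.
  rewrite /h (WD s cg (cdiffZ (- del g u) (cdiff_id w))) (WZ s (- del g u) (cdiff_id w)) W_id.
  case: s.
    by have := hg w Hwe; rewrite -[delbar g w]/(W true g w) => ->; rewrite mulr0 addr0 cnorm0 ltW.
  rewrite mulr1; apply: ltW; apply: Hd; apply: lt_le_trans Hw _.
  by rewrite ge_min lexx orbT.
have M := mvt_disc (csmooth_sub sub sh) B Hv.
have E : g v - g u = del g u * (v - u) + (h v - h u) by rewrite /h; ring.
have := cnormB (g v - g u) (h v - h u); rewrite {1}E addrK cnormM -/k0.
move: M; have -> : 8 * (k0 / 16) = k0 / 2 by field.
have aux (x y a b : R) : x <= a / 2 * b -> a * b <= y + x -> a / 2 * b <= y by lra.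
exact: aux.
Qed.

(** Local surjectivity: a minimum of |g - w|^2 over a small box around u is
   interior and critical, and the only critical values are zeros since g' <> 0. *)
Lemma holo_open g u (e : R) : 0 < e -> holo_on (disc u e) g -> del g u != 0 ->
  forall rho : R, 0 < rho -> exists2 d : R, 0 < d & forall w, cnorm (w - g u) < d ->
    exists2 v, cnorm (v - u) < rho & g v = w.
Proof.
move=> e0 hg d0 rho rho0.
have [sg dbg] := hg.
have oD := @copen_disc R u e; have D0 := @disc_center R u e e0.
have [r [k [r0 re k0 low]]] := holo_lower e0 hg d0.
have sdg := csmoothW false oD sg.
have dp : 0 < cnorm (del g u) by rewrite cnorm_gt0.
have [d1 d10 Hd1] := csmooth_cont oD sdg D0 dp.
have nz v : cnorm (v - u) < d1 -> del g v != 0.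
  move=> /Hd1; apply: contraTneq => E.
  by rewrite -[W false g v]/(del g v) E sub0r cnormN ltxx.
pose m := Num.min rho (Num.min r d1).
have m0 : 0 < m by rewrite !lt_min rho0 r0.
have m1 : m <= rho by rewrite ge_min lexx.
have m2 : m <= r by rewrite !ge_min lexx orbT.
have m3 : m <= d1 by rewrite !ge_min lexx !orbT.
pose s := m / 3.
have s0 : 0 < s by rewrite divr_gt0.
have sm p : `|p - ofC u| <= s -> cnorm (toC p - u) < m.
  move=> H; rewrite -{1}(ofC_K u) toCB; apply: le_lt_trans (cnorm_toC _) _.
  by apply: le_lt_trans (lerD H H) _; rewrite /s; lra.
have ks0 : 0 < k * s / 2 by rewrite divr_gt0 // mulr_gt0.
exists (k * s / 2) => // w Hw.
pose h v := g v + (- w).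
have sh : csmooth_on (disc u e) h.
  exact: (csmoothD oD sg (@csmooth_cst R (disc u e) (- w))).
pose q v := h v * cj (h v).
have sq : csmooth_on (disc u e) q by exact: (csmoothM oD sh (csmoothJ oD sh)).
have qE v : q v = (cnorm (h v) ^+ 2)%:C.
  rewrite /q cnorm_sqr; case: (h v) => x y; apply: complex_ext; rewrite ?ReM ?ImM /conjc /=; ring.
have me : m <= e by apply: le_trans m2 re.
have inD p : `|p - ofC u| <= s -> disc u e (toC p).
  by move=> /sm H; apply: lt_le_trans H me.
have cont : {within [set p : R * R | `|p - ofC u| <= s], continuous (rpart q)}.
  apply: continuous_in_subspaceT => p; rewrite inE /= => Hp.
  have [D _] := csmooth_cdiff oD sq (inD p Hp); rewrite toC_K in D.
  exact: differentiable_continuous.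
have ne : [set p : R * R | `|p - ofC u| <= s] !=set0.
  by exists (ofC u); rewrite /= subrr normr0 ltW.
have [p0 Hp0 Mp0] := compact_EVT_min ne (@box_compact (ofC u) s) cont.
rewrite inE /= in Hp0.
have rq p : rpart q p = cnorm (h (toC p)) ^+ 2 by rewrite /rpart qE.
have int : `|p0 - ofC u| < s.
  rewrite lt_neqAle Hp0 andbT; apply/eqP => Eb.
  have : rpart q p0 <= rpart q (ofC u) by apply: Mp0; rewrite inE /= subrr normr0 ltW.
  rewrite !rq ofC_K leNgt => /negP; apply.
  rewrite ltrXn2r ?nnegrE ?cnorm_ge0 //=.
  apply: (@lt_le_trans _ _ (k * s / 2)); first by rewrite /h cnorm_dist.
  have L : k * s <= cnorm (g (toC p0) - g u).
    apply: le_trans (low _ _); last by apply: lt_le_trans (sm _ Hp0) m2.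
    apply: ler_wpM2l; first exact: ltW.
    by rewrite -Eb -{2}(ofC_K u) toCB -[p0 - _]toC_K normp_ofC.
  have := cnormB (h (toC p0)) (g u - w).
  have -> : h (toC p0) - (g u - w) = g (toC p0) - g u by rewrite /h; ring.
  rewrite (cnorm_dist (g u)).
  have aux (x y t l : R) : x < l / 2 -> l <= y -> y <= t + x -> l / 2 <= t by lra.
  exact: aux Hw L.
pose u0 := toC p0.
have Hu0 : disc u e u0 := inD p0 Hp0.
have [t t0 Ht] : exists2 t : R, 0 < t & forall p, `|p - p0| < t -> `|p - ofC u| <= s.
  exists (s - `|p0 - ofC u|); first by rewrite subr_gt0.
  move=> p; rewrite ltrBrDr => /ltW; apply: le_trans.
  by rewrite -(subrKA p0 p) ler_normD.
have crit b : cd b q u0 = 0.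
  rewrite cd_def toC_K; apply: complex_ext => /=.
    apply: (local_min_derive _ t0) => p Hp; split; last first.
      by apply: Mp0; rewrite inE /=; exact: Ht.
    by have [D _] := csmooth_cdiff oD sq (inD p (Ht p Hp)); rewrite toC_K in D.
  rewrite (_ : ipart q = cst 0) ?derive_cst //.
  by apply/funext => p; rewrite /ipart qE.
have dq0 : W false q u0 = 0 by rewrite WE !crit mulr0 addr0 mul0r.
have ch := csmooth_cdiff oD sh Hu0.
have cg := csmooth_cdiff oD sg Hu0.
have hW s' : W s' h u0 = W s' g u0.
  by rewrite /h (WD s' cg (cdiff_cst (- w) u0)) W_cst addr0.
move: dq0; rewrite /q (WM false ch (cdiffJ ch)) (WJ false ch) !hW.
have -> : W (~~ false) g u0 = 0 by exact: dbg.
rewrite conjc0 mulr0 addr0 => /eqP; rewrite mulf_eq0 => /orP[/eqP E|].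
  have : del g u0 != 0 by apply: nz; apply: lt_le_trans (sm _ Hp0) m3.
  by rewrite -[del g u0]/(W false g u0) E eqxx.
rewrite conjc_eq0 => /eqP hz; exists u0; first by apply: lt_le_trans (sm _ Hp0) m1.
by apply/eqP; rewrite -subr_eq0; apply/eqP.
Qed.

End PlaneTopology.

(** * The spherical metric *)

Section Spherical.
Context {R : realType}.
Local Notation C := R[i].
Local Notation cj := (@conjc R).
Implicit Types (c : C -> P1 R) (z w u v : C) (U V A : set C) (b : bool) (p : P1 R).

(** Up to a constant, 1 + |z|^2 is the ratio of Euclidean to spherical lengths, and [sph c]
    is the conformal factor of c from the flat to the spherical metric. *)
Definition dens p : R := if p is Some z then 1 + cnorm z ^+ 2 else 1.
Definition sph c u : R := cnorm (dparam c u) / dens (c u).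

Lemma dens_ge1 p : 1 <= dens p.
Proof. by case: p => [z|] //=; rewrite lerDl exprn_ge0 // cnorm_ge0. Qed.
Lemma dens_gt0 p : 0 < dens p.
Proof. by apply: lt_le_trans (dens_ge1 p). Qed.

Lemma sph_stdpar b z : sph (stdpar b) z = (1 + cnorm z ^+ 2)^-1.
Proof.
rewrite /sph dparam_stdpar /dstd; case: b; last by rewrite cnorm1 mul1r.
have [->|z0] := eqVneq z 0.
  by rewrite cnorm1 mul1r /= /paroo eqxx /= cnorm0 expr0n addr0.
rewrite /= /paroo (negbTE z0) /= cnormN !cnormV cnormX.
have : cnorm z != 0 by rewrite cnorm_eq0.
move: (cnorm z) => x x0.
have x2 : x ^+ 2 + 1 != 0.
  by rewrite gt_eqF // ltr_wpDl // sqr_ge0.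
by field; rewrite x0 /= addrC x2.
Qed.

Lemma sph_chart c b V v : copen V -> V v -> (forall w, V w -> c w <> miss b) ->
  holo_on V (fun w => chart b (c w)) ->
  sph c v = cnorm (del (fun w => chart b (c w)) v) / (1 + cnorm (chart b (c v)) ^+ 2).
Proof.
move=> oV Vv cm hc; rewrite /sph (dparam_chart oV Vv cm hc) cnormM -mulrA.
congr (_ * _); rewrite -(sph_stdpar b) /sph dparam_stdpar stdpar_chart //.
exact: cm.
Qed.

Lemma sph_ge0 c u : 0 <= sph c u.
Proof. by rewrite divr_ge0 ?cnorm_ge0 // ltW // dens_gt0. Qed.

Lemma sph_gt0 c u : dparam c u != 0 -> 0 < sph c u.
Proof. by move=> H; rewrite divr_gt0 ?dens_gt0 // cnorm_gt0. Qed.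

Lemma sph_loc c U u : copen U -> holoP1_on U c -> U u -> dparam c u != 0 ->
  exists2 e : R, 0 < e & exists K : R, forall v, disc u e v -> (sph c v)^-1 <= K.
Proof.
move=> oU hc Uu du.
pose b := at_oo (c u).
have [d [d0 sd cm hg]] := holo_chart oU hc Uu (@at_oo_miss R (c u)).
rewrite -/b in cm hg.
have oV := @copen_disc R u d; have Vu := @disc_center R u d d0.
set g := fun w => chart b (c w) in hg *.
have [sg _] := hg.
have dg : del g u != 0.
  move: du; rewrite (dparam_chart oV Vu cm hg) -/g.
  by apply: contraNneq => ->; rewrite mul0r.
have a0 : 0 < cnorm (del g u) / 2 by rewrite divr_gt0 // cnorm_gt0.
have [r1 r10 H1] := csmooth_cont oV (csmoothW false oV sg) Vu a0.
have [r2 r20 H2] := csmooth_cont oV sg Vu ltr01.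
exists (Num.min d (Num.min r1 r2)); first by rewrite !lt_min d0 r10.
exists ((1 + (cnorm (g u) + 1) ^+ 2) / (cnorm (del g u) / 2)) => v Hv.
have Hd : disc u d v by apply: lt_le_trans Hv _; rewrite ge_min lexx.
have /H1 K1 : cnorm (v - u) < r1 by apply: lt_le_trans Hv _; rewrite !ge_min lexx orbT.
have /H2 K2 : cnorm (v - u) < r2 by apply: lt_le_trans Hv _; rewrite !ge_min lexx !orbT.
rewrite (sph_chart oV Hd cm hg) -/g invfM invrK mulrC.
have L1 : cnorm (del g u) / 2 <= cnorm (del g v).
  have := cnormB (W false g v) (W false g v - W false g u).
  have -> : W false g v - (W false g v - W false g u) = W false g u by ring.
  have aux (x y t : R) : t < x / 2 -> x <= y + t -> x / 2 <= y by lra.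
  exact: aux K1.
have L2 : cnorm (g v) <= cnorm (g u) + 1.
  by have := cnormD (g v - g u) (g u); rewrite subrK => /le_trans; apply; rewrite addrC lerD2l ltW.
apply: ler_pM.
- by rewrite addr_ge0 // sqr_ge0.
- by rewrite invr_ge0 cnorm_ge0.
- rewrite lerD2l; apply: lerXn2r => //; rewrite ?nnegrE ?cnorm_ge0 //.
  by rewrite addr_ge0 // cnorm_ge0.
- by rewrite lef_pV2 ?posrE //; exact: lt_le_trans L1.
Qed.

(** A neighbourhood of c(u) consists of values of c near u: estimates in the coordinate u
    become estimates near c(u). *)
Lemma param_open U c u b : copen U -> holoP1_on U c -> U u -> dparam c u != 0 -> c u <> miss b ->
  forall rho : R, 0 < rho -> exists2 d : R, 0 < d & forall w, cnorm (w - chart b (c u)) < d ->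
    exists2 v, cnorm (v - u) < rho & c v = stdpar b w.
Proof.
move=> oU hc Uu du cu rho rho0.
have [d [d0 sd cm hg]] := holo_chart oU hc Uu cu.
have oV := @copen_disc R u d; have Vu := @disc_center R u d d0.
have dg : del (fun w => chart b (c w)) u != 0.
  move: du; rewrite (dparam_chart oV Vu cm hg).
  by apply: contraNneq => ->; rewrite mul0r.
have m0 : 0 < Num.min rho d by rewrite lt_min rho0.
have [t t0 Ht] := holo_open d0 hg dg m0.
exists t => // w /Ht [v Hv Ev]; exists v.
  by apply: lt_le_trans Hv _; rewrite ge_min lexx.
have Hd : disc u d v by apply: lt_le_trans Hv _; rewrite ge_min lexx orbT.
by rewrite -Ev stdpar_chart //; exact: cm.
Qed.

Lemma unit_chart p : exists b u, cnorm u <= 1 /\ p = stdpar b u.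
Proof.
case: p => [z|]; last by exists true, 0; rewrite cnorm0 /= /paroo eqxx.
have [z1|z1] := leP (cnorm z) 1; first by exists false, z.
exists true, z^-1; rewrite cnormV; split.
  by rewrite invf_le1 ?(lt_trans ltr01) // ltW.
have z0 : z != 0 by rewrite -cnorm_gt0 (lt_trans ltr01).
by rewrite /= /paroo invr_eq0 (negbTE z0) invrK.
Qed.

Section Norms.
Context {n : nat}.
Implicit Types (phi : form1 R n) (tau : P1 R -> C).

(** Norms of a one-form and of a two-form in the spherical metric; they do not depend on the
    coordinate, see [fnorm_pulls] and [tnorm_pull2]. *)
Definition fnorm phi p : R := dens p * (mnorm (phi p).1 + mnorm (phi p).2).
Definition tnorm tau p : R := dens p ^+ 2 * cnorm (tau p).
Definition pull2 c tau u : C := dparam c u * cj (dparam c u) * tau (c u).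

Lemma fnorm_ge0 phi p : 0 <= fnorm phi p.
Proof. by rewrite mulr_ge0 ?addr_ge0 ?mnorm_ge0 // ltW // dens_gt0. Qed.
Lemma fnorm_pulls c phi u :
  sph c u * fnorm phi (c u) = mnorm (pulls false c phi u) + mnorm (pulls true c phi u).
Proof.
rewrite !pullsE !mnormZ !cnorm_cjs /sph /fnorm -mulrDr mulrA.
by rewrite mulfVK // gt_eqF // dens_gt0.
Qed.

Lemma tnorm_pull2 c tau u : sph c u ^+ 2 * tnorm tau (c u) = cnorm (pull2 c tau u).
Proof.
rewrite /pull2 !cnormM cnormJ /sph /tnorm exprMn exprVn mulrA mulfVK; first by rewrite expr2.
by rewrite expf_neq0 // gt_eqF // dens_gt0.
Qed.

End Norms.
End Spherical.

Section OnSphere.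
Context {R : realType} {n m : nat}.
Variable a : conn_data R n m.
Local Notation C := R[i].
Local Notation cj := (@conjc R).
Implicit Types (z w u v : C) (b s : bool) (p : P1 R) (i : 'I_m).
Implicit Types (phi psi : form1 R n) (tau : P1 R -> C).

Local Notation O := (off_D a).
Local Notation c i := (locpar a i).
Local Notation rad i := (disc_rad a i).
Local Notation pt i := (Defs.point a i).

Lemma finite_radius (I : finType) (r : I -> R) : (forall j, 0 < r j) ->
  exists2 d : R, 0 < d & forall j, d <= r j.
Proof.
move=> H; exists (\big[Num.min/1]_j r j).
  by elim/big_rec: _ => // j x _ x0; rewrite lt_min x0 H.
by move=> j; exact: bigmin_le.
Qed.

Lemma popen_off : popen O.
Proof.
move=> b; apply/copenP => z Oz.
have H i : exists r : R, 0 < r /\ forall w, disc z r w -> stdpar b w <> pt i.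
  have [E|E] := pselect (pt i = miss b).
    by exists 1; split => // w _; rewrite E; exact: stdpar_miss.
  have nz : z - chart b (pt i) != 0.
    rewrite subr_eq0; apply/eqP => Ez; apply: (Oz i).
    by rewrite Ez stdpar_chart.
  exists (cnorm (z - chart b (pt i))); split; first by rewrite cnorm_gt0.
  move=> w Hw Ew; move: Hw; rewrite /disc /= -[w](chart_stdpar b) Ew.
  by rewrite cnorm_dist ltxx.
have [r Hr] := choice H.
have [d d0 Hd] := finite_radius (fun i => (Hr i).1).
exists d => // w Hw i; apply: (Hr i).2; exact: lt_le_trans Hw (Hd i).
Qed.

Lemma locpar0 i : disc 0 (rad i) (0 : C).
Proof. by apply: disc_center; exact: disc_rad_gt0. Qed.

Lemma locpar_off i u : disc 0 (rad i) u -> u != 0 -> O (c i u).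
Proof.
move=> Hu u0 j Ej.
have [ij|ij] := eqVneq i j.
  move: u0; apply/negP; rewrite negbK; apply/eqP.
  apply: (locpar_inj (i := i) Hu (locpar0 i)).
  by rewrite Ej ij.
exact: (locpar_disj ij Hu (locpar0 j)).
Qed.

Lemma on_D p : ~ O p -> exists i, p = pt i.
Proof. by move=> /existsNP [i /contrapT]; exists i. Qed.

(** Smooth off D, and bounded near each a_i in the coordinate z_i in which the Laurent
    expansions are given. *)
Definition bounded2 tau :=
  (forall b, csmooth_on (stdpar b @^-1` O) (pull2 (stdpar b) tau)) /\
  forall i, exists r K : R, 0 < r /\
    forall u, 0 < cnorm u < r -> cnorm (pull2 (c i) tau u) <= K.

Lemma csmooth_locbound U (f : C -> C) u : copen U -> csmooth_on U f -> U u ->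
  exists2 e : R, 0 < e & forall v, disc u e v -> cnorm (f v) <= cnorm (f u) + 1.
Proof.
move=> oU sf Uu; have [d d0 Hd] := csmooth_cont oU sf Uu ltr01; exists d => // v Hv.
have := cnormD (f v - f u) (f u); rewrite subrK => /le_trans; apply.
by rewrite addrC lerD2l ltW // Hd.
Qed.

(** The two closed unit discs cover the sphere and are compact; at a point of D, [param_open]
    turns the bound in the local coordinate into one in the standard chart. *)
Lemma sphere_bounded (A : set (P1 R)) (q : P1 R -> R) :
  (forall b u, O (stdpar b u) -> exists2 e : R, 0 < e &
     exists K : R, forall v, disc u e v -> A (stdpar b v) -> q (stdpar b v) <= K) ->
  (forall i, exists r K : R, 0 < r /\
     forall u, cnorm u < r -> A (c i u) -> q (c i u) <= K) ->
  exists2 K : R, 0 <= K & forall p, A p -> q p <= K.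
Proof.
move=> H1 H2.
have B b : exists2 K : R, 0 <= K & forall v, cnorm v <= 1 -> A (stdpar b v) -> q (stdpar b v) <= K.
  apply: (@loc_bounded R (fun v => q (stdpar b v)) (stdpar b @^-1` A) 1) => u _.
  have [Ou|/on_D [i Ei]] := pselect (O (stdpar b u)); first exact: H1.
  have [r [K [r0 HK]]] := H2 i.
  have m0 : 0 < Num.min r (rad i) by rewrite lt_min r0 disc_rad_gt0.
  have cm : c i 0 <> miss b by rewrite -[c i 0]/(pt i) -Ei; exact: stdpar_miss.
  have [d d0 Hd] := param_open (@copen_disc _ _ _) (@locpar_holo _ _ _ a i) (locpar0 i)
     (locpar_deriv (locpar0 i)) cm m0.
  exists d => //; exists K => w Hw Aw.
  have [v Hv Ev] : exists2 v, cnorm (v - 0) < Num.min r (rad i) & c i v = stdpar b w.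
    by apply: Hd; rewrite -[c i 0]/(pt i) -Ei chart_stdpar.
  rewrite -Ev; apply: HK; last by rewrite Ev.
  by move: Hv; rewrite subr0 lt_min => /andP[].
have [K1 K10 B1] := B true; have [K2 K20 B2] := B false.
exists (K1 + K2); first exact: addr_ge0.
move=> p Ap; have [b [u [u1 Ep]]] := unit_chart p.
rewrite Ep in Ap *; case: b Ap {Ep} => Ap.
  by apply: le_trans (B1 u u1 Ap) _; rewrite lerDl.
by apply: le_trans (B2 u u1 Ap) _; rewrite lerDr.
Qed.

Lemma sph_stdpar_le b u e v : disc u e v -> (sph (stdpar b) v)^-1 <= 1 + (cnorm u + e) ^+ 2.
Proof.
move=> Hv; rewrite sph_stdpar invrK lerD2l.
have e0 : 0 <= e by apply: le_trans (ltW Hv); exact: cnorm_ge0.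
apply: lerXn2r; rewrite ?nnegrE ?addr_ge0 ?cnorm_ge0 //.
have := cnormD (v - u) u; rewrite subrK => /le_trans; apply.
by rewrite addrC lerD2l ltW.
Qed.

Lemma from_pull (cc : C -> P1 R) u (x y s : R) : sph cc u ^+ 2 * x = y -> 0 < sph cc u ->
  (sph cc u)^-1 <= s -> 0 <= y -> x <= s ^+ 2 * y.
Proof.
move=> E s0 Hs y0.
have -> : x = (sph cc u)^-1 ^+ 2 * y.
  by rewrite -E mulrA -exprMn mulVf ?expr1n ?mul1r // gt_eqF.
apply: ler_wpM2r => //; apply: lerXn2r => //; rewrite ?nnegrE ?invr_ge0 ?sph_ge0 //.
by apply: le_trans Hs; rewrite invr_ge0 sph_ge0.
Qed.

Lemma sph_inner i (r : R) : r < rad i ->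
  exists2 K : R, 0 <= K & forall u, cnorm u <= r -> (sph (c i) u)^-1 <= K.
Proof.
move=> rr.
suff [K K0 H] : exists2 K : R, 0 <= K & forall v, cnorm v <= r -> setT v -> (sph (c i) v)^-1 <= K.
  by exists K => // u ur; apply: H.
apply: (@loc_bounded R (fun v => (sph (c i) v)^-1)) => u ur.
have Hu : disc 0 (rad i) u by rewrite /disc /= subr0; exact: le_lt_trans ur rr.
have [e e0 [K HK]] := sph_loc (@copen_disc _ _ _) (@locpar_holo _ _ _ a i) Hu (locpar_deriv Hu).
by exists e => //; exists K => v Hv _; exact: HK.
Qed.

(** Local bounds become, by compactness, a decay of order |z|^-4 in the affine coordinate. *)
Lemma bounded2_tnorm tau : bounded2 tau ->
  exists2 K : R, 0 <= K & forall p, O p -> tnorm tau p <= K.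
Proof.
move=> [N1 N2]; apply: sphere_bounded.
  move=> b u Ou.
  have [e e0 He] := csmooth_locbound (@popen_off b) (N1 b) Ou.
  exists e => //; exists ((1 + (cnorm u + e) ^+ 2) ^+ 2 * (cnorm (pull2 (stdpar b) tau u) + 1)) => v Hv _.
  have K := from_pull (tnorm_pull2 (stdpar b) tau v) _ (sph_stdpar_le b Hv) (cnorm_ge0 _).
  apply: le_trans (K _) _; first by apply: sph_gt0; rewrite dparam_stdpar dstd_neq0.
  apply: ler_wpM2l; first exact: sqr_ge0.
  exact: He.
move=> i; have [r [K [r0 HK]]] := N2 i.
have h0 : rad i / 2 < rad i by have := disc_rad_gt0 a i; lra.
have [S S0 HS] := sph_inner h0.
exists (Num.min r (rad i / 2)), (S ^+ 2 * K); split.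
  by rewrite lt_min r0 divr_gt0 // disc_rad_gt0.
move=> u; rewrite lt_min => /andP[ur uh] Ou.
have u0 : u != 0 by apply/eqP => u0; apply: (Ou i); rewrite u0.
have Hu : disc 0 (rad i) u by rewrite /disc /= subr0; exact: lt_trans uh h0.
have E := from_pull (tnorm_pull2 (c i) tau u) _ (HS u (ltW uh)) (cnorm_ge0 _).
apply: le_trans (E _) _; first by apply: sph_gt0; exact: locpar_deriv.
by apply: ler_wpM2l; [exact: sqr_ge0 | apply: HK; rewrite cnorm_gt0 u0].
Qed.

End OnSphere.

(** * Dominated integrals on the plane *)

Section PlaneIntegral.
Context {R : realType}.
Local Notation mR := (measurableTypeR R).
Local Notation T2 := (mR * mR)%type.
Local Notation mu := (@lebesgue_measure R).
Local Notation mu2 := (mu \x mu)%E.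
Implicit Types (U Z : set (R * R)) (f g P Q : R * R -> R).

(** The product sigma-algebra is generated by rectangles; an open set is a countable union
    of rational boxes. *)
Lemma open2_measurable U : open U -> measurable (U : set T2).
Proof.
move=> oU.
pose box (x y r : rat) : set (R * R) :=
  [set p | `|p.1 - ratr x| < ratr r /\ `|p.2 - ratr y| < ratr r].
pose F x y r := if `[< box x y r `<=` U >] then box x y r else set0.
have -> : U = \bigcup_x \bigcup_y \bigcup_r F x y r.
  apply/seteqP; split=> [p Up|p [x _ [y _ [r _]]]]; last first.
    by rewrite /F; case: asboolP => // H; exact: H.
  have [e e0 He] := (nbhs_pP p U).1 (open_nbhs_nbhs (conj oU Up)).
  have h0 : 0 < e / 2 by rewrite divr_gt0.
  have [r /=] := rat_in_itvoo h0; rewrite in_itv /= => /andP[r0 rh].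
  have near_rat (t : R) : exists q : rat, `|t - ratr q| < ratr r.
    have lt : t - ratr r < t + ratr r by lra.
    have [q] := rat_in_itvoo lt; rewrite in_itv /= => /andP[q1 q2].
    by exists q; rewrite distrC ltr_distl q1.
  have [x Hx] := near_rat p.1; have [y Hy] := near_rat p.2.
  exists x => //; exists y => //; exists r => //.
  rewrite /F; case: asboolP => [_ //|]; case=> q [/= Q1 Q2]; apply: He.
  have tri (s t w v d : R) : `|s - w| < v -> `|t - w| < v -> v < d / 2 -> `|s - t| < d.
    rewrite !ltr_distl => /andP[a1 a2] /andP[b1 b2] vd; apply/andP; split; lra.
  by rewrite normp_lt /=; apply/andP; split; [exact: tri Q1 Hx rh | exact: tri Q2 Hy rh].
apply: bigcupT_measurable_rat => x; apply: bigcupT_measurable_rat => y.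
apply: bigcupT_measurable_rat => r; rewrite /F; case: asboolP => // _.
have -> : box x y r = `](ratr x - ratr r), (ratr x + ratr r)[%classic `*`
    `](ratr y - ratr r), (ratr y + ratr r)[%classic.
  by apply/seteqP; split=> -[s t]; rewrite /box /= !in_itv /= !ltr_distl.
by apply: measurableX; exact: measurable_itv.
Qed.

Lemma cont_measurable U f : open U -> (forall p, U p -> {for p, continuous f}) ->
  measurable_fun (U : set T2) f.
Proof.
move=> oU cf; apply: (measurability _ (RGenOpens.measurableE R)).
move=> _ [_ [a [b ->] <-]]; apply: open2_measurable.
rewrite openE => p [Up fp]; rewrite /interior.
have oI : nbhs (f p) `]a, b[%classic.
  by apply: open_nbhs_nbhs; split; [exact: interval_open | exact: fp].
have N := cf p Up _ oI.
by apply: filterI; [exact: open_nbhs_nbhs | exact: N].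
Qed.

Lemma finite2_measurable Z : finite_set Z -> measurable (Z : set T2).
Proof.
move=> fZ; apply: countable_measurable; last exact: finite_set_countable.
move=> [x y].
have -> : [set (x, y)] = [set x] `*` [set y] :> set T2.
  by apply/seteqP; split=> -[s t] /= [-> ->].
by apply: measurableX; exact: measurable_set1.
Qed.

Lemma finite2_null Z : finite_set Z -> mu2 Z = 0%E.
Proof.
move=> fZ.
have fF : finite_set (fst @` Z) by exact: finite_image.
have mF : measurable (fst @` Z : set mR).
  by apply: countable_measurable; [move=> t; exact: measurable_set1 | exact: finite_set_countable].
apply: (@subset_measure0 _ _ _ mu2 Z ((fst @` Z) `*` setT)).
- exact: finite2_measurable.
- exact: measurableX.
- by move=> p Zp; split => //=; exists p.
have E := @product_measure1E _ _ mR mR R mu mu (fst @` Z) setT mF measurableT.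
apply: etrans E _.
rewrite [X in (X * _)%E](_ : _ = 0%E) ?mul0e //.
by apply: countable_lebesgue_measure0; exact: finite_set_countable.
Qed.

Lemma finite2_open Z : finite_set Z -> open (~` Z).
Proof.
move=> fZ; apply: closed_openC; apply: accessible_finite_set_closed.1 fZ.
exact: hausdorff_accessible (@norm_hausdorff R (R * R)%type).
Qed.

Lemma cont_off_measurable Z f : finite_set Z -> (forall p, ~ Z p -> {for p, continuous f}) ->
  measurable_fun (setT : set T2) f.
Proof.
move=> fZ cf; rewrite -(setvU (Z : set T2)); apply/measurable_funU.
- by apply: measurableC; exact: finite2_measurable.
- exact: finite2_measurable.
split; first by apply: cont_measurable; [exact: finite2_open | exact: cf].
move=> mZ Y mY; apply: finite2_measurable; apply: sub_finite_set fZ.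
by move=> p [].
Qed.

(** A product, so that Tonelli's theorem gives its integral; it dominates (1 + |z|^2)^-2. *)
Definition wt (p : R * R) : R := (oneDsqr p.1)^-1 * (oneDsqr p.2)^-1.

Lemma oneDsqr_gt0 (x : R) : 0 < oneDsqr x.
Proof. by apply: lt_le_trans (oneDsqr_ge1 x). Qed.

Lemma wt_gt0 p : 0 < wt p.
Proof. by rewrite mulr_gt0 // invr_gt0 oneDsqr_gt0. Qed.

Lemma oneDsqrV_cont2 : (forall p, {for p, continuous wt}).
Proof.
move=> p; rewrite /wt; apply: cvgM.
  by apply: (cvg_comp _ (fun x : R => (oneDsqr x)^-1) cvg_fst); exact: continuous_oneDsqrV.
by apply: (cvg_comp _ (fun x : R => (oneDsqr x)^-1) cvg_snd); exact: continuous_oneDsqrV.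
Qed.

Lemma integral_oneDsqrV_lty : (\int[mu]_x ((oneDsqr x)^-1)%:E < +oo)%E.
Proof.
rewrite ge0_symfun_integralT.
- rewrite -set_itvcy integral0y_oneDsqr -EFinM; exact: ltry.
- by move=> x; rewrite invr_ge0 ltW // oneDsqr_gt0.
- exact: continuous_oneDsqrV.
- by move=> x /=; rewrite /oneDsqr sqrrN.
Qed.

Lemma wt_measurable : measurable_fun (setT : set T2) wt.
Proof. by apply: cont_measurable; [exact: openT | move=> p _; exact: oneDsqrV_cont2]. Qed.

Lemma wt_integrable : mu2.-integrable setT (EFin \o (wt : T2 -> R)).
Proof.
apply/integrable12ltyP; first by apply/measurable_EFinP; exact: wt_measurable.
have m1 : measurable_fun (setT : set mR) (fun x => (oneDsqr x)^-1 : R).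
  by apply: continuous_measurable_fun; exact: continuous_oneDsqrV.
have fin := integral_oneDsqrV_lty.
set J := (\int[mu]_x ((oneDsqr x)^-1)%:E)%E in fin.
have J0 : (0 <= J)%E.
  by apply: integral_ge0 => x _; rewrite lee_fin invr_ge0 ltW // oneDsqr_gt0.
have E x : (\int[mu]_y `|(EFin \o wt) (x, y)|)%E = (((oneDsqr x)^-1)%:E * J)%E.
  rewrite -ge0_integralZl //.
  - apply: eq_integral => y _ /=.
    by rewrite ger0_norm ?ltW ?wt_gt0.
  - exact/measurable_EFinP.
have E2 : (\int[mu]_x (((oneDsqr x)^-1)%:E * J) = J * J)%E.
  rewrite ge0_integralZr //.
  exact/measurable_EFinP.
have Jf : J \is a fin_num by rewrite ge0_fin_numE.
apply: (@le_lt_trans _ _ (J * J)%E); last exact: (lte_mul_pinfty J0 Jf fin).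
by rewrite -E2 le_eqVlt; apply/orP; left; apply/eqP; apply: eq_integral => x _; exact: E.
Qed.

Definition wt_mass : R := \int[mu2]_p wt p.

Lemma wtK_ge0 : 0 <= wt_mass.
Proof. by apply: Rintegral_ge0 => p _; rewrite ltW ?wt_gt0. Qed.

Lemma dominated_integrable2 Z f (K : R) : finite_set Z -> 0 <= K ->
  (forall p, ~ Z p -> {for p, continuous f}) -> (forall p, ~ Z p -> `|f p| <= K * wt p) ->
  mu2.-integrable setT (EFin \o (f : T2 -> R)) /\ `|\int[mu2]_p f p| <= K * wt_mass.
Proof.
move=> fZ K0 cf bf.
have mZ := finite2_measurable fZ; have nZ := finite2_null fZ.
have mf := cont_off_measurable fZ cf.
have mD : measurable (setT `\` Z : set T2) by exact: measurableD.
have iW : mu2.-integrable (setT `\` Z) (EFin \o (fun p : T2 => K * wt p)).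
  rewrite (_ : EFin \o _ = fun p => (K%:E * (EFin \o wt) p)%E) //.
  apply: integrableZl => //; apply: integrableS wt_integrable => //.
have iD : mu2.-integrable (setT `\` Z) (EFin \o (f : T2 -> R)).
  apply: le_integrable iW => //.
    by apply/measurable_EFinP; apply: measurable_funS mf.
  move=> p [_ Zp] /=; rewrite lee_fin [leRHS]ger0_norm; first exact: bf.
  by rewrite mulr_ge0 // ltW // wt_gt0.
have iT : mu2.-integrable setT (EFin \o (f : T2 -> R)).
  by apply/(negligible_integrable mZ) => //; exact/measurable_EFinP.
split=> //.
have -> : \int[mu2]_p f p = \int[mu2]_(p in setT `\` Z) f p.
  by rewrite /Rintegral (negligible_integral mZ).
have -> : wt_mass = \int[mu2]_(p in setT `\` Z) wt p.
  by rewrite /wt_mass /Rintegral (negligible_integral mZ) //; exact: wt_integrable.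
rewrite -RintegralZl //; last by apply: integrableS wt_integrable.
apply: le_trans (le_normr_Rintegral mD iD) _.
apply: le_Rintegral => //; last by move=> p [_ Zp]; exact: bf.
rewrite (_ : EFin \o _ = abse \o (EFin \o (f : T2 -> R))) //.
exact: integrable_abse.
Qed.

End PlaneIntegral.

(** * The divergence theorem on the plane *)

Section Stokes.
Context {R : realType}.
Local Notation mR := (measurableTypeR R).
Local Notation T2 := (mR * mR)%type.
Local Notation mu := (@lebesgue_measure R).
Local Notation mu2 := (mu \x mu)%E.
Implicit Types (f g P Q : R * R -> R) (b : bool).

Definition square (N : R) : set (R * R) := [set p | `|p| <= N].
Definition pt b (s t : R) : R * R := if b then (t, s) else (s, t).

Lemma pt_line b (s t : R) : pt b 0 t + s *: dir b = pt b s t.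
Proof. by case: b; rewrite /pt /dir scalepE addpE /= ?mulr1 ?mulr0 ?add0r ?addr0. Qed.

Lemma pt_square b (N s t : R) : square N (pt b s t) <-> `|s| <= N /\ `|t| <= N.
Proof.
by case: b; rewrite /square /pt /= normp_le /=; split=> [/andP[]|[-> ->]].
Qed.

(** Along a line in direction b the fundamental theorem of calculus leaves two boundary
    values. *)
Lemma square_inner b P (K N t : R) : 0 < N ->
  (forall p, differentiable P p) -> (forall p, {for p, continuous ('D_(dir b) P)}) ->
  (forall p, `|P p| <= K / (1 + `|p| ^+ 2)) ->
  (`|\int[mu]_s ((('D_(dir b) P) \_ (square N)) (pt b s t))%:E| <=
    (2 * K / (1 + N ^+ 2) * \1_(`[- N, N]%classic : set mR) t)%:E)%E.
Proof.
move=> N0 dP cP bP.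
have D s : is_derive s (1 : R) (fun s => P (pt b s t)) ('D_(dir b) P (pt b s t)).
  have E : (fun s => P (pt b s t)) = fun s => P (pt b 0 t + s *: dir b).
    by apply/funext => s'; rewrite pt_line.
  have S := @is_derive_slice R P (pt b 0 t) (dir b) s (@diff_derivable _ _ _ _ _ (dir b) (dP _)).
  by move: S; rewrite pt_line -E.
have [tN|tN] := boolP (`|t| <= N); last first.
  have -> : \1_(`[- N, N]%classic : set mR) t = 0 :> R.
    by rewrite indicE; case: (boolP (_ \in _)) => //; rewrite inE /= in_itv /= -ler_norml (negbTE tN).
  rewrite mulr0 (_ : (\int[mu]_s _)%E = 0%E) ?abse0 //.
  apply: integral0_eq => s _; rewrite patchE; case: (boolP (_ \in _)) => //.
  by rewrite inE => /pt_square[_]; rewrite (negbTE tN).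
have -> : \1_(`[- N, N]%classic : set mR) t = 1 :> R.
  by rewrite indicE mem_set //= in_itv /= -ler_norml.
rewrite mulr1.
have lt : - N < N by rewrite gtrN.
have E : (\int[mu]_s ((('D_(dir b) P) \_ (square N)) (pt b s t))%:E =
   (P (pt b N t))%:E - (P (pt b (- N) t))%:E)%E.
  rewrite -(@continuous_FTC2 R (fun s => 'D_(dir b) P (pt b s t)) (fun s => P (pt b s t)) (- N) N lt).
  - rewrite [RHS]integral_mkcond; apply: eq_integral => s _.
    rewrite patchE [RHS]patchE.
    have -> : (pt b s t \in square N) = (s \in `[- N, N]%classic).
      apply/idP/idP; rewrite !inE /= in_itv /= -ler_norml.
        by move=> /pt_square[].
      by move=> sN; apply/pt_square.
    by case: ifP.
  - apply: continuous_subspaceT => s.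
    have C : {for s, continuous (fun s => pt b s t)}.
      apply: differentiable_continuous.
      by case: b {dP cP bP D}; apply: differentiable_pair => //; exact: differentiable_cst.
    exact: (continuous_comp C (cP _)).
  - have DC s : {for s, continuous (fun s => P (pt b s t))}.
      by apply: differentiable_continuous; apply/derivable1_diffP; have [] := D s.
    split; first by move=> s _; have [] := D s.
      exact: cvg_at_right_filter (DC _).
    exact: cvg_at_left_filter (DC _).
  - by move=> s _; rewrite derive1E; have [_ ->] := D s.
rewrite E -EFinB /= lee_fin (le_trans (ler_normB _ _)) //.
have K0 : 0 <= K.
  by have := le_trans (normr_ge0 _) (bP 0); rewrite normr0 expr0n /= addr0 divr1.
have B s : `|s| = N -> `|P (pt b s t)| <= K / (1 + N ^+ 2).
  move=> sN; apply: le_trans (bP _) _; apply: ler_wpM2l => //.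
  rewrite lef_pV2 ?posrE ?ltr_wpDr ?sqr_ge0 // lerD2l.
  apply: lerXn2r; rewrite ?nnegrE ?normr_ge0 ?(ltW N0) //.
  by rewrite -{1}sN; case: b {dP cP bP D E}; [exact: normp_snd (t, s) | exact: normp_fst (s, t)].
have := B N (ger0_norm (ltW N0)); have := B (- N); rewrite normrN => /(_ (ger0_norm (ltW N0))).
by rewrite -mulrA; lra.
Qed.

Lemma square_wt (N : R) p : square N p -> 1 <= (1 + N ^+ 2) ^+ 2 * wt p.
Proof.
rewrite /square /= normp_le => /andP[p1 p2]; rewrite /wt.
rewrite -invfM ler_pdivlMr ?mul1r ?mulr_gt0 ?oneDsqr_gt0 // expr2.
have H (x : R) : `|x| <= N -> oneDsqr x <= 1 + N ^+ 2.
  move=> xN; rewrite /oneDsqr lerD2l -(real_normK (num_real x)).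
  by apply: lerXn2r; rewrite ?nnegrE ?normr_ge0 // (le_trans _ xN).
by apply: ler_pM; rewrite ?(ltW (oneDsqr_gt0 _)) ?H.
Qed.

Lemma square_measurable (N : R) : measurable (square N : set T2).
Proof.
have -> : square N = `[- N, N]%classic `*` `[- N, N]%classic :> set T2.
  apply/seteqP; split=> -[s t]; rewrite /square /= !in_itv /= -!ler_norml normp_le /=.
    by move=> /andP[].
  by move=> [-> ->].
by apply: measurableX; exact: measurable_itv.
Qed.

Lemma square_integrable f (N : R) : (forall p, {for p, continuous f}) ->
  mu2.-integrable setT (EFin \o ((f \_ (square N)) : T2 -> R)).
Proof.
move=> cf.
have mf : measurable_fun (setT : set T2) (f \_ (square N)).
  apply/(measurable_restrictT (f : T2 -> R) (square_measurable N)).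
  apply: (@measurable_funS _ _ T2 mR setT (square N) f) => //.
  by apply: cont_measurable; [exact: openT | move=> p _; exact: cf].
have [K HK] : exists K : R, forall p, square N p -> `|f p| <= K.
  have [[p0 p0N]|ne] := pselect (square N !=set0); last first.
    by exists 0 => p pN; exfalso; apply: ne; exists p.
  have -> : square N = [set q : R * R | `|q - 0| <= N].
    by apply/seteqP; split=> q; rewrite /square /= subr0.
  have ne : [set q : R * R | `|q - 0| <= N] !=set0 by exists p0; rewrite /= subr0.
  have cn : {within [set q : R * R | `|q - 0| <= N], continuous (fun p => `|f p|)}.
    by apply: continuous_subspaceT => p; apply: (continuous_comp (cf p)); exact: norm_continuous.
  have [p _ Hp] := compact_EVT_max ne (@box_compact R 0 N) cn.
  by exists `|f p| => q Hq; apply: Hp; rewrite inE.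
have iW : mu2.-integrable setT (EFin \o (fun p : T2 => K * (1 + N ^+ 2) ^+ 2 * wt p)).
  rewrite (_ : EFin \o _ = fun p => ((K * (1 + N ^+ 2) ^+ 2)%:E * (EFin \o wt) p)%E) //.
  by apply: integrableZl => //; exact: wt_integrable.
apply: le_integrable iW => //; first exact/measurable_EFinP.
move=> p _; rewrite /= lee_fin patchE; case: ifPn; rewrite ?normr0 // inE => pN.
have K0 : 0 <= K by apply: le_trans (HK p pN).
apply: le_trans (HK p pN) _; rewrite ger0_norm.
  by rewrite -mulrA ler_peMr // square_wt.
by rewrite !mulr_ge0 ?exprn_ge0 ?addr_ge0 ?sqr_ge0 // ltW // wt_gt0.
Qed.

Lemma square_bound b P (K N : R) : 0 < N ->
  (forall p, differentiable P p) -> (forall p, {for p, continuous ('D_(dir b) P)}) ->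
  (forall p, `|P p| <= K / (1 + `|p| ^+ 2)) ->
  `|\int[mu2]_p ((('D_(dir b) P) \_ (square N)) p)| <= 4 * K * N / (1 + N ^+ 2).
Proof.
move=> N0 dP cP bP.
have ig := square_integrable N cP.
have K0 : 0 <= K.
  by have := le_trans (normr_ge0 _) (bP 0); rewrite normr0 expr0n /= addr0 divr1.
have inner t := square_inner t N0 dP cP bP.
set g := 'D_(dir b) P \_ (square N) in ig inner *.
pose G (t : mR) : \bar R := (\int[mu]_s (g (pt b s t))%:E)%E.
have mG : measurable_fun setT G.
  case: b dP cP @g ig inner @G => dP cP g ig inner G.
    exact: (measurable_fubini_F ig).
  exact: (measurable_fubini_G ig).
have EG : (\int[mu2]_p (EFin \o g) p = \int[mu]_t G t)%E.
  case: b dP cP @g ig inner @G mG => dP cP g ig inner G mG.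
    exact: esym (integral12_prod_meas1 ig).
  exact: esym (integral21_prod_meas1 ig).
rewrite -lee_fin EFin_normr_Rintegral // EG.
apply: le_trans (le_abse_integral _ measurableT mG) _.
have mI : measurable (`[- N, N]%classic : set mR) by exact: measurable_itv.
have m1 : measurable_fun (setT : set mR) (\1_(`[- N, N]%classic : set mR) : mR -> R).
  by apply: measurable_indic.
have c0 : 0 <= 2 * K / (1 + N ^+ 2).
  by rewrite divr_ge0 ?mulr_ge0 // addr_ge0 // sqr_ge0.
apply: (@le_trans _ _ (\int[mu]_t (2 * K / (1 + N ^+ 2) * \1_(`[- N, N]%classic : set mR) t)%:E)%E).
  apply: ge0_le_integral => //.
  - exact: measurableT_comp.
  - by apply/measurable_EFinP; exact: measurable_funM.
  - by move=> t _; exact: inner.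
under eq_integral do rewrite EFinM.
rewrite ge0_integralZl //.
- rewrite integral_indic // setIT [X in (_ * X)%E](_ : _ = (N + N)%:E); last first.
    by apply: etrans (@lebesgue_measure_itv R `[- N, N]) _; rewrite /= lte_fin gtrN // -EFinB opprK.
  by rewrite -EFinM lee_fin le_eqVlt; apply/orP; left; apply/eqP; ring.
- exact/measurable_EFinP.
Qed.

(** The boundary terms on the square of size N are O(1/N), and dominated convergence lets N
    tend to infinity. *)
Lemma stokes_real P Q (K : R) :
  (forall p, differentiable P p) -> (forall p, {for p, continuous ('D_(dir false) P)}) ->
  (forall p, differentiable Q p) -> (forall p, {for p, continuous ('D_(dir true) Q)}) ->
  (forall p, `|P p| <= K / (1 + `|p| ^+ 2)) -> (forall p, `|Q p| <= K / (1 + `|p| ^+ 2)) ->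
  (forall p, `|'D_(dir false) P p + 'D_(dir true) Q p| <= K * wt p) ->
  \int[mu2]_p ('D_(dir false) P p + 'D_(dir true) Q p) = 0.
Proof.
move=> dP cP dQ cQ bP bQ bh.
pose h p := 'D_(dir false) P p + 'D_(dir true) Q p.
have ch p : {for p, continuous h} by exact: (@continuousD _ _ _ _ _ _ (cP p) (cQ p)).
have K0 : 0 <= K.
  by have := le_trans (normr_ge0 _) (bP 0); rewrite normr0 expr0n /= addr0 divr1.
have [ih _] := @dominated_integrable2 R set0 h K (finite_set0 _) K0 (fun p _ => ch p) (fun p _ => bh p).
pose u n : R := \int[mu2]_p ((h \_ (square n.+1%:R)) p).
have bu n : `|u n| <= 8 * K * (n.+1%:R)^-1.
  have N0 : 0 < n.+1%:R :> R by rewrite ltr0n.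
  have EE : u n = \int[mu2]_p ((('D_(dir false) P) \_ (square n.+1%:R)) p) +
      \int[mu2]_p ((('D_(dir true) Q) \_ (square n.+1%:R)) p).
    rewrite -RintegralD //; [|exact: square_integrable|exact: square_integrable].
    by apply: eq_Rintegral => p _; rewrite !patchE; case: ifP => //; rewrite addr0.
  rewrite EE (le_trans (ler_normD _ _)) //.
  have B1 := square_bound N0 dP cP bP; have B2 := square_bound N0 dQ cQ bQ.
  have B3 : 4 * K * n.+1%:R / (1 + n.+1%:R ^+ 2) <= 4 * K * (n.+1%:R)^-1 :> R.
    rewrite -mulrA; apply: ler_wpM2l; first by rewrite mulr_ge0.
    rewrite ler_pdivrMr ?ltr_wpDr ?sqr_ge0 // mulrC expr2 mulrDl mul1r -mulrA divff ?gt_eqF //.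
    by rewrite mulr1 lerDr invr_ge0 ltW.
  have -> : 8 * K / n.+1%:R = 4 * K / n.+1%:R + 4 * K / n.+1%:R by rewrite -mulrDl; congr (_ / _); ring.
  by apply: lerD; [exact: le_trans B1 B3 | exact: le_trans B2 B3].
have H1 n : measurable_fun (setT : set T2) (EFin \o (h \_ (square n.+1%:R) : T2 -> R)).
  exact: measurable_int (square_integrable n.+1%:R ch).
have H2 : measurable_fun (setT : set T2) (EFin \o (h : T2 -> R)) by exact: measurable_int ih.
have H3 : {ae mu2, forall p, setT p ->
    (fun n => (EFin \o (h \_ (square n.+1%:R) : T2 -> R)) p) @ \oo --> (EFin \o (h : T2 -> R)) p}.
  apply: aeW => p _; apply: cvg_near_cst; exists (Num.bound `|p|) => // n /= Hn.
  rewrite patchE mem_set // /square /=; apply: ltW; apply: lt_le_trans (archi_boundP (normr_ge0 p)) _.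
  by rewrite ler_nat; apply: leq_trans Hn _.
have H4 : mu2.-integrable setT (EFin \o (fun p : T2 => K * wt p)).
  rewrite (_ : EFin \o _ = fun p => (K%:E * (EFin \o wt) p)%E) //.
  by apply: integrableZl => //; exact: wt_integrable.
have H5 : {ae mu2, forall p n, setT p ->
    (`|(EFin \o (h \_ (square n.+1%:R) : T2 -> R)) p| <= (EFin \o (fun p : T2 => (K * wt p)%R)) p)%E}.
  apply: aeW => p n _; rewrite /= lee_fin patchE; case: ifP => _; first exact: bh.
  by rewrite normr0 mulr_ge0 // ltW // wt_gt0.
have [_ _ H6] := dominated_convergence measurableT H1 H2 H3 H4 H5.
have cv : u @ \oo --> \int[mu2]_p h p.
  have fh : (\int[mu2]_p (EFin \o (h : T2 -> R)) p)%E \is a fin_num by exact: integrable_fin_num.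
  rewrite /Rintegral; apply: fine_cvg; rewrite fineK //.
have u0 : u @ \oo --> (0 : R).
  have c8 : (fun n => 8 * K * (n.+1%:R)^-1) @ \oo --> (0 : R).
    rewrite -(mulr0 (8 * K)); apply: cvgM; [exact: cvg_cst | exact: cvg_harmonic].
  have cN8 : (fun n => - (8 * K * (n.+1%:R)^-1)) @ \oo --> (0 : R).
    by rewrite -oppr0; exact: cvgN.
  apply: squeeze_cvgr cN8 c8; apply: nearW => n.
  by rewrite -ler_norml; exact: bu.
exact: (cvg_unique _ cv u0).
Qed.

End Stokes.

(** * Integration of two-forms over the sphere *)

Section SphereIntegral.
Context {R : realType} {n m : nat}.
Variable a : conn_data R n m.
Local Notation C := R[i].
Local Notation mR := (measurableTypeR R).
Local Notation T2 := (mR * mR)%type.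
Local Notation mu := (@lebesgue_measure R).
Local Notation mu2 := (mu \x mu)%E.
Implicit Types (z w u v : C) (b s : bool) (p : P1 R) (i : 'I_m).
Implicit Types (tau : P1 R -> C).
Local Notation O := (off_D a).

Definition exceptional : set (R * R) := [set q | ~ O (Some (toC q))].

Lemma exceptional_finite : finite_set exceptional.
Proof.
apply: (@sub_finite_set _ _ [set ofC (chart false (Defs.point a i)) | i in [set: 'I_m]]).
  move=> q /on_D [i Ei]; exists i => //.
  by rewrite -Ei /= toC_K.
by apply: finite_image; exact: finite_finset.
Qed.

Lemma pull2_par0 tau z : pull2 (stdpar false) tau z = tau (Some z).
Proof. by rewrite /pull2 dparam_stdpar /dstd conjc1 !mul1r. Qed.

Lemma bounded2_cont tau q : bounded2 a tau -> ~ exceptional q ->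
  {for q, continuous (fun q : R * R => complex.Re (tau (Some (toC q))))} /\
  {for q, continuous (fun q : R * R => complex.Im (tau (Some (toC q))))}.
Proof.
move=> [N1 _] /contrapT Oq.
have := csmooth_cdiff (@popen_off _ _ _ a false) (N1 false) Oq.
rewrite /cdiff toC_K.
have -> : pull2 (stdpar false) tau = fun z => tau (Some z).
  by apply/funext => z; exact: pull2_par0.
by move=> [D1 D2]; split; [exact: differentiable_continuous D1 | exact: differentiable_continuous D2].
Qed.

Lemma wt_dens z (K t : R) : 0 <= K -> (1 + cnorm z ^+ 2) ^+ 2 * t <= K -> t <= K * wt (ofC z).
Proof.
move=> K0; rewrite cnorm_sqr /wt /oneDsqr /= => H.
move: H; move: (complex.Re z) (complex.Im z) => x y H.
have P : 0 < (1 + x ^+ 2) * (1 + y ^+ 2).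
  by rewrite mulr_gt0 // ltr_wpDr // sqr_ge0.
rewrite -invfM ler_pdivlMr //.
have [t0|t0] := leP 0 t; last first.
  by apply: le_trans K0; rewrite pmulr_lle0 // ltW.
apply: le_trans H; rewrite mulrC; apply: ler_wpM2r => //.
have := sqr_ge0 x; have := sqr_ge0 y.
move: (x ^+ 2) (y ^+ 2) => s r; nra.
Qed.

Lemma bounded2_wt tau (K : R) : 0 <= K -> (forall p, O p -> tnorm tau p <= K) -> forall q, ~ exceptional q ->
  cnorm (tau (Some (toC q))) <= K * wt q.
Proof.
move=> K0 H q /contrapT Oq; rewrite -[in wt q](toC_K q).
exact: (wt_dens K0 (H _ Oq)).
Qed.

Lemma bounded2_integrable tau (K : R) : bounded2 a tau -> 0 <= K -> (forall p, O p -> tnorm tau p <= K) ->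
  (mu2.-integrable setT (EFin \o ((fun q => complex.Re (tau (Some (toC q)))) : T2 -> R)) /\
   mu2.-integrable setT (EFin \o ((fun q => complex.Im (tau (Some (toC q)))) : T2 -> R))) /\
  (`|\int[mu2]_q complex.Re (tau (Some (toC q)))| <= K * wt_mass /\
   `|\int[mu2]_q complex.Im (tau (Some (toC q)))| <= K * wt_mass).
Proof.
move=> N K0 H; have B := bounded2_wt K0 H.
have [I1 B1] := dominated_integrable2 exceptional_finite K0 (fun q Hq => (bounded2_cont N Hq).1)
  (fun q Hq => le_trans (cnorm_Re _) (B q Hq)).
have [I2 B2] := dominated_integrable2 exceptional_finite K0 (fun q Hq => (bounded2_cont N Hq).2)
  (fun q Hq => le_trans (cnorm_Im _) (B q Hq)).
by [].
Qed.

(** All continuity statements below go through this estimate. *)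
Lemma integralP1_bound tau (K : R) : bounded2 a tau -> 0 <= K -> (forall p, O p -> tnorm tau p <= K) ->
  cnorm (integralP1 tau) <= 4 * wt_mass * K.
Proof.
move=> N K0 H; have [_ [B1 B2]] := bounded2_integrable N K0 H.
rewrite /integralP1 cnormM.
have -> : cnorm (- 2 * 'i : C) = 2.
  rewrite cnormM cnormN -[(2 : C)]/((2%:R : C)) -(rmorph_nat (real_complex R)) cnorm_real.
  have -> : cnorm ('i : C) = 1 by exact: cnormi.
  by rewrite mulr1 ger0_norm.
have -> : 4 * wt_mass * K = 2 * (K * wt_mass + K * wt_mass) by ring.
apply: ler_wpM2l => //; apply: le_trans (cnorm_ReIm _) _ => /=; exact: lerD.
Qed.

Lemma bounded2D tau1 tau2 : bounded2 a tau1 -> bounded2 a tau2 -> bounded2 a (fun p => tau1 p + tau2 p).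
Proof.
move=> [A1 B1] [A2 B2].
have E c : pull2 c (fun p => tau1 p + tau2 p) = fun z => pull2 c tau1 z + pull2 c tau2 z.
  by apply/funext => z; rewrite /pull2 mulrDr.
split=> [b|i].
  by rewrite E; apply: csmoothD; [exact: popen_off | exact: A1 | exact: A2].
have [r1 [K1 [r10 H1]]] := B1 i; have [r2 [K2 [r20 H2]]] := B2 i.
exists (Num.min r1 r2), (K1 + K2); split; first by rewrite lt_min r10.
move=> u /andP[u0]; rewrite lt_min => /andP[ur1 ur2]; rewrite E.
by apply: le_trans (cnormD _ _) _; apply: lerD; [apply: H1|apply: H2]; rewrite u0.
Qed.

Lemma bounded2Z (t : C) tau : bounded2 a tau -> bounded2 a (fun p => t * tau p).
Proof.
move=> [A1 B1].
have E c : pull2 c (fun p => t * tau p) = fun z => t * pull2 c tau z.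
  by apply/funext => z; rewrite /pull2 mulrCA.
split=> [b|i].
  by rewrite E; apply: csmoothZ; [exact: popen_off | exact: A1].
have [r1 [K1 [r10 H1]]] := B1 i.
exists r1, (cnorm t * K1); split => // u ur; rewrite E cnormM.
by apply: ler_wpM2l; [exact: cnorm_ge0 | exact: H1].
Qed.

Lemma integralP1D tau1 tau2 : bounded2 a tau1 -> bounded2 a tau2 ->
  integralP1 (fun p => tau1 p + tau2 p) = integralP1 tau1 + integralP1 tau2.
Proof.
move=> N1 N2.
have [K1 K10 H1] := bounded2_tnorm N1; have [K2 K20 H2] := bounded2_tnorm N2.
have [[I1 I2] _] := bounded2_integrable N1 K10 H1; have [[J1 J2] _] := bounded2_integrable N2 K20 H2.
rewrite /integralP1 -mulrDr; congr (_ * _).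
apply: complex_ext => /=; rewrite -RintegralD //; apply: eq_Rintegral => q _.
  exact: ReD.
exact: ImD.
Qed.

Lemma integralP1Z (t : C) tau : bounded2 a tau ->
  integralP1 (fun p => t * tau p) = t * integralP1 tau.
Proof.
move=> N1; have [K1 K10 H1] := bounded2_tnorm N1.
have [[I1 I2] _] := bounded2_integrable N1 K10 H1.
rewrite /integralP1 mulrCA; congr (_ * _).
have cI (r : R) f : mu2.-integrable setT (EFin \o (f : T2 -> R)) ->
    mu2.-integrable setT (EFin \o ((fun q => r * f q) : T2 -> R)).
  move=> If; rewrite (_ : EFin \o _ = fun q => (r%:E * (EFin \o f) q)%E) //.
  exact: integrableZl.
apply: complex_ext => /=.
  rewrite ReM /= -!RintegralZl // -RintegralB //; try exact: cI.
  by apply: eq_Rintegral => q _; exact: ReM.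
rewrite ImM /= -!RintegralZl // -RintegralD //; try exact: cI.
by apply: eq_Rintegral => q _; exact: ImM.
Qed.

(** The affine points of D form a finite, hence negligible, set. *)
Lemma integralP1_eq tau1 tau2 : bounded2 a tau1 -> bounded2 a tau2 ->
  (forall z, O (Some z) -> tau1 (Some z) = tau2 (Some z)) -> integralP1 tau1 = integralP1 tau2.
Proof.
move=> N1 N2 E.
have N : bounded2 a (fun p => tau1 p + -1 * tau2 p) by exact: bounded2D N1 (bounded2Z (-1) N2).
have Z : integralP1 (fun p => tau1 p + -1 * tau2 p) = 0.
  have S : forall q, ~ exceptional q -> tau1 (Some (toC q)) + -1 * tau2 (Some (toC q)) = 0.
    by move=> q /contrapT Oq; rewrite E // mulN1r subrr.
  have Q (f : C -> R) : f 0 = 0 -> (forall q, ~ exceptional q -> {for q, continuous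
      (fun q : R * R => f (tau1 (Some (toC q)) + -1 * tau2 (Some (toC q))))}) ->
      \int[mu2]_q f (tau1 (Some (toC q)) + -1 * tau2 (Some (toC q))) = 0.
    move=> f0 cf.
    have bf q : ~ exceptional q -> `|f (tau1 (Some (toC q)) + -1 * tau2 (Some (toC q)))| <= 0 * wt q.
      by move=> /S ->; rewrite f0 normr0 mul0r.
    have [_] := dominated_integrable2 exceptional_finite (lexx 0) cf bf.
    by rewrite mul0r normr_le0 => /eqP.
  rewrite /integralP1 (Q (@complex.Re R)) //; last by move=> q Hq; exact: (bounded2_cont N Hq).1.
  rewrite (Q (@complex.Im R)) //; first by rewrite -[_ +i* _]/(0 : C) mulr0.
  by move=> q Hq; exact: (bounded2_cont N Hq).2.
move: Z; rewrite (integralP1D N1 (bounded2Z (-1) N2)) (integralP1Z (-1) N2) mulN1r => /eqP.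
by rewrite subr_eq0 => /eqP.
Qed.

End SphereIntegral.

(** * Wirtinger form of the divergence theorem *)

Section ComplexStokes.
Context {R : realType}.
Local Notation C := R[i].
Local Notation II := (@Complex R 0 1).
Local Notation cj := (@conjc R).
Local Notation mR := (measurableTypeR R).
Local Notation mu := (@lebesgue_measure R).
Local Notation mu2 := (mu \x mu)%E.
Implicit Types (f g : C -> C) (z w u v : C) (U V : set C) (s t b : bool).

Definition ccont f z := forall e : R, 0 < e -> exists2 d : R, 0 < d &
  forall w, cnorm (w - z) < d -> cnorm (f w - f z) < e.

Lemma ccontD f g z : ccont f z -> ccont g z -> ccont (fun w => f w + g w) z.
Proof.
move=> cf cg e e0; have h0 : 0 < e / 2 by rewrite divr_gt0.
have [d1 d10 H1] := cf _ h0; have [d2 d20 H2] := cg _ h0.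
exists (Num.min d1 d2); first by rewrite lt_min d10.
move=> w; rewrite lt_min => /andP[/H1 A1 /H2 A2].
have -> : f w + g w - (f z + g z) = (f w - f z) + (g w - g z) by ring.
apply: le_lt_trans (cnormD _ _) _; have := ltrD A1 A2.
by rewrite -splitr.
Qed.

Lemma ccontZ (c : C) f z : ccont f z -> ccont (fun w => c * f w) z.
Proof.
move=> cf e e0; have k0 : 0 < cnorm c + 1 by rewrite ltr_wpDl // cnorm_ge0.
have [d d0 H] := cf _ (divr_gt0 e0 k0); exists d => // w /H.
rewrite -mulrBr cnormM ltr_pdivlMr // mulrC; apply: le_lt_trans.
by apply: ler_wpM2r; [exact: cnorm_ge0 | rewrite lerDl].
Qed.

Lemma ccont_eq f g z : (forall w, f w = g w) -> ccont f z -> ccont g z.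
Proof. by move=> E H e e0; have [d d0 Hd] := H e e0; exists d => // w /Hd; rewrite !E. Qed.

Lemma ccont_part (h : C -> C) (F : C -> R) q :
  (forall z w, `|F z - F w| <= cnorm (z - w)) -> ccont h (toC q) ->
  {for q, continuous (fun q => F (h (toC q)))}.
Proof.
move=> HF ch; apply/cvgrPdist_lt => e e0; have [d d0 H] := ch e e0.
suff : nbhs (ofC (toC q)) [set p | `|F (h (toC q)) - F (h (toC p))| < e] by rewrite toC_K.
apply/nbhs_cP; exists d => // w /H Hw; rewrite /= ofC_K distrC.
exact: le_lt_trans (HF _ _) Hw.
Qed.

Lemma cnorm_2 : cnorm (2 : C) = 2.
Proof.
by rewrite -[(2 : C)]/((2%:R : C)) -(rmorph_nat (real_complex R)) cnorm_real ger0_norm.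
Qed.

(** For A = E false and B = E true, the real and imaginary parts of dB/dz - dA/d(conj z)
    are divergences of plane vector fields with components taken from (B - A) / 2 and (A + B) / 2i. *)
Lemma stokes_plane (E : bool -> C -> C) (K : R) :
  (forall s z, cdiff (E s) z) -> (forall s t z, ccont (W t (E s)) z) ->
  (forall s z, cnorm (E s z) <= K / (1 + cnorm z ^+ 2)) ->
  (forall z, cnorm (W false (E true) z - W true (E false) z) <= K * wt (ofC z)) ->
  \int[mu2]_q complex.Re (W false (E true) (toC q) - W true (E false) (toC q)) = 0 /\
  \int[mu2]_q complex.Im (W false (E true) (toC q) - W true (E false) (toC q)) = 0.
Proof.
move=> dE cE bE bD.
pose G (b : bool) z := (if b then - II / 2 else 2^-1) * (E true z + (if b then 1 else -1) * E false z).
have dG b z : cdiff (G b) z.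
  by apply: cdiffZ; apply: cdiffD; [exact: dE | apply: cdiffZ; exact: dE].
have WG b t z : W t (G b) z = (if b then - II / 2 else 2^-1) *
    (W t (E true) z + (if b then 1 else -1) * W t (E false) z).
  rewrite WZ; last by apply: cdiffD; [exact: dE | apply: cdiffZ; exact: dE].
  by rewrite (WD _ (dE _ _) (cdiffZ _ (dE _ _))) (WZ _ _ (dE _ _)).
have cWG b t z : ccont (W t (G b)) z.
  apply: (@ccont_eq (fun z => (if b then - II / 2 else 2^-1) *
    (W t (E true) z + (if b then 1 else -1) * W t (E false) z))); first by move=> w; rewrite WG.
  by apply: ccontZ; apply: ccontD; [exact: cE | apply: ccontZ; exact: cE].
have ccd b c z : ccont (cd c (G b)) z.
  apply: (@ccont_eq (fun z => (if c then II else 1) * (W false (G b) z + (if c then -1 else 1) * W true (G b) z))).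
    by move=> w; rewrite cdE.
  by apply: ccontZ; apply: ccontD; [exact: cWG | apply: ccontZ; exact: cWG].
have ED z : W false (E true) z - W true (E false) z = cd false (G false) z + cd true (G true) z.
  rewrite !cdE -![del _ _]/(W false _ _) -![delbar _ _]/(W true _ _) !WG.
  have I2 : II * II = -1 :> C by exact: i2.
  by field: I2.
have bG b z : cnorm (G b z) <= K / (1 + cnorm z ^+ 2).
  rewrite /G cnormM.
  have -> : cnorm (if b then - II / 2 else 2^-1 : C) = 2^-1.
    by case: b; rewrite ?cnormM ?cnormN ?cnormi ?mul1r cnormV cnorm_2.
  have L : cnorm (E true z + (if b then 1 else -1) * E false z) <= cnorm (E true z) + cnorm (E false z).
    apply: le_trans (cnormD _ _) _; rewrite lerD2l cnormM.
    by case: b; rewrite ?cnormN cnorm1 mul1r.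
  have := bE true z; have := bE false z.
  move: (cnorm (E true z)) (cnorm (E false z)) (cnorm (_ + _)) (K / _) L => x y t k; lra.
have bound (F : C -> R) : (forall z, `|F z| <= cnorm z) -> forall b q,
    `|F (G b (toC q))| <= K / (1 + `|q| ^+ 2).
  move=> HF b q; apply: le_trans (HF _) _; apply: le_trans (bG b _) _.
  have K0 : 0 <= K.
    by have := le_trans (cnorm_ge0 _) (bE true 0); rewrite cnorm0 expr0n /= addr0 divr1.
  apply: ler_wpM2l => //; rewrite lef_pV2 ?posrE ?ltr_wpDr ?sqr_ge0 // lerD2l.
  apply: lerXn2r; rewrite ?nnegrE ?cnorm_ge0 //.
  by have := normp_ofC (toC q); rewrite toC_K.
have fin (F : C -> R) (part : (C -> C) -> R * R -> R) :
    (forall z w, F (z + w) = F z + F w) -> (forall z, F (- z) = - F z) -> (forall z, `|F z| <= cnorm z) ->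
    (forall f, part f = fun q => F (f (toC q))) ->
    (forall b f q, F (cd b f (toC q)) = 'D_(dir b) (part f) q) ->
    (forall f q, cdiff f (toC q) -> differentiable (part f) q) ->
    \int[mu2]_q F (W false (E true) (toC q) - W true (E false) (toC q)) = 0.
  move=> FD FN Fle pE pD pd.
  have EI q : F (W false (E true) (toC q) - W true (E false) (toC q)) =
      'D_(dir false) (part (G false)) q + 'D_(dir true) (part (G true)) q.
    by rewrite ED FD !pD.
  transitivity (\int[mu2]_q ('D_(dir false) (part (G false)) q + 'D_(dir true) (part (G true)) q)).
    by apply: eq_Rintegral => q _; exact: EI.
  have FB z w : `|F z - F w| <= cnorm (z - w) by rewrite -FN -FD.
  apply: (@stokes_real R _ _ K).
  - by move=> p; apply: pd; exact: dG.
  - move=> p; rewrite (_ : 'D_(dir false) _ = fun q => F (cd false (G false) (toC q))).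
      exact: ccont_part.
    by apply/funext => q; rewrite pD.
  - by move=> p; apply: pd; exact: dG.
  - move=> p; rewrite (_ : 'D_(dir true) _ = fun q => F (cd true (G true) (toC q))).
      exact: ccont_part.
    by apply/funext => q; rewrite pD.
  - by move=> p; rewrite pE; exact: bound.
  - by move=> p; rewrite pE; exact: bound.
  - move=> p; rewrite -EI; apply: le_trans (Fle _) _.
    by have := bD (toC p); rewrite toC_K.
split.
- apply: (fin _ (@rpart R)) => //; first exact: ReD; first exact: ReN; first exact: cnorm_Re.
  by move=> f q [+ _]; rewrite toC_K.
- apply: (fin _ (@ipart R)) => //; first exact: ImD; first exact: ImN; first exact: cnorm_Im.
  by move=> f q [_ +]; rewrite toC_K.
Qed.

(** The quadratic bound forces f to be differentiable at z with derivative 0, the linear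
    bound makes the derivatives continuous there. *)
Lemma removable_C1 f z (r K : R) : 0 < r -> 0 <= K -> f z = 0 ->
  (forall w, 0 < cnorm (w - z) < r -> cnorm (f w) <= K * cnorm (w - z) ^+ 2) ->
  (forall t w, 0 < cnorm (w - z) < r -> cnorm (W t f w) <= K * cnorm (w - z)) ->
  [/\ cdiff f z, forall t, W t f z = 0 & forall t, ccont (W t f) z].
Proof.
move=> r0 K0 fz B1 B2.
have B1' w : cnorm (w - z) < r -> cnorm (f w) <= K * cnorm (w - z) ^+ 2.
  move=> wr; have [->|wz] := eqVneq w z; first by rewrite fz subrr cnorm0 expr0n mulr0.
  by apply: B1; rewrite wr andbT cnorm_gt0 subr_eq0.
have part (F : C -> R) (p : R * R -> R) : (forall v, `|F v| <= cnorm v) -> F 0 = 0 ->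
    (p = fun q => F (f (toC q))) -> forall e : R, 0 < e -> \forall h \near (0 : R * R),
      `|p (h + ofC z) - p (ofC z) - lform 0 0 h| <= e * `|h|.
  move=> HF F0 -> e e0.
  have k0 : 0 < 4 * K + 1 by rewrite ltr_wpDl // mulr_ge0.
  have m0 : 0 < Num.min (r / 2) (e / (4 * K + 1)) by rewrite lt_min !divr_gt0.
  apply/nbhs_pP; exists (Num.min (r / 2) (e / (4 * K + 1))) => // h; rewrite subr0 lt_min => /andP[hr he].
  rewrite ofC_K fz F0 /lform !mul0r addr0 !subr0.
  have E : toC (h + ofC z) - z = toC h.
    by case: z {B1 B2 B1' fz} => x y; case: h {hr he} => s t; apply: complex_ext => /=; ring.
  have T := cnorm_toC h.
  apply: le_trans (HF _) _; apply: le_trans (B1' _ _) _; rewrite E.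
    by apply: le_lt_trans T _; lra.
  have n0 := normr_ge0 h; have c0 := cnorm_ge0 (toC h).
  move: he; rewrite ltr_pdivlMr // => he.
  move: T n0 c0 he; move: (cnorm (toC h)) `|h| => x y xy y0 x0 he.
  have x2 : x ^+ 2 <= 4 * y ^+ 2 by nra.
  apply: (@le_trans _ _ (K * (4 * y ^+ 2))); first exact: ler_wpM2l.
  nra.
have [D1 V1] := differentiable_of_bound (part _ (rpart f) (@cnorm_Re R) erefl erefl).
have [D2 V2] := differentiable_of_bound (part _ (ipart f) (@cnorm_Im R) erefl erefl).
have W0 t : W t f z = 0 by rewrite WE !cd_def !V1 !V2 /lform !mul0r addr0 -[_ +i* _]/(0 : C) mulr0 addr0 mul0r.
split=> // t e e0; exists (Num.min r (e / (K + 1))).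
  by rewrite lt_min r0 divr_gt0 // ltr_wpDl.
move=> w; rewrite lt_min => /andP[wr we]; rewrite W0 subr0.
have [->|wz] := eqVneq w z; first by rewrite W0 cnorm0.
apply: le_lt_trans (B2 t w _) _; first by rewrite wr andbT cnorm_gt0 subr_eq0.
move: we; rewrite ltr_pdivlMr ?ltr_wpDl //; apply: le_lt_trans.
by rewrite mulrC ler_wpM2l ?cnorm_ge0 // lerDl.
Qed.

End ComplexStokes.

(** * Growth at a puncture *)

Section PuncturedGerms.
Context {R : realType} {n : nat}.
Local Notation C := R[i].
Local Notation M := 'M[C]_n.
Implicit Types (h k : C -> M) (f g : C -> C) (z w u v : C) (U V : set C) (s t : bool).

(** Decay at a puncture at 0, faster than every power of u ... *)
Definition rapid h := forall N, exists r K : R, [/\ 0 < r, 0 <= K &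
  forall u, 0 < cnorm u < r -> mnorm (h u) <= K * cnorm u ^+ N].
(** ... and growth of at most polynomial order, as for a pole. *)
Definition tempered h := exists (j : nat) (r K : R), [/\ 0 < r, 0 <= K &
  forall u, 0 < cnorm u < r -> mnorm (h u) * cnorm u ^+ j <= K].

Lemma rapid_eq h k (r : R) : 0 < r -> (forall u, 0 < cnorm u < r -> h u = k u) -> rapid h -> rapid k.
Proof.
move=> r0 E H N; have [r1 [K [r10 K0 H1]]] := H N.
exists (Num.min r r1), K; split => //; first by rewrite lt_min r0.
move=> u /andP[u0]; rewrite lt_min => /andP[ur ur1]; rewrite -E ?u0 //.
by apply: H1; rewrite u0.
Qed.

Lemma rapidD h k : rapid h -> rapid k -> rapid (fun u => h u + k u).
Proof.
move=> H1 H2 N; have [r1 [K1 [r10 K10 B1]]] := H1 N; have [r2 [K2 [r20 K20 B2]]] := H2 N.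
exists (Num.min r1 r2), (K1 + K2); split; rewrite ?lt_min ?r10 ?addr_ge0 //.
move=> u /andP[u0]; rewrite lt_min => /andP[ur1 ur2].
apply: le_trans (mnormD _ _) _; rewrite mulrDl; apply: lerD.
  by apply: B1; rewrite u0.
by apply: B2; rewrite u0.
Qed.

Lemma rapidN h : rapid h -> rapid (fun u => - h u).
Proof.
move=> H N; have [r [K [r0 K0 B]]] := H N; exists r, K; split => // u /B.
by rewrite mnormN.
Qed.

Lemma rapid_mul h k (l : C -> M) : (forall u, mnorm (l u) <= mnorm (h u) * mnorm (k u)) ->
  tempered h -> rapid k -> rapid l.
Proof.
move=> Hl [j [r1 [K1 [r10 K10 B1]]]] H2 N; have [r2 [K2 [r20 K20 B2]]] := H2 (j + N)%N.
exists (Num.min r1 r2), (K1 * K2); split; rewrite ?lt_min ?r10 ?mulr_ge0 //.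
move=> u /andP[u0]; rewrite lt_min => /andP[ur1 ur2].
apply: le_trans (Hl u) _.
have A1 := B1 u; have A2 := B2 u; rewrite !u0 /= ur1 ur2 in A1 A2.
apply: (@le_trans _ _ (mnorm (h u) * (K2 * cnorm u ^+ (j + N)))).
  by apply: ler_wpM2l; [exact: mnorm_ge0 | exact: A2].
have -> : mnorm (h u) * (K2 * cnorm u ^+ (j + N)) =
    (mnorm (h u) * cnorm u ^+ j) * (K2 * cnorm u ^+ N) by rewrite exprD; ring.
rewrite -[leRHS]mulrA; apply: ler_wpM2r; last exact: A1.
by rewrite mulr_ge0 // exprn_ge0 // ltW.
Qed.

Lemma rapidM h k : tempered h -> rapid k -> rapid (fun u => h u *m k u).
Proof. by move=> H1 H2; apply: rapid_mul H1 H2 => u; exact: mnormM. Qed.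

Lemma rapidMr h k : rapid h -> tempered k -> rapid (fun u => h u *m k u).
Proof. by move=> H1 H2; apply: rapid_mul H2 H1 => u; rewrite mulrC; exact: mnormM. Qed.

Lemma mxflat_rapid h : mxflat h -> rapid h.
Proof.
move=> H N; have [r [K [r0 K0 B]]] := mxflat_bound N H; exists r, K; split => // u /andP[_ ur].
by apply: B; rewrite /disc /= subr0.
Qed.

Lemma smooth_bounded f (r : R) : 0 < r -> csmooth_on (disc 0 r) f ->
  exists d K : R, [/\ 0 < d, 0 <= K & forall u, cnorm u < d -> cnorm (f u) <= K].
Proof.
move=> r0 sf; have [d d0 H] := csmooth_locbound (@copen_disc R 0 r) sf (disc_center 0 r0).
exists d, (cnorm (f 0) + 1); split; rewrite ?addr_ge0 ?cnorm_ge0 // => u ud.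
by apply: H; rewrite /disc /= subr0.
Qed.

Lemma mxsmooth_locbound U h u : copen U -> mxsmooth_on U h -> U u ->
  exists2 e : R, 0 < e & exists K : R, forall v, disc u e v -> mnorm (h v) <= K.
Proof.
move=> oU sh Uu.
have H i j : exists e : R, 0 < e /\ forall v, disc u e v -> cnorm (h v i j) <= cnorm (h u i j) + 1.
  by have [d d0 Hd] := csmooth_locbound oU (sh i j) Uu; exists d.
have H2 i : exists d : R, 0 < d /\ forall j v, disc u d v -> cnorm (h v i j) <= cnorm (h u i j) + 1.
  have [e He] := choice (H i); have [d d0 Hd] := finite_radius (fun j => (He j).1).
  by exists d; split=> // j v Hv; apply: (He j).2; exact: lt_le_trans Hv (Hd j).
have [e He] := choice H2; have [d d0 Hd] := finite_radius (fun i => (He i).1).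
exists d => //; exists (\sum_i \sum_j (cnorm (h u i j) + 1)) => v Hv.
apply: ler_sum => i _; apply: ler_sum => j _; apply: (He i).2; exact: lt_le_trans Hv (Hd i).
Qed.

Lemma mxsmooth_bounded h (r : R) : 0 < r -> mxsmooth_on (disc 0 r) h ->
  exists d K : R, [/\ 0 < d, 0 <= K & forall u, cnorm u < d -> mnorm (h u) <= K].
Proof.
move=> r0 sh; have [d d0 [K HK]] := mxsmooth_locbound (@copen_disc R 0 r) sh (disc_center 0 r0).
exists d, K; split => //; last by move=> u ud; apply: HK; rewrite /disc /= subr0.
exact: le_trans (mnorm_ge0 _) (HK 0 (disc_center 0 d0)).
Qed.

Lemma tempered_smooth h (r : R) : 0 < r -> mxsmooth_on (disc 0 r) h -> tempered h.
Proof.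
move=> r0 /(mxsmooth_bounded r0) [d [K [d0 K0 H]]]; exists 0%N, d, K; split=> // u /andP[_ ud].
by rewrite expr0 mulr1 H.
Qed.

Lemma tempered_div (k : nat) h h' (r : R) : 0 < r -> (forall u, 0 < cnorm u < r -> u ^+ k *: h u = h' u) ->
  tempered h' -> tempered h.
Proof.
move=> r0 E [j [r1 [K [r10 K0 B]]]]; exists (k + j)%N, (Num.min r r1), K; split => //.
  by rewrite lt_min r0.
move=> u /andP[u0]; rewrite lt_min => /andP[ur ur1].
have := B u; rewrite -E ?u0 //= ur1 => /(_ isT).
by rewrite mnormZ cnormX exprD mulrA mulrAC mulrC mulrA.
Qed.

Lemma rapid_div (k : nat) h h' (r : R) : 0 < r -> (forall u, 0 < cnorm u < r -> u ^+ k *: h u = h' u) ->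
  rapid h' -> rapid h.
Proof.
move=> r0 E H N; have [r1 [K [r10 K0 B]]] := H (k + N)%N; exists (Num.min r r1), K; split => //.
  by rewrite lt_min r0.
move=> u /andP[u0]; rewrite lt_min => /andP[ur ur1].
have := B u; rewrite -E ?u0 //= ur1 => /(_ isT).
rewrite mnormZ cnormX exprD mulrCA mulrC [leRHS]mulrC ler_pM2r //.
by rewrite exprn_gt0.
Qed.

Lemma rapid_bounded (f : C -> C) h : (forall u, cnorm (f u) <= mnorm (h u)) -> rapid h ->
  exists r K : R, 0 < r /\ forall u, 0 < cnorm u < r -> cnorm (f u) <= K.
Proof.
move=> H /(_ 0%N) [r [K [r0 _ B]]]; exists r, K; split => // u /B.
by rewrite expr0 mulr1; apply: le_trans.
Qed.

(** Leibniz' rule for u^k h; it avoids differentiating negative powers. *)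
Lemma MW_div_eq (k : nat) h h' s (r : R) u :
  (forall v, 0 < cnorm v < r -> v ^+ k *: h v = h' v) ->
  0 < cnorm u < r -> mxcdiff h u ->
  u ^+ k *: MW s h u = MW s h' u - W s (fun v => v ^+ k) u *: h u.
Proof.
move=> E ur dh; apply/eqP; rewrite -subr_eq opprK addrC; apply/eqP.
pose V : set C := disc 0 r `&` [set v | v != 0].
have oV : copen V by apply: openI; [exact: copen_disc | exact: copen_nz].
have EV v : V v -> v ^+ k *: h v = h' v.
  by move=> [vr v0]; apply: E; rewrite cnorm_gt0 v0 /=; move: vr; rewrite /disc /= subr0.
have Vu : V u.
  by move: ur => /andP[u0 ur]; split; rewrite /disc /= ?subr0 // -cnorm_gt0.
rewrite -(MW_eq s oV Vu EV) MWZ //.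
by apply: (csmooth_cdiff oV _ Vu); apply: (csmoothX _ oV); exact: csmooth_id.
Qed.

Lemma scaled_smooth_rapid g h : germ_smooth g -> rapid h -> rapid (fun u => g u *: h u).
Proof.
move=> [r r0 sg] H N; have [d [K [d0 K0 B]]] := smooth_bounded r0 sg.
have [r1 [K1 [r10 K10 B1]]] := H N.
exists (Num.min d r1), (K * K1); split; rewrite ?lt_min ?d0 ?mulr_ge0 //.
move=> u /andP[u0]; rewrite lt_min => /andP[ud ur]; rewrite mnormZ -mulrA.
apply: ler_pM; rewrite ?cnorm_ge0 ?mnorm_ge0 //; first exact: B.
by apply: B1; rewrite u0.
Qed.

Lemma germ_smoothX (k : nat) : germ_smooth (fun u : C => u ^+ k).
Proof. by exists 1 => //; apply: csmoothX; [exact: copen_disc | exact: csmooth_id]. Qed.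

(** Rapid decay of h' would not suffice: that of its derivative is needed as well. *)
Lemma rapid_MW_div (k : nat) h h' s (r : R) : 0 < r ->
  (forall v, 0 < cnorm v < r -> v ^+ k *: h v = h' v) -> (forall u, 0 < cnorm u < r -> mxcdiff h u) ->
  mxflat h' -> rapid (MW s h).
Proof.
move=> r0 E dh fh.
have fh' : rapid h := rapid_div r0 E (mxflat_rapid fh).
have fW : rapid (fun u => W s (fun v => v ^+ k) u *: h u).
  by apply: scaled_smooth_rapid => //; apply: germ_smoothW; exact: germ_smoothX.
apply: (rapid_div r0 (h' := fun u => MW s h' u + - (W s (fun v => v ^+ k) u *: h u)) (k := k)).
  by move=> u ur; rewrite (MW_div_eq s E ur (dh u ur)).
by apply: rapidD; [apply: mxflat_rapid; exact: mxflatMW | exact: rapidN].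
Qed.

Lemma W_delbar_X (k : nat) (u : C) : W true (fun v : C => v ^+ k) u = 0.
Proof.
elim: k => [|k IH]; first exact: W_cst.
have sX j : cdiff (fun v : C => v ^+ j) u.
  apply: (csmooth_cdiff (@copen_disc R u 1) _ (disc_center u ltr01)).
  by apply: csmoothX; [exact: copen_disc | exact: csmooth_id].
have -> : (fun v : C => v ^+ k.+1) = (fun v => v * v ^+ k) by apply/funext => v; rewrite exprS.
by rewrite (WM true (cdiff_id u) (sX k)) W_id IH mul0r mulr0 addr0.
Qed.

(** Since u^k is holomorphic, d-bar does not see the pole. *)
Lemma rapid_delbar_div (k : nat) h h' (r : R) : 0 < r ->
  (forall v, 0 < cnorm v < r -> v ^+ k *: h v = h' v) -> (forall u, 0 < cnorm u < r -> mxcdiff h u) ->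
  mxflat (MW true h') -> rapid (MW true h).
Proof.
move=> r0 E dh fh.
apply: (rapid_div r0 (h' := MW true h') (k := k)); last exact: mxflat_rapid.
by move=> u ur; rewrite (MW_div_eq true E ur (dh u ur)) W_delbar_X scale0r subr0.
Qed.

End PuncturedGerms.

(** * Forms near the points of D *)

Section FormsAtD.
Context {R : realType} {n m : nat}.
Variable a : conn_data R n m.
Local Notation C := R[i].
Local Notation M := 'M[C]_n.
Local Notation cj := (@conjc R).
Implicit Types (z w u v : C) (b s t : bool) (p : P1 R) (i : 'I_m) (h : C -> M).
Implicit Types (phi psi chi alpha : form1 R n) (F G : form2 R n) (x : mxfun R n).

Local Notation O := (off_D a).
Local Notation c i := (locpar a i).
Local Notation rad i := (disc_rad a i).
Local Notation ord i := (pole_ord a i).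

Definition pull2m cc F u : M := (dparam cc u * cj (dparam cc u)) *: F (cc u).

(** Decay is asked in the coordinates z_i, where it can be read off Laurent expansions. *)
Definition rapid2 F := (forall b, mxsmooth_on (stdpar b @^-1` O) (pull2m (stdpar b) F)) /\
  forall i, rapid (pull2m (c i) F).

Lemma locpar_punct i u : 0 < cnorm u < rad i -> disc 0 (rad i) u /\ O (c i u).
Proof.
move=> /andP[u0 ur]; have Hu : disc 0 (rad i) u by rewrite /disc /= subr0.
by split => //; apply: locpar_off => //; rewrite -cnorm_gt0.
Qed.

Lemma rapid2D F G : rapid2 F -> rapid2 G -> rapid2 (fun p => F p + G p).
Proof.
move=> [F1 F2] [G1 G2].
have E cc : pull2m cc (fun p => F p + G p) = fun u => pull2m cc F u + pull2m cc G u.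
  by apply/funext => u; rewrite /pull2m scalerDr.
split=> [b|i]; rewrite E; last exact: rapidD.
by apply: mxsmoothD; [exact: popen_off | exact: F1 | exact: G1].
Qed.

Lemma rapid2N F : rapid2 F -> rapid2 (fun p => - F p).
Proof.
move=> [F1 F2].
have E cc : pull2m cc (fun p => - F p) = fun u => - pull2m cc F u.
  by apply/funext => u; rewrite /pull2m scalerN.
split=> [b|i]; rewrite E; last exact: rapidN.
by apply: mxsmoothN; [exact: popen_off | exact: F1].
Qed.

Lemma mxsmooth_P1_local i x : smooth_P1 x -> mxsmooth_on (disc 0 (rad i)) (fun u => x (c i u)).
Proof. exact: smooth_P1_comp (@copen_disc _ _ _) (@locpar_holo _ _ _ a i). Qed.

Lemma rapid2Mr F x : smooth_P1 x -> rapid2 F -> rapid2 (fun p => F p *m x p).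
Proof.
move=> sx [F1 F2].
have E cc : pull2m cc (fun p => F p *m x p) = fun u => pull2m cc F u *m x (cc u).
  by apply/funext => u; rewrite /pull2m scalemxAl.
split=> [b|i]; rewrite E.
  apply: mxsmoothM; [exact: popen_off | exact: F1 |].
  by apply: mxsmooth_sub (sx b).
apply: rapidMr => //; apply: tempered_smooth (disc_rad_gt0 a i) _; exact: mxsmooth_P1_local.
Qed.

Lemma bounded2_entry F j l : rapid2 F -> bounded2 a (fun p => F p j l).
Proof.
move=> [F1 F2].
have E cc : pull2 cc (fun p => F p j l) = fun u => pull2m cc F u j l.
  by apply/funext => u; rewrite /pull2m mxE.
split=> [b|i]; rewrite E; first exact: F1.
by apply: rapid_bounded (F2 i) => u; exact: mnorm_entry.
Qed.

Lemma bounded2_tr F : rapid2 F -> bounded2 a (fun p => \tr (F p)).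
Proof.
move=> [F1 F2].
have E cc : pull2 cc (fun p => \tr (F p)) = fun u => \tr (pull2m cc F u).
  by apply/funext => u; rewrite /pull2m mxtraceZ.
split=> [b|i]; rewrite E; first by apply: csmooth_tr; [exact: popen_off | exact: F1].
by apply: rapid_bounded (F2 i) => u; exact: mnorm_tr.
Qed.

Lemma rapid2_norm F : rapid2 F -> exists2 K : R, 0 <= K &
  forall p, O p -> dens p ^+ 2 * mnorm (F p) <= K.
Proof.
move=> gF.
have H j : exists k : 'I_n -> R, forall l, 0 <= k l /\ forall p, O p -> tnorm (fun p => F p j l) p <= k l.
  have H0 l : exists k : R, 0 <= k /\ forall p, O p -> tnorm (fun p => F p j l) p <= k.
    by have [k k0 Hk] := bounded2_tnorm (bounded2_entry j l gF); exists k.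
  by have [e He] := choice H0; exists e.
have [k Hk] := choice H.
exists (\sum_j \sum_l k j l).
  by apply: sumr_ge0 => j _; apply: sumr_ge0 => l _; exact: (Hk j l).1.
move=> p Op; rewrite /mnorm mulr_sumr; apply: ler_sum => j _; rewrite mulr_sumr.
by apply: ler_sum => l _; exact: (Hk j l).2.
Qed.

Lemma pull2m_wedge cc phi chi u : pull2m cc (wedge phi chi) u =
  pulls false cc phi u *m pulls true cc chi u - pulls true cc phi u *m pulls false cc chi u.
Proof.
rewrite !pullsE /= /pull2m /wedge -!scalemxAl -!scalemxAr !scalerA scalerBr.
by rewrite [cj _ * _]mulrC.
Qed.

(** The polar part is holomorphic to infinite order and has type (1,0), so that it cancels
    in d phi and in wedge products. *)
Definition polar phi := [/\ fsmooth O phi, forall i s, tempered (pulls s (c i) phi) &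
  forall i, [/\ rapid (pulls true (c i) phi), rapid (MW false (pulls true (c i) phi)) &
                rapid (MW true (pulls false (c i) phi))]].

(** In each product a tempered factor meets a rapidly decaying (0,1)-coefficient. *)
Lemma rapid2_wedge phi chi : polar phi -> polar chi -> rapid2 (wedge phi chi).
Proof.
move=> [s1 p1 f1] [s2 p2 f2]; split=> [b|i].
  have oO := @popen_off _ _ _ a b.
  apply: (mxsmooth_eq oO (h := fun u => pulls false (stdpar b) phi u *m pulls true (stdpar b) chi u -
    pulls true (stdpar b) phi u *m pulls false (stdpar b) chi u)).
    by move=> z _; rewrite pull2m_wedge.
  apply: (mxsmoothD oO); first by apply: (mxsmoothM oO); [exact: s1 | exact: s2].
  by apply: (mxsmoothN oO); apply: (mxsmoothM oO); [exact: s1 | exact: s2].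
have [g1 _ _] := f1 i; have [g2 _ _] := f2 i.
apply: (rapid_eq ltr01 (h := fun u => pulls false (c i) phi u *m pulls true (c i) chi u -
    pulls true (c i) phi u *m pulls false (c i) chi u)).
  by move=> u _; rewrite pull2m_wedge.
by apply: rapidD; [exact: rapidM | apply: rapidN; exact: rapidMr].
Qed.

Lemma rapid2_dform phi : fsmooth O phi ->
  (forall i, rapid (fun u => MW false (pulls true (c i) phi) u - MW true (pulls false (c i) phi) u)) ->
  rapid2 (dform phi).
Proof.
move=> sphi fphi; have oP := @popen_off _ _ _ a; split=> [b|i].
  have oO := oP b.
  apply: (mxsmooth_eq oO (h := D2 (fun s => pulls s (stdpar b) phi))).
    by move=> z Oz; rewrite (dform_stdpar oP sphi Oz) /pull2m dparam_stdpar.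
  apply: (mxsmoothD oO); first by apply: (mxsmoothMW _ oO); exact: sphi.
  by apply: (mxsmoothN oO); apply: (mxsmoothMW _ oO); exact: sphi.
apply: rapid_eq (disc_rad_gt0 a i) _ (fphi i) => u /locpar_punct[Hu Ou].
exact: (dform_pull (@copen_disc _ _ _) (@locpar_holo _ _ _ a i) oP sphi Hu Ou).
Qed.

Lemma polar_dform phi : polar phi -> rapid2 (dform phi).
Proof.
move=> [s1 _ f1]; apply: rapid2_dform => // i; have [_ g1 g2] := f1 i.
by apply: rapidD => //; exact: rapidN.
Qed.

Lemma rapid2_curvature alpha : polar alpha -> rapid2 (curvature alpha).
Proof.
move=> pa; apply: rapid2D; first by apply: rapid2N; exact: polar_dform.
exact: rapid2_wedge.
Qed.

Lemma laurentP k h l : laurent_expansion k h l -> exists r : R, 0 < r /\ exists s : C -> M,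
  [/\ mxsmooth_on (disc 0 r) s, forall z, disc 0 r z -> h z = z ^- k *: s z &
      forall (p q : nat), taylor s p q = l (p%:Z - k%:Z) q].
Proof.
move=> [r [r0 [s [ss E L]]]]; exists r; split => //; exists s; split => // p q.
by rewrite L subrK.
Qed.

Lemma div_mul (k : nat) h (s : C -> M) (r : R) : (forall z, disc 0 r z -> h z = z ^- k *: s z) ->
  forall u, 0 < cnorm u < r -> u ^+ k *: h u = s u.
Proof.
move=> E u /andP[u0 ur]; rewrite E ?/disc /= ?subr0 // scalerA mulfV ?scale1r //.
by rewrite expf_neq0 // -cnorm_gt0.
Qed.

Lemma singular_fsmooth phi : singular_form a phi -> fsmooth O phi.
Proof.
move=> [H _] b s; have [H1 H2] := H b.
by case: s; [exact: H2 | exact: H1].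
Qed.

Lemma fsmooth_local phi i : fsmooth O phi ->
  forall s u, 0 < cnorm u < rad i -> mxcdiff (pulls s (c i) phi) u.
Proof.
move=> sphi s u /locpar_punct[Hu Ou].
have oP := @popen_off _ _ _ a.
have oU := copen_pre (@copen_disc _ _ _) (@locpar_holo _ _ _ a i) oP.
apply: mxsmooth_cdiff oU (mxsmooth_pulls s (@copen_disc _ _ _) (@locpar_holo _ _ _ a i) oP sphi) _.
by split.
Qed.

Lemma singular_tempered phi i s : singular_form a phi -> tempered (pulls s (c i) phi).
Proof.
move=> [_ H]; have [r [r0 [s10 [s01 [S1 S2 E]]]]] := H i.
apply: (tempered_div r0 (k := ord i) (h' := if s then s01 else s10)).
  apply: div_mul => z Hz; have [E1 E2] := E z Hz.
  by case: s.
by case: s; [exact: tempered_smooth r0 S2 | exact: tempered_smooth r0 S1].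
Qed.

Lemma taylor_delbar_flat h (r : R) : 0 < r -> mxsmooth_on (disc 0 r) h ->
  (forall (j q : nat), taylor h j q.+1 = 0) -> mxflat (MW true h).
Proof.
move=> r0 sh H; apply: taylor_mxflat.
  apply/mxgermP; exists r; first exact: r0.
  by apply: mxsmoothMW sh; exact: copen_disc.
move=> j q; have := H j q; rewrite /taylor iterSr => /eqP.
rewrite scaler_eq0 invr_eq0 => /orP[|/eqP].
  by rewrite pnatr_eq0 eqn0Ngt muln_gt0 !fact_gt0.
by move=> E; rewrite [iter j _ _ _]E scaler0.
Qed.

(** An expansion without conj z means that d-bar of z^k times the (1,0)-coefficient has zero
    Taylor series. *)
Lemma L_form_polar phi : singular_form a phi ->
  (forall i, exists2 l : formal_laurent, L_form a i phi l (@zero_series R n) & forall j q, l j q.+1 = 0) ->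
  polar phi.
Proof.
move=> sphi H; split; first exact: singular_fsmooth.
  by move=> i s; exact: singular_tempered.
move=> i; have [l [/laurentP[r1 [r10 [s10 [S1 E1 T1]]]] /laurentP[r2 [r20 [s01 [S2 E2 T2]]]]] Hl] := H i.
have r0 : 0 < Num.min (rad i) (Num.min r1 r2) by rewrite !lt_min disc_rad_gt0 r10.
have dP s u : 0 < cnorm u < Num.min (rad i) (Num.min r1 r2) -> mxcdiff (pulls s (c i) phi) u.
  move=> /andP[u0]; rewrite lt_min => /andP[ur _].
  by apply: fsmooth_local; [exact: singular_fsmooth | rewrite u0].
have EE1 u : 0 < cnorm u < Num.min (rad i) (Num.min r1 r2) -> u ^+ ord i *: pulls false (c i) phi u = s10 u.
  move=> /andP[u0]; rewrite !lt_min => /and3P[_ ur1 _]; apply: (div_mul E1).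
  by rewrite u0.
have EE2 u : 0 < cnorm u < Num.min (rad i) (Num.min r1 r2) -> u ^+ ord i *: pulls true (c i) phi u = s01 u.
  move=> /andP[u0]; rewrite !lt_min => /and3P[_ _ ur2]; apply: (div_mul E2).
  by rewrite u0.
have f01 : mxflat s01 by apply: taylor_mxflat; [apply/mxgermP; exists r2 | move=> p q; rewrite T2].
have f10 : mxflat (MW true s10) by apply: (taylor_delbar_flat r10 S1) => p q; rewrite T1 Hl.
split.
- exact: (rapid_div r0 EE2 (mxflat_rapid f01)).
- exact: (rapid_MW_div _ r0 EE2 (dP true) f01).
- exact: (rapid_delbar_div r0 EE1 (dP false) f10).
Qed.

Lemma extA_polar alpha : extA a alpha -> polar alpha.
Proof.
move=> [sa H]; apply: L_form_polar => // i; have [v [_ L]] := H i.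
eexists; first exact: L.
by move=> j q; rewrite /germ_series /dlog_series /= andbF addr0.
Qed.

Lemma tangent_polar phi : extA_tangent a phi -> polar phi.
Proof.
move=> [sa H]; apply: L_form_polar => // i; have [v L] := H i.
eexists; first exact: L.
by move=> j q; rewrite /dlog_series andbF.
Qed.

Lemma lieG1_flat x i : lieG1 a x -> mxflat (fun u => x (c i u)).
Proof.
move=> [_ /(_ i) /laurentP[r [r0 [s [S E T]]]]].
apply: (mxflat_eq r0 (h := s)).
  by move=> z Hz; have := E z Hz; rewrite expr0 invr1 scale1r => <-.
by apply: taylor_mxflat; [apply/mxgermP; exists r | move=> p q; rewrite T].
Qed.

Lemma pulls_rmulf s cc phi x u : pulls s cc (rmulf phi x) u = pulls s cc phi u *m x (cc u).
Proof. by rewrite !pullsE -scalemxAl; case: s. Qed.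

Lemma pulls_lmulf s cc phi x u : pulls s cc (lmulf x phi) u = x (cc u) *m pulls s cc phi u.
Proof. by rewrite !pullsE -scalemxAr; case: s. Qed.

Lemma pulls_addf s cc phi psi u : pulls s cc (Defs.addf phi psi) u = pulls s cc phi u + pulls s cc psi u.
Proof. by rewrite !pullsE -scalerDr; case: s. Qed.

Lemma pulls_scalef s cc (t : C) phi u : pulls s cc (scalef t phi) u = t *: pulls s cc phi u.
Proof. by rewrite !pullsE scalerA mulrC -scalerA; case: s. Qed.

Lemma fsmooth_rmulf phi x : smooth_P1 x -> fsmooth O phi -> fsmooth O (rmulf phi x).
Proof.
move=> sx sphi b s; have oO := @popen_off _ _ _ a b.
apply: (mxsmooth_eq oO (h := fun u => pulls s (stdpar b) phi u *m x (stdpar b u))).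
  by move=> z _; rewrite pulls_rmulf.
apply: mxsmoothM oO (sphi b s) _; exact: mxsmooth_sub (sx b).
Qed.

(** The zero of infinite order of x absorbs the pole of phi, also after differentiation. *)
Lemma rmulf_flat phi x i s : singular_form a phi -> lieG1 a x ->
  rapid (pulls s (c i) (rmulf phi x)) /\ forall t, rapid (MW t (pulls s (c i) (rmulf phi x))).
Proof.
move=> sphi lx; have fx := lieG1_flat i lx.
have [_ /(_ i) [r [r0 [s10 [s01 [S1 S2 E]]]]]] := sphi.
have m0 : 0 < Num.min (rad i) r by rewrite lt_min disc_rad_gt0.
have EE u : 0 < cnorm u < Num.min (rad i) r ->
    u ^+ ord i *: pulls s (c i) (rmulf phi x) u = (if s then s01 else s10) u *m x (c i u).
  move=> /andP[u0]; rewrite lt_min => /andP[_ ur].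
  rewrite pulls_rmulf scalemxAl; congr (_ *m _).
  apply: (@div_mul _ _ _ r); last by rewrite u0.
  move=> z Hz; have [E1 E2] := E z Hz.
  by case: s.
have fY : mxflat (fun u => (if s then s01 else s10) u *m x (c i u)).
  apply: mxflatMl fx; apply/mxgermP; exists r; first exact: r0.
  by case: s EE; [exact: (fun=> S2) | exact: (fun=> S1)].
split; first exact: rapid_div m0 EE (mxflat_rapid fY).
move=> t; apply: (rapid_MW_div _ m0 EE _ fY) => u /andP[u0]; rewrite lt_min => /andP[ur _].
apply: fsmooth_local; last by rewrite u0.
by apply: fsmooth_rmulf lx.1 _; exact: singular_fsmooth.
Qed.

End FormsAtD.

(** * From the coordinates at D to the affine coordinate *)

Section SphereStokes.
Context {R : realType} {n m : nat}.
Variable a : conn_data R n m.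
Local Notation C := R[i].
Local Notation M := 'M[C]_n.
Local Notation cj := (@conjc R).
Local Notation mR := (measurableTypeR R).
Local Notation mu := (@lebesgue_measure R).
Local Notation mu2 := (mu \x mu)%E.
Implicit Types (z w u v : C) (b s t : bool) (p : P1 R) (i : 'I_m) (h : C -> M).
Implicit Types (phi psi : form1 R n).

Local Notation O := (off_D a).
Local Notation c i := (locpar a i).
Local Notation rad i := (disc_rad a i).
Local Notation pt i := (Defs.point a i).

Lemma pulls_comp_wd s b z psi : pulls s (stdpar b) psi z = cjs s (dstd b z) *: comp s psi (stdpar b z).
Proof. by rewrite pullsE dparam_stdpar. Qed.

Lemma uniform_near (I : finType) (A : I -> C -> R) N :
  (forall j, exists r K : R, [/\ 0 < r, 0 <= K & forall u, 0 < cnorm u < r -> A j u <= K * cnorm u ^+ N]) ->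
  exists r K : R, [/\ 0 < r, 0 <= K & forall j u, 0 < cnorm u < r -> A j u <= K * cnorm u ^+ N].
Proof.
move=> /choice[r Hr].
have /choice[K HK] j : exists K : R, [/\ 0 < r j, 0 <= K & forall u, 0 < cnorm u < r j -> A j u <= K * cnorm u ^+ N].
  exact: Hr.
have [d d0 Hd] := finite_radius (fun j => let: And3 H _ _ := HK j in H).
have K0 j : 0 <= K j by have [] := HK j.
exists d, (\sum_j K j); split=> //; first exact: sumr_ge0.
move=> j u /andP[u0 ud]; have [_ _ H] := HK j.
have := H u; rewrite u0 (lt_le_trans ud (Hd j)) => /(_ isT) /le_trans; apply.
rewrite ler_wpM2r ?exprn_ge0 ?cnorm_ge0 // (bigD1 j) //= lerDl.
exact: sumr_ge0.
Qed.

(** With z = g(u) the affine coordinate, |u| is comparable to |z - g(0)|, g' is bounded below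
    and g'' above, which transports O(|u|^2) bounds for the coefficients and their
    derivatives. *)
Lemma flat_affine psi i : fsmooth O psi -> pt i <> miss false ->
  (forall s, rapid (pulls s (c i) psi) /\ forall t, rapid (MW t (pulls s (c i) psi))) ->
  exists r K : R, [/\ 0 < r, 0 <= K & forall w, 0 < cnorm (w - chart false (pt i)) < r ->
    O (stdpar false w) /\
    forall s, mnorm (pulls s (stdpar false) psi w) <= K * cnorm (w - chart false (pt i)) ^+ 2 /\
      forall t, mnorm (MW t (pulls s (stdpar false) psi) w) <= K * cnorm (w - chart false (pt i))].
Proof.
move=> sphi cm fpsi.
set z0 := chart false (pt i).
have oD := @copen_disc R 0 (rad i).
have hc := @locpar_holo _ _ _ a i.
have D0 := locpar0 a i.
have [d [d0 sd cmd hg]] := holo_chart oD hc D0 cm.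
set g := fun v => chart false (c i v) in hg.
have [sg dg] := hg.
have oV := @copen_disc R 0 d.
have V0 := @disc_center R 0 d d0.
have g0 : g 0 = z0 by [].
have dg0 : del g 0 != 0.
  have := locpar_deriv D0; rewrite (dparam_chart oV V0 cmd hg).
  by apply: contraNneq => E; rewrite -/g E mul0r.
have [rl [k [rl0 rld k0 low]]] := holo_lower d0 hg dg0.
have sdg : csmooth_on (disc 0 d) (W false g) := csmoothW false oV sg.
have [e1 e10 lowd] : exists2 e : R, 0 < e & forall v, cnorm v < e -> cnorm (del g 0) / 2 <= cnorm (del g v).
  have h0 : 0 < cnorm (del g 0) / 2 by rewrite divr_gt0 // cnorm_gt0.
  have [e e0 He] := csmooth_cont oV sdg V0 h0.
  exists e => // v ve; have ve' : cnorm (v - 0) < e by rewrite subr0.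
  have := He v ve'; have := cnormB (W false g v) (W false g v - W false g 0).
  have -> : W false g v - (W false g v - W false g 0) = W false g 0 by ring.
  rewrite -![del g _]/(W false g _).
  have aux (x y t : R) : x <= y + t -> t < x / 2 -> x / 2 <= y by lra.
  exact: aux.
pose kap := cnorm (del g 0) / 2.
have kap0 : 0 < kap by rewrite divr_gt0 // cnorm_gt0.
have bdd s t : exists d K : R, [/\ 0 < d, 0 <= K & forall u, cnorm u < d ->
    cnorm (W t (fun v => cjs s (del g v)) u) <= K].
  apply: (smooth_bounded d0); apply: (csmoothW t oV); apply: csmooth_cjs => //.
have [eb [Kb [eb0 Kb0 HB]]] : exists eb Kb : R, [/\ 0 < eb, 0 <= Kb & forall (st : bool * bool) u, 0 < cnorm u < eb ->
    cnorm (W st.2 (fun v => cjs st.1 (del g v)) u) <= Kb * cnorm u ^+ 0].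
  apply: uniform_near => -[s t]; have [x [y [x0 y0 B]]] := bdd s t; exists x, y; split=> // u /andP[_ ux].
  by rewrite expr0 mulr1; exact: B.
have [ef [Kf [ef0 Kf0 HF]]] : exists ef Kf : R, [/\ 0 < ef, 0 <= Kf & forall s u, 0 < cnorm u < ef ->
    mnorm (pulls s (c i) psi u) <= Kf * cnorm u ^+ 2].
  by apply: uniform_near => s; exact: (fpsi s).1.
have [eh [Kh [eh0 Kh0 HH]]] : exists ef Kf : R, [/\ 0 < ef, 0 <= Kf & forall (st : bool * bool) u, 0 < cnorm u < ef ->
    mnorm (MW st.2 (pulls st.1 (c i) psi) u) <= Kf * cnorm u ^+ 2].
  by apply: uniform_near => -[s t]; exact: (fpsi s).2.
pose rho := Num.min (Num.min rl e1) (Num.min eb (Num.min ef eh)).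
have rho0 : 0 < rho by rewrite !lt_min rl0 e10 eb0 ef0.
have [r r0 Hr] := param_open oD hc D0 (locpar_deriv D0) cm rho0.
have key v : 0 < cnorm v < rho -> forall s,
    mnorm (pulls s (stdpar false) psi (g v)) <= Kf / kap * cnorm v ^+ 2 /\
    forall t, mnorm (MW t (pulls s (stdpar false) psi) (g v)) <=
      (Kh + Kb * (Kf / kap)) / kap ^+ 2 * cnorm v ^+ 2.
  move=> /andP[v0]; rewrite !lt_min => /andP[/andP[vrl ve1] /and3P[veb vef veh]] s.
  have Hv : disc 0 d v by rewrite /disc /= subr0; exact: lt_le_trans vrl rld.
  have F1 : mnorm (pulls s (c i) psi v) <= Kf * cnorm v ^+ 2 by apply: HF; rewrite v0.
  have F2 t : mnorm (MW t (pulls s (c i) psi) v) <= Kh * cnorm v ^+ 2.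
    by apply: (HH (s, t)); rewrite v0.
  have F3 t : cnorm (W t (fun v => cjs s (del g v)) v) <= Kb.
    by have := HB (s, t) v; rewrite v0 expr0 mulr1; apply.
  have E w : disc 0 d w -> pulls s (c i) psi w = cjs s (del g w) *: pulls s (stdpar false) psi (g w).
    by move=> Hw; exact: pulls_chart oV Hw cmd hg.
  have Ld := lowd v ve1; rewrite -/kap in Ld.
  have P1 : mnorm (pulls s (stdpar false) psi (g v)) <= Kf / kap * cnorm v ^+ 2.
    rewrite mulrAC ler_pdivlMr // mulrC; apply: le_trans F1.
    rewrite E // mnormZ cnorm_cjs ler_wpM2r ?mnorm_ge0 //.
  split => // t.
  have Og : O (stdpar false (g v)).
    rewrite stdpar_chart; last exact: cmd.
    by apply: locpar_off; [exact: sd | rewrite -cnorm_gt0].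
  have dP := mxsmooth_cdiff (@popen_off _ _ _ a false) (sphi false s) Og.
  have dgv : cdiff g v := csmooth_cdiff oV sg Hv.
  have ddg : cdiff (fun w => cjs s (del g w)) v.
    by apply: (csmooth_cdiff oV _ Hv); apply: csmooth_cjs.
  have EW : MW t (pulls s (c i) psi) v =
      W t (fun w => cjs s (del g w)) v *: pulls s (stdpar false) psi (g v) +
      cjs s (del g v) *: (cjs t (del g v) *: MW t (pulls s (stdpar false) psi) (g v)).
    rewrite (MW_eq t oV Hv E) (MWZ _ ddg (mxcdiff_comp dgv dP)) (MW_comp _ dgv dP (dg v Hv)).
    by case: t.
  have B : cnorm (del g v) ^+ 2 * mnorm (MW t (pulls s (stdpar false) psi) (g v)) <=
      Kh * cnorm v ^+ 2 + Kb * (Kf / kap * cnorm v ^+ 2).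
    rewrite expr2 -mulrA -[X in _ * (X * _)](cnorm_cjs t) -mnormZ -[X in X * _](cnorm_cjs s) -mnormZ.
    have -> : cjs s (del g v) *: (cjs t (del g v) *: MW t (pulls s (stdpar false) psi) (g v)) =
      MW t (pulls s (c i) psi) v - W t (fun w => cjs s (del g w)) v *: pulls s (stdpar false) psi (g v).
      by rewrite EW addrC addKr.
    apply: le_trans (mnormB _ _) _; apply: lerD; first exact: F2.
    rewrite mnormZ; apply: ler_pM; rewrite ?cnorm_ge0 ?mnorm_ge0 //; exact: F3.
  rewrite mulrAC ler_pdivlMr ?exprn_gt0 // mulrC.
  rewrite (_ : (Kh + Kb * (Kf / kap)) * cnorm v ^+ 2 = Kh * cnorm v ^+ 2 + Kb * (Kf / kap * cnorm v ^+ 2));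
    last by ring.
  apply: le_trans B; apply: ler_wpM2r; first exact: mnorm_ge0.
  by apply: lerXn2r; rewrite ?nnegrE ?cnorm_ge0 // ltW.
pose K1 := Kf / kap + (Kh + Kb * (Kf / kap)) / kap ^+ 2.
have A1 : 0 <= Kf / kap by rewrite divr_ge0 // ltW.
have A2 : 0 <= (Kh + Kb * (Kf / kap)) / kap ^+ 2 by rewrite divr_ge0 ?sqr_ge0 // addr_ge0 // mulr_ge0.
have K10 : 0 <= K1 by exact: addr_ge0.
exists (Num.min r 1), (K1 / k ^+ 2); split.
- by rewrite lt_min r0 ltr01.
- by rewrite divr_ge0 // sqr_ge0.
move=> w /andP[w0]; rewrite lt_min => /andP[wr w1].
have [v Hv Ev] := Hr w wr.
have gv : g v = w by rewrite /g Ev chart_stdpar.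
move: Hv; rewrite subr0 => Hv.
have v0 : 0 < cnorm v.
  rewrite cnorm_gt0; apply: contraTneq w0 => v0.
  by rewrite -gv v0 g0 subrr cnorm0 ltxx.
split.
  rewrite -Ev; apply: locpar_off; last by rewrite -cnorm_gt0.
  apply: sd; rewrite /disc /= subr0; move: Hv; rewrite !lt_min => /andP[/andP[vl _] _].
  exact: lt_le_trans vl rld.
move=> s; have Hk : 0 < cnorm v < rho by rewrite v0.
have [B1 B2] := key v Hk s.
rewrite gv in B1 B2.
have lw : k * cnorm v <= cnorm (w - z0).
  have := low v; rewrite gv g0 subr0; apply.
  by move: Hv; rewrite /disc /= subr0 !lt_min => /andP[/andP[]].
have lw2 : cnorm v ^+ 2 <= cnorm (w - z0) ^+ 2 / k ^+ 2.
  rewrite ler_pdivlMr ?exprn_gt0 // mulrC -exprMn; apply: lerXn2r => //; rewrite ?nnegrE ?mulr_ge0 ?cnorm_ge0 //.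
  exact: ltW.
have fin (x L : R) : 0 <= L -> L <= K1 -> x <= L * cnorm v ^+ 2 -> x <= K1 / k ^+ 2 * cnorm (w - z0) ^+ 2.
  move=> L0 LK Hx; apply: le_trans Hx _; rewrite mulrAC -mulrA; apply: ler_pM => //; exact: sqr_ge0.
split.
  by apply: fin B1 => //; rewrite lerDl.
move=> t; have L : (Kh + Kb * (Kf / kap)) / kap ^+ 2 <= K1 by rewrite lerDr.
apply: le_trans (fin _ _ A2 L (B2 t)) _; apply: ler_wpM2l.
  by rewrite divr_ge0 // sqr_ge0.
by rewrite expr2 ler_piMr ?cnorm_ge0 // ltW.
Qed.

End SphereStokes.

(** * Stokes' theorem on the sphere *)

Section SphereStokesTheorem.
Context {R : realType} {n m : nat}.
Variable a : conn_data R n m.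
Local Notation C := R[i].
Local Notation mR := (measurableTypeR R).
Local Notation mu := (@lebesgue_measure R).
Local Notation mu2 := (mu \x mu)%E.
Implicit Types (z w u v : C) (b s t : bool) (p : P1 R) (i : 'I_m).
Implicit Types (phi psi : form1 R n) (tau : P1 R -> C).

Local Notation O := (off_D a).
Local Notation c i := (locpar a i).
Local Notation rad i := (disc_rad a i).
Local Notation pt i := (Defs.point a i).

Lemma fnorm_loc U cc phi u : copen U -> holoP1_on U cc -> (forall v, U v -> dparam cc v != 0) ->
  fsmooth O phi -> U u -> O (cc u) ->
  exists2 e : R, 0 < e & exists K : R, forall v, disc u e v -> fnorm phi (cc v) <= K.
Proof.
move=> oU hc dc sphi Uu Ou.
have oP := @popen_off _ _ _ a.
have [e1 e10 [K1 H1]] := sph_loc oU hc Uu (dc u Uu).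
have oV := copen_pre oU hc oP.
have Vu : (U `&` cc @^-1` O) u by split.
have [e2 e20 [K2 H2]] := mxsmooth_locbound oV (mxsmooth_pulls false oU hc oP sphi) Vu.
have [e3 e30 [K3 H3]] := mxsmooth_locbound oV (mxsmooth_pulls true oU hc oP sphi) Vu.
have /copenP/(_ u Uu) [e4 e40 H4] := oU.
exists (Num.min (Num.min e1 e2) (Num.min e3 e4)); first by rewrite !lt_min e10 e20 e30.
exists (K1 * (K2 + K3)) => v; rewrite /disc /= !lt_min => /andP[/andP[v1 v2] /andP[v3 v4]].
have s0 : 0 < sph cc v by apply: sph_gt0; apply: dc; exact: H4.
have -> : fnorm phi (cc v) = (sph cc v)^-1 * (mnorm (pulls false cc phi v) + mnorm (pulls true cc phi v)).
  by rewrite -fnorm_pulls mulKf // gt_eqF.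
apply: ler_pM; rewrite ?addr_ge0 ?mnorm_ge0 ?invr_ge0 ?(ltW s0) //; first exact: H1.
by apply: lerD; [exact: H2 | exact: H3].
Qed.

Lemma fnorm_loc_std b phi u : fsmooth O phi -> O (stdpar b u) ->
  exists2 e : R, 0 < e & exists K : R, forall v, disc u e v -> fnorm phi (stdpar b v) <= K.
Proof.
move=> sphi Ou; apply: (fnorm_loc (U := setT)) => //.
- exact: openT.
- exact: holo_stdpar.
- by move=> v _; rewrite dparam_stdpar dstd_neq0.
Qed.

Lemma rapid_fnorm_bounded psi : fsmooth O psi -> (forall i s, rapid (pulls s (c i) psi)) ->
  exists2 K : R, 0 <= K & forall p, O p -> fnorm psi p <= K.
Proof.
move=> spsi fpsi; apply: (@sphere_bounded _ _ _ a).
  by move=> b u Ou; have [e e0 [K HK]] := fnorm_loc_std spsi Ou; exists e => //; exists K => v Hv _; exact: HK.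
move=> i; have h0 : rad i / 2 < rad i by have := disc_rad_gt0 a i; lra.
have [S S0 HS] := sph_inner h0.
have [r1 [K1 [r10 K10 H1]]] := fpsi i false 0; have [r2 [K2 [r20 K20 H2]]] := fpsi i true 0.
exists (Num.min (rad i / 2) (Num.min r1 r2)), (S * (K1 + K2)).
split; first by rewrite !lt_min divr_gt0 ?disc_rad_gt0 // r10.
move=> u; rewrite !lt_min => /and3P[uh u1 u2] Ou.
have u0 : 0 < cnorm u by rewrite cnorm_gt0; apply/eqP => u0; apply: (Ou i); rewrite u0.
have Hu : disc 0 (rad i) u by rewrite /disc /= subr0; exact: lt_trans uh h0.
have s0 : 0 < sph (c i) u by apply: sph_gt0; exact: locpar_deriv.
have -> : fnorm psi (c i u) = (sph (c i) u)^-1 * (mnorm (pulls false (c i) psi u) + mnorm (pulls true (c i) psi u)).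
  by rewrite -fnorm_pulls mulKf // gt_eqF.
have E1 := H1 u; have E2 := H2 u; rewrite u0 u1 u2 expr0 !mulr1 /= in E1 E2.
apply: ler_pM; rewrite ?addr_ge0 ?mnorm_ge0 ?invr_ge0 ?(ltW s0) //; first by apply: HS; exact: ltW.
by apply: lerD; [exact: E1 | exact: E2].
Qed.

Lemma bounded2_eq (tau1 tau2 : P1 R -> C) : (forall p, O p -> tau1 p = tau2 p) -> bounded2 a tau1 -> bounded2 a tau2.
Proof.
move=> E [N1 N2]; split=> [b|i].
  apply: csmooth_eq (@popen_off _ _ _ a b) _ (N1 b) => z Oz.
  by rewrite /pull2 E.
have [r [K [r0 H]]] := N2 i; exists (Num.min (rad i) r), K.
split; first by rewrite lt_min disc_rad_gt0.
move=> u /andP[u0]; rewrite lt_min => /andP[uh ur].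
have Hu : 0 < cnorm u < rad i by rewrite u0.
have [_ Ou] := locpar_punct Hu.
by rewrite /pull2 -E //; apply: H; rewrite u0.
Qed.

(** In the affine coordinate the coefficients are O((1 + |z|^2)^-1), as for every one-form
    bounded in the spherical metric, and they extend by zero to C^1 functions at D. *)
Theorem stokes_sphere psi : fsmooth O psi ->
  (forall i s, rapid (pulls s (c i) psi) /\ forall t, rapid (MW t (pulls s (c i) psi))) ->
  integralP1 (fun p => \tr (dform psi p)) = 0.
Proof.
move=> spsi fpsi.
have oO := @popen_off _ _ _ a false.
have gd : rapid2 a (dform psi).
  apply: rapid2_dform => // i; apply: rapidD; first exact: (fpsi i true).2.
  by apply: rapidN; exact: (fpsi i false).2.
have nd := bounded2_tr gd.
have [K1 K10 H1] := rapid_fnorm_bounded spsi (fun i s => (fpsi i s).1).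
have [K2 K20 H2] := bounded2_tnorm nd.
pose E s z : C := if `[< O (Some z) >] then \tr (pulls s (stdpar false) psi z) else 0.
have EO s z : O (Some z) -> E s z = \tr (pulls s (stdpar false) psi z) by rewrite /E => H; rewrite asboolT.
have ED s z : ~ O (Some z) -> E s z = 0 by rewrite /E => H; rewrite asboolF.
have sE s : csmooth_on (stdpar false @^-1` O) (E s).
  apply: csmooth_eq oO _ (csmooth_tr oO (spsi false s)) => z Oz.
  by rewrite EO.
have WE s t z : O (Some z) -> W t (E s) z = \tr (MW t (pulls s (stdpar false) psi) z).
  move=> Oz; rewrite -W_tr; last exact: mxsmooth_cdiff oO (spsi false s) Oz.
  by apply: (W_eq t oO Oz) => w Ow; rewrite EO.
have C1 s z : cdiff (E s) z /\ forall t, ccont (W t (E s)) z /\ (~ O (Some z) -> W t (E s) z = 0).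
  have [Oz|nOz] := pselect (O (Some z)).
    split; first exact: csmooth_cdiff oO (sE s) Oz.
    by move=> t; split=> // e e0; exact: (csmooth_cont oO (csmoothW t oO (sE s)) Oz e0).
  have [i Ei] := on_D nOz.
  have cm : pt i <> miss false by rewrite -Ei.
  have [r [K [r0 K0 B]]] := flat_affine spsi cm (fpsi i).
  have Ez : chart false (pt i) = z by rewrite -Ei.
  rewrite Ez in B.
  have [||D W0 CW] := @removable_C1 _ (E s) z r K r0 K0 (ED s z nOz).
  - move=> w Hw; have [Ow /(_ s) [B1 _]] := B w Hw.
    by rewrite EO //; apply: le_trans (mnorm_tr _) B1.
  - move=> t w Hw; have [Ow /(_ s) [_ /(_ t) B1]] := B w Hw.
    by rewrite WE //; apply: le_trans (mnorm_tr _) B1.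
  by split => // t; split=> // _; exact: W0.
have bE s z : cnorm (E s z) <= K1 / (1 + cnorm z ^+ 2).
  have d0 : 0 < 1 + cnorm z ^+ 2 by rewrite ltr_wpDr // sqr_ge0.
  have [Oz|nOz] := pselect (O (Some z)); last by rewrite ED // cnorm0 divr_ge0 // ltW.
  rewrite ler_pdivlMr // mulrC EO //; apply: le_trans (H1 _ Oz).
  rewrite /fnorm; apply: ler_wpM2l; first exact: ltW.
  apply: le_trans (mnorm_tr _) _; rewrite pulls_comp_wd mnormZ cnorm_cjs /dstd cnorm1 mul1r.
  by case: s; rewrite /comp /= ?lerDl ?lerDr mnorm_ge0.
have dE z : W false (E true) z - W true (E false) z =
    if `[< O (Some z) >] then \tr (dform psi (Some z)) else 0.
  case: asboolP => Oz; last by rewrite ((C1 true z).2 false).2 // ((C1 false z).2 true).2 // subrr.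
  by rewrite !WE //; exact/esym/raddfB.
pose tau p : C := if `[< O p >] then \tr (dform psi p) else 0.
have Et p : O p -> \tr (dform psi p) = tau p by rewrite /tau => Op; rewrite asboolT.
have ntau : bounded2 a tau := bounded2_eq Et nd.
rewrite (integralP1_eq nd ntau (fun z => Et (Some z))).
have [S1 S2] : \int[mu2]_q complex.Re (W false (E true) (toC q) - W true (E false) (toC q)) = 0 /\
  \int[mu2]_q complex.Im (W false (E true) (toC q) - W true (E false) (toC q)) = 0.
  apply: (@stokes_plane _ E (K1 + K2)).
  - by move=> s z; exact: (C1 s z).1.
  - by move=> s t z; exact: ((C1 s z).2 t).1.
  - move=> s z; apply: le_trans (bE s z) _; rewrite ler_wpM2r ?lerDl //.
    by rewrite invr_ge0 addr_ge0 // sqr_ge0.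
  - move=> z; apply: (@le_trans _ _ (K2 * wt (ofC z))); last first.
      by rewrite ler_wpM2r ?lerDr // ltW // wt_gt0.
    rewrite dE; case: asboolP => Oz; last by rewrite cnorm0 mulr_ge0 // ltW // wt_gt0.
    exact: (wt_dens K20 (H2 _ Oz)).
rewrite /integralP1.
have Eq q : tau (Some (toC q)) = W false (E true) (toC q) - W true (E false) (toC q) by rewrite dE.
under eq_Rintegral do rewrite Eq.
rewrite S1; under eq_Rintegral do rewrite Eq.
by rewrite S2 -[_ +i* _]/(0 : C) mulr0.
Qed.

End SphereStokesTheorem.

(** * Laurent expansions in the extended space *)

Section LaurentAlgebra.
Context {R : realType} {n m : nat}.
Variable a : conn_data R n m.
Local Notation C := R[i].
Local Notation M := 'M[C]_n.
Implicit Types (z w u v : C) (b s t : bool) (i : 'I_m) (h : C -> M) (l : @formal_laurent R n).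
Implicit Types (phi psi alpha : form1 R n) (x : mxfun R n).

Local Notation O := (off_D a).
Local Notation c i := (locpar a i).
Local Notation rad i := (disc_rad a i).
Local Notation ord i := (pole_ord a i).

Lemma laurent_lin (k : nat) h h' l l' (e : C) :
  laurent_expansion k h l -> laurent_expansion k h' l' ->
  laurent_expansion k (fun z => h z + e *: h' z) (fun j q => l j q + e *: l' j q).
Proof.
move=> [r [r0 [S [sS E T]]]] [r' [r'0 [S' [sS' E' T']]]].
have oD (r : R) := @copen_disc R 0 r.
have m0 : 0 < Num.min r r' by rewrite lt_min r0.
have L : disc 0 (Num.min r r') `<=` disc (0 : C) r by apply: disc_sub; rewrite ge_min lexx.
have L' : disc 0 (Num.min r r') `<=` disc (0 : C) r' by apply: disc_sub; rewrite ge_min lexx orbT.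
exists (Num.min r r'); split => //; exists (fun z => S z + e *: S' z); split.
- apply: (mxsmoothD (oD _)); first exact: mxsmooth_sub L sS.
  apply: (mxsmoothZ (oD _) (csmooth_cst _ e)); exact: mxsmooth_sub L' sS'.
- move=> z Hz; rewrite E; last exact: L.
  rewrite E'; last exact: L'.
  by rewrite scalerDr !scalerA [e * _]mulrC.
- move=> j q; rewrite T T'; case: (j + k%:Z) => [p|_]; last by rewrite scaler0 addr0.
  by rewrite taylor_lin //; apply/mxgermP; [exists r | exists r'].
Qed.

Lemma eq_laurent (k : nat) h h' l (r : R) : 0 < r -> (forall u, disc 0 r u -> h u = h' u) ->
  laurent_expansion k h l -> laurent_expansion k h' l.
Proof.
move=> r0 E [r' [r'0 [S [sS E' T]]]].
have L : disc 0 (Num.min r r') `<=` disc (0 : C) r by apply: disc_sub; rewrite ge_min lexx.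
have L' : disc 0 (Num.min r r') `<=` disc (0 : C) r' by apply: disc_sub; rewrite ge_min lexx orbT.
exists (Num.min r r'); split; first by rewrite lt_min r0.
exists S; split; [exact: mxsmooth_sub L' sS | | by []].
move=> z Hz; rewrite -E; last exact: L.
by rewrite E' //; exact: L'.
Qed.

Lemma laurentD (k : nat) h h' l : laurent_expansion k h l -> laurent_expansion k h' (@zero_series R n) ->
  laurent_expansion k (fun z => h z + h' z) l.
Proof.
move=> H H'; have := laurent_lin 1 H H'.
have -> : (fun z => h z + 1 *: h' z) = (fun z => h z + h' z) by apply/funext => z; rewrite scale1r.
suff -> : (fun j q => l j q + 1 *: @zero_series R n j q) = l by [].
by apply/funext => j; apply/funext => q; rewrite /zero_series scaler0 addr0.
Qed.

(** The value at 0 has to be prescribed, since 0^-1 = 0 makes z^-k vanish there. *)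
Lemma flat_laurent (k : nat) h (S : C -> M) (r : R) : (0 < k)%N -> 0 < r -> mxsmooth_on (disc 0 r) S ->
  mxflat S -> h 0 = 0 -> (forall u, 0 < cnorm u < r -> u ^+ k *: h u = S u) ->
  laurent_expansion k h (@zero_series R n).
Proof.
move=> k0 r0 sS fS h0 E; exists r; split => //; exists S; split => //.
  move=> u; rewrite /disc /= subr0 => ur.
  have [->|u0] := eqVneq u 0; first by rewrite h0 expr0n gtn_eqF // invr0 scale0r.
  rewrite -E ?cnorm_gt0 ?u0 // scalerA mulVf ?scale1r // expf_neq0 //.
move=> j q; rewrite /zero_series; case: (j + k%:Z) => // p.
by rewrite mxflat_taylor.
Qed.

Lemma laurent_zero_rapid (k : nat) h : laurent_expansion k h (@zero_series R n) -> rapid h.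
Proof.
move=> /laurentP[r [r0 [S [sS E T]]]]; apply: (rapid_div r0 (div_mul E)); apply: mxflat_rapid.
by apply: taylor_mxflat => //; apply/mxgermP; exists r.
Qed.

Lemma singular_of_laurent phi : fsmooth O phi -> (forall i, exists l l', L_form a i phi l l') ->
  singular_form a phi.
Proof.
move=> sphi H; split.
  by move=> b; split; [exact: (sphi b false) | exact: (sphi b true)].
move=> i; have [l [l' [[r [r0 [S [sS E _]]]] [r' [r'0 [S' [sS' E' _]]]]]]] := H i.
have L : disc 0 (Num.min r r') `<=` disc (0 : C) r by apply: disc_sub; rewrite ge_min lexx.
have L' : disc 0 (Num.min r r') `<=` disc (0 : C) r' by apply: disc_sub; rewrite ge_min lexx orbT.
exists (Num.min r r'); split; first by rewrite lt_min r0.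
exists S, S'; split; [exact: mxsmooth_sub L sS | exact: mxsmooth_sub L' sS' |].
by move=> u Hu; split; [apply: E; exact: L | apply: E'; exact: L'].
Qed.

Lemma fsmooth_lin phi psi (e : C) : fsmooth O phi -> fsmooth O psi ->
  fsmooth O (Defs.addf phi (scalef e psi)).
Proof.
move=> s1 s2 b s; have oO := @popen_off _ _ _ a b.
apply: (mxsmooth_eq oO (h := fun u => pulls s (stdpar b) phi u + e *: pulls s (stdpar b) psi u)).
  by move=> z _; rewrite pulls_addf pulls_scalef.
apply: (mxsmoothD oO (s1 b s)); apply: (mxsmoothZ oO (csmooth_cst _ e)); exact: s2.
Qed.

Lemma pulls_fundamental s cc x alpha u : pulls s cc (fundamental_field x alpha) u =
  pulls s cc alpha u *m x (cc u) - x (cc u) *m pulls s cc alpha u - pulls s cc (dfun x) u.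
Proof.
rewrite /fundamental_field /covd /oppf !(pulls_scalef, pulls_addf) pulls_rmulf pulls_lmulf !scaleN1r.
by rewrite !opprD opprK addrC.
Qed.

(** Each term of d_alpha x contains x or dx, which are flat. *)
Lemma fundamental_laurent x alpha i s : lieG1 a x -> singular_form a alpha ->
  laurent_expansion (ord i) (pulls s (c i) (fundamental_field x alpha)) (@zero_series R n).
Proof.
move=> lx sa; have sx := lx.1.
have [_ /(_ i) [r [r0 [s10 [s01 [S1 S2 E]]]]]] := sa.
have [S sS ES] : exists2 S : C -> M, mxsmooth_on (disc 0 r) S &
    forall u, disc 0 r u -> pulls s (c i) alpha u = u ^- ord i *: S u.
  by case: s; [exists s01 | exists s10] => // u Hu; have [E1 E2] := E u Hu.
have gS : mxgerm S by apply/mxgermP; exists r.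
pose X := fun u => x (c i u).
have fX : mxflat X := lieG1_flat i lx.
pose T u := S u *m X u + (- (X u *m S u)) + (- (u ^+ ord i *: MW s X u)).
have fT : mxflat T.
  apply: mxflatD; last by apply: mxflatN; apply: mxflatZ (germ_smoothX _) (mxflatMW s fX).
  by apply: mxflatD; [exact: mxflatMl | apply: mxflatN; exact: mxflatM].
have [r' r'0 sT] := (mxgermP _).1 (mxflat_germ fT).
have m0 : 0 < Num.min r' (Num.min r (rad i)) by rewrite !lt_min r'0 r0 disc_rad_gt0.
have dx u : disc 0 (rad i) u -> pulls s (c i) (dfun x) u = MW s X u.
  by move=> Hu; rewrite (dfun_pull s (@copen_disc _ _ _) (@locpar_holo _ _ _ a i) sx Hu).
apply: (flat_laurent (pole_ord_gt0 a i) m0 (S := T)) => //.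
- by apply: mxsmooth_sub sT; apply: disc_sub; rewrite ge_min lexx.
- rewrite pulls_fundamental dx; last exact: locpar0.
  by rewrite -[x _]/(X 0) (mxflat0 fX) (mxflat0 (mxflatMW s fX)) mulmx0 mul0mx !subr0.
- move=> u /andP[u0]; rewrite !lt_min => /and3P[_ ur ui].
  rewrite pulls_fundamental dx; last by rewrite /disc /= subr0.
  rewrite -[x _]/(X u) /T !scalerDr !scalerN; congr (_ - _ - _).
    by rewrite scalemxAl; congr (_ *m _); apply: div_mul ES _ _; rewrite u0.
  by rewrite scalemxAr; congr (_ *m _); apply: div_mul ES _ _; rewrite u0.
Qed.

Lemma fundamental_tangent x alpha : lieG1 a x -> extA a alpha ->
  extA_tangent a (fundamental_field x alpha).
Proof.
move=> lx ea; have sx := lx.1; have sa := ea.1.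
have salpha := singular_fsmooth sa; have L i s := fundamental_laurent i s lx sa.
have sphi : fsmooth O (fundamental_field x alpha).
  move=> b s; have oO := @popen_off _ _ _ a b.
  have sX : mxsmooth_on (stdpar b @^-1` O) (fun u => x (stdpar b u)) by exact: mxsmooth_sub (sx b).
  apply: (mxsmooth_eq oO (h := fun u => pulls s (stdpar b) alpha u *m x (stdpar b u) +
    (- (x (stdpar b u) *m pulls s (stdpar b) alpha u)) + (- MW s (fun v => x (stdpar b v)) u))).
    by move=> z _; rewrite pulls_fundamental dfun_stdpar.
  apply: (mxsmoothD oO); last by apply: (mxsmoothN oO); exact: mxsmoothMW.
  apply: (mxsmoothD oO); first exact: (mxsmoothM oO (salpha b s) sX).
  apply: (mxsmoothN oO); exact: (mxsmoothM oO sX (salpha b s)).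
have D0 : dlog_series 0 = @zero_series R n.
  by apply/funext => j; apply/funext => q; rewrite /dlog_series linear0 if_same.
split; first by apply: singular_of_laurent => // i; do 2 exists (@zero_series R n); split; [exact: (L i false) | exact: (L i true)].
move=> i; exists 0; rewrite D0; split; [exact: (L i false) | exact: (L i true)].
Qed.

(** A complex number d which is not real is at distance at least |Im d| from the integers; a
    real one lies strictly between two consecutive integers. *)
Lemma int_gap (d : C) : (forall z : int, d != z%:~R) ->
  exists2 e : R, 0 < e & forall z : int, e <= cnorm (d - z%:~R).
Proof.
move=> Hd.
have intr_re (z : int) : (z%:~R : C) = (z%:~R : R)%:C by rewrite rmorph_int.
have re (z : int) : `|complex.Re d - z%:~R| <= cnorm (d - z%:~R).
  apply: le_trans (cnorm_Re _); rewrite ReD ReN intr_re //.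
have im (z : int) : `|complex.Im d| <= cnorm (d - z%:~R).
  by apply: le_trans (cnorm_Im _); rewrite ImD ImN intr_re /= subr0.
have [i0|i0] := eqVneq (complex.Im d) 0; last first.
  by exists `|complex.Im d|; [rewrite normr_gt0 | exact: im].
set x := complex.Re d in re.
have xz (z : int) : x != z%:~R.
  have := Hd z; apply: contraNneq => E; apply/eqP/complex_ext; rewrite intr_re //=.
pose f := Num.floor x.
have f1 : f%:~R < x by rewrite lt_neqAle eq_sym xz /= floor_le_tmp.
have f2 : x < (f + 1)%:~R by rewrite floorD1_gt.
exists (Num.min (x - f%:~R) ((f + 1)%:~R - x)); first by rewrite lt_min !subr_gt0 f1.
move=> z; apply: le_trans (re z); rewrite ge_min.
have [zf|zf] := leP z f.
  have L : z%:~R <= f%:~R :> R by rewrite ler_int.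
  by rewrite ger0_norm ?lerD2l ?lerN2 ?L // subr_ge0 (le_trans L) // ltW.
have L : (f + 1)%:~R <= z%:~R :> R by rewrite ler_int lezD1.
rewrite distrC ger0_norm ?lerD2r ?L ?orbT // subr_ge0 (le_trans _ L) // ltW //.
Qed.

Lemma distinct_mod_Z_open (v w : 'rV[C]_n) : distinct_mod_Z v ->
  exists2 r : R, 0 < r & forall e, disc 0 r e -> distinct_mod_Z (v + e *: w).
Proof.
move=> Hv.
have H (ij : 'I_n * 'I_n) : exists r : R, 0 < r /\ (ij.1 != ij.2 -> forall e : C, cnorm e < r -> forall z : int,
    (v + e *: w) 0 ij.1 - (v + e *: w) 0 ij.2 != z%:~R).
  have [E|N] := eqVneq ij.1 ij.2; first by exists 1.
  have [d d0 Hd] := int_gap (Hv _ _ N).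
  have k0 : 0 < cnorm (w 0 ij.1 - w 0 ij.2) + 1 by rewrite ltr_wpDl // cnorm_ge0.
  exists (d / (cnorm (w 0 ij.1 - w 0 ij.2) + 1)); split; first exact: divr_gt0.
  move=> _ e; rewrite ltr_pdivlMr // => He z; apply/eqP => E.
  have := Hd z; rewrite leNgt => /negP; apply.
  have -> : v 0 ij.1 - v 0 ij.2 - z%:~R = - (e * (w 0 ij.1 - w 0 ij.2)).
    by rewrite -E !mxE; ring.
  rewrite cnormN cnormM; apply: le_lt_trans He; rewrite ler_wpM2l ?cnorm_ge0 // lerDl.
  exact: ler01.
have [r Hr] := choice H.
have [d d0 Hd] := finite_radius (fun ij => (Hr ij).1).
exists d => // e; rewrite /disc /= subr0 => ed j l jl z.
by apply: (Hr (j, l)).2 => //=; exact: lt_le_trans ed (Hd _).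
Qed.

(** Only the open condition on the residues at simple poles restricts e. *)
Lemma extA_line alpha phi : extA a alpha -> extA_tangent a phi ->
  exists2 r : R, 0 < r & forall e, disc 0 r e -> extA a (Defs.addf alpha (scalef e phi)).
Proof.
move=> [sa Ha] [sp Hp].
have H i : exists r : R, 0 < r /\ forall e, disc 0 r e -> exists v : 'rV[C]_n,
    (ord i = 1%N -> distinct_mod_Z v) /\ L_form a i (Defs.addf alpha (scalef e phi))
      (fun j q => germ_series a i j q + dlog_series (v - germ_residue a i) j q) (@zero_series R n).
  have [v [dv [L1 L2]]] := Ha i; have [w [K1 K2]] := Hp i.
  have [r [r0 Hr]] : exists r : R, 0 < r /\ forall e, disc 0 r e -> ord i = 1%N -> distinct_mod_Z (v + e *: w).
    have [E|N] := eqVneq (ord i) 1%N; last by exists 1; split=> // e _ E; rewrite E in N.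
    by have [r r0 Hr] := distinct_mod_Z_open w (dv E); exists r; split=> // e He _; exact: Hr.
  exists r; split => // e He; exists (v + e *: w); split; first exact: Hr.
  split.
    have -> : pull10 (c i) (Defs.addf alpha (scalef e phi)) =
        fun u => pull10 (c i) alpha u + e *: pull10 (c i) phi u.
      by apply/funext => u; rewrite -[LHS]/(pulls false _ _ _) pulls_addf pulls_scalef.
    have -> : (fun j q => germ_series a i j q + dlog_series (v + e *: w - germ_residue a i) j q) =
        fun j q => (germ_series a i j q + dlog_series (v - germ_residue a i) j q) + e *: dlog_series w j q.
      apply/funext => j; apply/funext => q; rewrite -[RHS]addrA; congr (_ + _).
      rewrite /dlog_series; case: ifP => _; last by rewrite scaler0 addr0.
      by rewrite addrAC linearD /= linearZ.
    exact: laurent_lin.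
  have -> : pull01 (c i) (Defs.addf alpha (scalef e phi)) =
      fun u => pull01 (c i) alpha u + e *: pull01 (c i) phi u.
    by apply/funext => u; rewrite -[LHS]/(pulls true _ _ _) pulls_addf pulls_scalef.
  have -> : @zero_series R n = fun j q => @zero_series R n j q + e *: @zero_series R n j q.
    by apply/funext => j; apply/funext => q; rewrite /zero_series scaler0 addr0.
  exact: laurent_lin.
have [r Hr] := choice H.
have [d d0 Hd] := finite_radius (fun i => (Hr i).1).
exists d => // e He.
have Hi i := (Hr i).2 e (lt_le_trans He (Hd i)).
split=> //; apply: singular_of_laurent.
  by apply: fsmooth_lin; exact: singular_fsmooth.
by move=> i; have [v [_ L]] := Hi i; eexists; eexists; exact: L.
Qed.

End LaurentAlgebra.

(** * The curvature pairing *)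

Section CommutativeAlgebra.

(** The algebra behind d<F(alpha), x>(phi) = Tr(phi /\ [alpha, x] - phi /\ dx) - d Tr(phi x):
    cyclicity of the trace.  Here a0, a1 and b0, b1 are the coefficients of alpha and phi,
    X0, X1 those of dx, and A, B stand for d alpha and d phi. *)
Lemma tr_curvature_algebra (K : comNzRingType) n (a0 a1 b0 b1 X0 X1 X A B : 'M[K]_n) (e : K) :
  \tr ((- (A + e *: B) + ((a0 + e *: b0) *m (a1 + e *: b1) - (a1 + e *: b1) *m (a0 + e *: b0))) *m X) =
  \tr ((- A + (a0 *m a1 - a1 *m a0)) *m X) +
  (e * (\tr (b0 *m (a1 *m X - X *m a1 - X1) - b1 *m (a0 *m X - X *m a0 - X0)) +
     -1 * \tr (B *m X - (b0 *m X1 - b1 *m X0))) + e ^+ 2 * \tr ((b0 *m b1 - b1 *m b0) *m X)).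
Proof.
have trN (T : 'M[K]_n) : \tr (- T) = - \tr T by exact: raddfN.
rewrite !(mulmxDl, mulmxDr, mulNmx, mulmxN, opprD, opprK, scalerDr, mxtraceD, trN).
rewrite -!scalemxAl -!scalemxAr -!scalemxAl !scalerA !mxtraceZ !mulmxA.
have E1 : \tr (a0 *m b1 *m X) = \tr (b1 *m X *m a0) by rewrite -mulmxA mxtrace_mulC.
have E2 : \tr (a1 *m b0 *m X) = \tr (b0 *m X *m a1) by rewrite -mulmxA mxtrace_mulC.
by rewrite E1 E2; ring.
Qed.

Lemma is_derive_quadratic (K : numFieldType) (c0 c1 c2 : K) :
  is_derive (0 : K^o) (1 : K^o) (fun e : K^o => c0 + (e * c1 + e ^+ 2 * c2) : K^o) c1.
Proof.
apply: is_derive_eq.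
by rewrite /GRing.scale /= expr2 !(mul0r, mulr0, mulr1, addr0, add0r).
Qed.

End CommutativeAlgebra.

Section CurvaturePairing.
Context {R : realType} {n m : nat}.
Variable a : conn_data R n m.
Local Notation C := R[i].
Local Notation M := 'M[C]_n.
Local Notation cj := (@conjc R).
Implicit Types (z w u v e : C) (b s t : bool) (p : P1 R) (i : 'I_m).
Implicit Types (phi psi alpha : form1 R n) (x y : mxfun R n).

Local Notation O := (off_D a).
Local Notation c i := (locpar a i).
Local Notation addf := Defs.addf.

Lemma stdpar_at p : stdpar (at_oo p) (stdcoord p) = p.
Proof. by rewrite stdcoordE stdpar_chart //; exact: at_oo_miss. Qed.

Lemma pulls_at s phi p : pulls s (stdpar (at_oo p)) phi (stdcoord p) = comp s phi p.
Proof.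
rewrite pulls_comp_wd stdpar_at.
have -> : dstd (at_oo p) (stdcoord p) = 1 by case: p => [z|] //=; rewrite /dstd eqxx.
by rewrite cjs1 scale1r.
Qed.

Lemma off_at p : O p -> O (stdpar (at_oo p) (stdcoord p)).
Proof. by rewrite stdpar_at. Qed.

Lemma fsmooth_cdiff phi p s : fsmooth O phi -> O p ->
  mxcdiff (pulls s (stdpar (at_oo p)) phi) (stdcoord p).
Proof.
move=> sphi Op; apply: mxsmooth_cdiff (@popen_off _ _ _ a _) (sphi _ s) _.
exact: off_at.
Qed.

Lemma dform_lin phi psi e p : fsmooth O phi -> fsmooth O psi -> O p ->
  dform (addf phi (scalef e psi)) p = dform phi p + e *: dform psi p.
Proof.
move=> s1 s2 Op.
have E s : pulls s (stdpar (at_oo p)) (addf phi (scalef e psi)) =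
    fun u => pulls s (stdpar (at_oo p)) phi u + e *: pulls s (stdpar (at_oo p)) psi u.
  by apply/funext => u; rewrite pulls_addf pulls_scalef.
have D s t : MW t (pulls s (stdpar (at_oo p)) (addf phi (scalef e psi))) (stdcoord p) =
    MW t (pulls s (stdpar (at_oo p)) phi) (stdcoord p) + e *: MW t (pulls s (stdpar (at_oo p)) psi) (stdcoord p).
  have d1 := fsmooth_cdiff s s1 Op; have d2 := fsmooth_cdiff s s2 Op.
  rewrite E MWD //; first by rewrite MWZc.
  by apply: mxcdiffZ d2; exact: cdiff_cst.
rewrite -![dform _ p]/(MW false (pulls true _ _) _ - MW true (pulls false _ _) _) !D scalerBr.
by rewrite opprD addrACA.
Qed.

Lemma dform_rmulf phi x p : fsmooth O phi -> smooth_P1 x -> O p ->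
  dform (rmulf phi x) p = dform phi p *m x p - wedge phi (dfun x) p.
Proof.
move=> sphi sx Op.
pose X u := x (stdpar (at_oo p) u).
have dX : mxcdiff X (stdcoord p) by exact: mxsmooth_cdiff openT (sx (at_oo p)) I.
have D s t : MW t (pulls s (stdpar (at_oo p)) (rmulf phi x)) (stdcoord p) =
    MW t (pulls s (stdpar (at_oo p)) phi) (stdcoord p) *m x p + comp s phi p *m MW t X (stdcoord p).
  have -> : pulls s (stdpar (at_oo p)) (rmulf phi x) = fun u => pulls s (stdpar (at_oo p)) phi u *m X u.
    by apply/funext => u; rewrite pulls_rmulf.
  by rewrite (MWM t (fsmooth_cdiff s sphi Op) dX) pulls_at /X stdpar_at.
rewrite -![dform _ p]/(MW false (pulls true _ _) _ - MW true (pulls false _ _) _) !D /wedge mulmxBl.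
rewrite -[(dfun x p).2]/(MW true X (stdcoord p)) -[(dfun x p).1]/(MW false X (stdcoord p)) /comp.
rewrite !opprD !opprK -!addrA; congr (_ + _); rewrite addrCA; congr (_ + _); rewrite addrC //.
Qed.

Lemma comp_fundamental s x alpha p : comp s (fundamental_field x alpha) p =
  comp s alpha p *m x p - x p *m comp s alpha p - comp s (dfun x) p.
Proof. by rewrite -!pulls_at pulls_fundamental !pulls_at stdpar_at. Qed.

Lemma tr_curvature_line alpha phi x e p : fsmooth O alpha -> fsmooth O phi -> smooth_P1 x -> O p ->
  \tr (curvature (addf alpha (scalef e phi)) p *m x p) =
  \tr (curvature alpha p *m x p) +
  (e * (\tr (wedge phi (fundamental_field x alpha) p) + -1 * \tr (dform (rmulf phi x) p)) +
   e ^+ 2 * \tr (wedge phi phi p *m x p)).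
Proof.
move=> sa sphi sx Op.
rewrite /curvature dform_lin // dform_rmulf // /wedge.
rewrite -![(fundamental_field x alpha p).1]/(comp false (fundamental_field x alpha) p).
rewrite -![(fundamental_field x alpha p).2]/(comp true (fundamental_field x alpha) p) !comp_fundamental /=.
move: (dform alpha p) (dform phi p) (alpha p) (phi p) (dfun x p) (x p).
move=> dA dP [a0 a1] [b0 b1] [X0 X1] X /=.
exact: tr_curvature_algebra.
Qed.

Lemma bounded2_curvature alpha x : extA a alpha -> smooth_P1 x ->
  bounded2 a (fun p => \tr (curvature alpha p *m x p)).
Proof.
by move=> ea sx; apply: (@bounded2_tr _ _ _ a (fun p => curvature alpha p *m x p)); apply: rapid2Mr sx _;
  apply: rapid2_curvature; exact: extA_polar.
Qed.

(** Stokes' theorem removes the exact term d Tr (phi x). *)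
Lemma pairing_line alpha phi x : extA a alpha -> extA_tangent a phi -> lieG1 a x ->
  forall e, curvature_pairing (addf alpha (scalef e phi)) x =
    curvature_pairing alpha x + (e * omega phi (fundamental_field x alpha) +
      e ^+ 2 * (twopii^-1 * integralP1 (fun p => \tr (wedge phi phi p *m x p)))).
Proof.
move=> ea tp lx e; have sx := lx.1.
have sa := singular_fsmooth ea.1; have sp := singular_fsmooth tp.1.
have pf := tangent_polar (fundamental_tangent lx ea); have pp := tangent_polar tp.
have fr i s := rmulf_flat i s tp.1 lx.
have sr := fsmooth_rmulf sx sp.
have n0 := bounded2_curvature ea sx.
have n1 : bounded2 a (fun p => \tr (wedge phi (fundamental_field x alpha) p)) := bounded2_tr (rapid2_wedge pp pf).
have n2 : bounded2 a (fun p => \tr (dform (rmulf phi x) p)).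
  apply: bounded2_tr; apply: rapid2_dform sr _ => i; apply: rapidD; first exact: (fr i true).2.
  by apply: rapidN; exact: (fr i false).2.
have n3 : bounded2 a (fun p => \tr (wedge phi phi p *m x p)).
  by apply: (@bounded2_tr _ _ _ a (fun p => wedge phi phi p *m x p)); apply: rapid2Mr sx _; exact: rapid2_wedge.
have n12 := bounded2D n1 (bounded2Z (-1) n2).
have n123 := bounded2D (bounded2Z e n12) (bounded2Z (e ^+ 2) n3).
have nn := bounded2D n0 n123.
have E p : O p -> \tr (curvature alpha p *m x p) +
  (e * (\tr (wedge phi (fundamental_field x alpha) p) + -1 * \tr (dform (rmulf phi x) p)) +
   e ^+ 2 * \tr (wedge phi phi p *m x p)) = \tr (curvature (addf alpha (scalef e phi)) p *m x p).
  by move=> Op; rewrite tr_curvature_line.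
rewrite /curvature_pairing -(integralP1_eq nn (bounded2_eq E nn) (fun z => E (Some z))).
rewrite (integralP1D n0 n123) (integralP1D (bounded2Z e n12) (bounded2Z _ n3)) !(integralP1Z _ n12) (integralP1Z _ n3).
rewrite (integralP1D n1 (bounded2Z _ n2)) (integralP1Z _ n2) (stokes_sphere sr fr) /omega.
move: (integralP1 _) (integralP1 _) (integralP1 _) twopii^-1 => I0 I1 I2 t.
by rewrite mulr0 addr0 !mulrDr ![t * (_ * _)]mulrCA.
Qed.

Lemma pairing_derive alpha phi x : extA a alpha -> extA_tangent a phi -> lieG1 a x ->
  is_derive (0 : C^o) (1 : C^o)
    (fun e : C^o => curvature_pairing (addf alpha (scalef e phi)) x : C^o)
    (omega phi (fundamental_field x alpha)).
Proof.
move=> ea tp lx.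
have -> : (fun e : C^o => curvature_pairing (addf alpha (scalef e phi)) x : C^o) =
   (fun e : C^o => curvature_pairing alpha x + (e * omega phi (fundamental_field x alpha) +
      e ^+ 2 * (twopii^-1 * integralP1 (fun p => \tr (wedge phi phi p *m x p))))).
  by apply/funext => e; exact: pairing_line.
exact: is_derive_quadratic.
Qed.

Lemma small_fun_mnorm (d : R) x : small_fun 0 d x -> forall p, mnorm (x p) <= (n * n)%:R * d.
Proof.
move=> H p; have [b [u [u1 ->]]] := unit_chart p.
apply: mnorm_le => j l; apply: ltW.
by have := H b [::] u (leqnn _) u1 j l; rewrite /mxpartials mxE /cpartials /rpart /ipart /= ofC_K; case: (x _ j l).
Qed.

(** The curvature being bounded, smallness of x in the supremum norm suffices. *)
Lemma pairing_dual alpha : extA a alpha -> lieG1_dual a (curvature_pairing alpha).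
Proof.
move=> ea; split=> [e x y lx ly|x lx eps eps0].
  have nx := bounded2_curvature ea lx.1; have ny := bounded2_curvature ea ly.1.
  rewrite /curvature_pairing.
  have -> : (fun p => \tr (curvature alpha p *m (e *: x p + y p))) =
     (fun p => e * \tr (curvature alpha p *m x p) + \tr (curvature alpha p *m y p)).
    by apply/funext => p; rewrite mulmxDr -scalemxAr mxtraceD mxtraceZ.
  by rewrite (integralP1D (bounded2Z e nx) ny) (integralP1Z _ nx); ring.
have [K K0 HK] := rapid2_norm (rapid2_curvature (extA_polar ea)).
pose L := cnorm (twopii^-1 : C) * (4 * wt_mass * (K * (n * n)%:R)).
have L0 : 0 <= L by rewrite !mulr_ge0 ?cnorm_ge0 // ?wtK_ge0 // ler0n.
have L1 : 0 < L + 1 by rewrite ltr_wpDl.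
exists 0%N, (eps / (L + 1)); first exact: divr_gt0.
move=> y ly /small_fun_mnorm B.
have nx := bounded2_curvature ea lx.1; have ny := bounded2_curvature ea ly.1.
have nyx := bounded2D ny (bounded2Z (-1) nx).
have -> : curvature_pairing alpha y - curvature_pairing alpha x =
    twopii^-1 * integralP1 (fun p => \tr (curvature alpha p *m y p) + -1 * \tr (curvature alpha p *m x p)).
  by rewrite (integralP1D ny (bounded2Z _ nx)) (integralP1Z _ nx) /curvature_pairing; ring.
have d0 : 0 <= eps / (L + 1) by rewrite divr_ge0 // ltW.
have H : cnorm (integralP1 (fun p => \tr (curvature alpha p *m y p) + -1 * \tr (curvature alpha p *m x p))) <=
    4 * wt_mass * (K * ((n * n)%:R * (eps / (L + 1)))).
  apply: (integralP1_bound nyx); first by rewrite mulr_ge0 // mulr_ge0 // ler0n.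
  move=> p Op; rewrite /tnorm.
  have -> : \tr (curvature alpha p *m y p) + -1 * \tr (curvature alpha p *m x p) =
      \tr (curvature alpha p *m (y p - x p)).
    by rewrite mulmxBr mulN1r; exact/esym/raddfB.
  apply: (@le_trans _ _ (dens p ^+ 2 * mnorm (curvature alpha p) * mnorm (y p - x p))).
    rewrite -mulrA ler_wpM2l ?sqr_ge0 //; apply: le_trans (mnorm_tr _) _; exact: mnormM.
  apply: (ler_pM _ (mnorm_ge0 _) (HK p Op) (B p)).
  by rewrite mulr_ge0 ?sqr_ge0 ?mnorm_ge0.
rewrite cnormM; apply: le_lt_trans (ler_wpM2l (cnorm_ge0 _) H) _.
have -> : cnorm (twopii^-1 : C) * (4 * wt_mass * (K * ((n * n)%:R * (eps / (L + 1))))) = L * (eps / (L + 1)).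
  by rewrite /L; ring.
rewrite mulrA ltr_pdivrMr // [L * eps]mulrC ltr_pM2l //.
by rewrite ltrDl.
Qed.

End CurvaturePairing.

(** * Gauge transformations *)

(** The algebra behind [curvature_gauge]: A is g, V its inverse, G0 and G1 its first
    derivatives, GG the mixed second derivative; P0 and P1 are the coefficients of alpha,
    Q0 and Q1 the derivatives that enter d alpha. *)
Lemma gauge_algebra (K : comNzRingType) n (A V GG G1 G0 P1 P0 Q1 Q0 : 'M[K]_n) : V *m A = 1%:M ->
  - ((G0 *m P1 + A *m Q1 + GG) *m V - (A *m P1 + G1) *m V *m G0 *m V -
     ((G1 *m P0 + A *m Q0 + GG) *m V - (A *m P0 + G0) *m V *m G1 *m V)) +
  ((A *m P0 + G0) *m V *m ((A *m P1 + G1) *m V) - (A *m P1 + G1) *m V *m ((A *m P0 + G0) *m V)) =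
  A *m (- (Q1 - Q0) + (P0 *m P1 - P1 *m P0)) *m V.
Proof.
move=> VA; have VK (B : 'M[K]_n) : B *m V *m A = B by rewrite -mulmxA VA mulmx1.
rewrite !(mulmxDl, mulmxDr, mulNmx, mulmxN, mulmxA) !VK.
move: (G0 *m P1 *m V) (A *m Q1 *m V) (GG *m V) (A *m P1 *m V *m G0 *m V) (G1 *m V *m G0 *m V)
  (G1 *m P0 *m V) (A *m Q0 *m V) (A *m P0 *m V *m G1 *m V) (G0 *m V *m G1 *m V)
  (A *m P0 *m P1 *m V) (A *m P1 *m P0 *m V) => m1 m2 m3 m4 m5 m6 m7 m8 m9 m10 m11.
by apply/matrixP => j k; rewrite !mxE; ring.
Qed.

Section Gauge.
Context {R : realType} {n m : nat}.
Variable a : conn_data R n m.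
Local Notation C := R[i].
Local Notation M := 'M[C]_n.
Implicit Types (z w u v e : C) (b s t : bool) (p : P1 R) (i : 'I_m).
Implicit Types (phi psi alpha : form1 R n) (x y g : mxfun R n).

Local Notation O := (off_D a).
Local Notation c i := (locpar a i).
Local Notation rad i := (disc_rad a i).
Local Notation ord i := (pole_ord a i).
Local Notation addf := Defs.addf.

(** Subtract the constant function 1, whose Taylor series is [one_series]. *)
Lemma one_series_flat h (l : @formal_laurent R n) : laurent_expansion 0 h l -> l = one_series ->
  mxflat (fun u : C => h u - 1%:M).
Proof.
move=> /laurentP[r [r0 [S [sS E T]]]] L.
have oD := @copen_disc R 0 r.
apply: (mxflat_eq r0 (h := fun u => S u - 1%:M)).
  by move=> z Hz; rewrite E // expr0 invr1 scale1r.
have gS : mxgerm S by apply/mxgermP; exists r.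
have g1 : mxgerm (fun=> 1%:M : M) by apply/mxgermP; exists r; [exact: r0 | exact: mxsmooth_cst].
apply: taylor_mxflat.
  apply: (mxgermD gS); apply/mxgermP; exists r; first exact: r0.
  exact: mxsmooth_cst.
move=> p q.
have -> : (fun z => S z - 1%:M) = (fun z => S z + (-1 : C) *: (fun=> 1%:M) z).
  by apply/funext => z; rewrite scaleN1r.
rewrite taylor_lin // T L /one_series subr0.
have Tc : taylor (fun=> 1%:M : M) p q = if (p == 0%N) && (q == 0%N) then 1%:M else 0.
  apply/matrixP => j k; rewrite taylorE.
  have Z f l0 : l0 != [::] -> Wword l0 (fun=> f : C) 0 = 0.
    case/lastP: l0 => // l0 s _; rewrite Wword_rcons.
    have -> : W s (fun=> f) = (fun=> 0) by apply/funext => z; rewrite W_cst.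
    exact: flat_zero.2.
  case: p => [|p]; case: q => [|q]; first by rewrite /= invr1 mul1r.
  - by rewrite Z // mulr0 mxE.
  - by rewrite Z // mulr0 mxE.
  - by rewrite Z // mulr0 mxE.
rewrite Tc {Tc}; case: p => [|p]; case: q => [|q] //=; rewrite ?scaler0 ?addr0 //.
by rewrite scaleN1r subrr.
Qed.

Lemma G1_flat g i : G1 a g -> mxflat (fun u => g (c i u) - 1%:M).
Proof. by move=> [_ _ /(_ i) H]; exact: one_series_flat H erefl. Qed.

Lemma ginv_smooth g : G1 a g -> smooth_P1 (ginv g).
Proof.
move=> [sg ug _] b; apply: (mxsmooth_inv (h := fun u => g (stdpar b u)) openT) (sg b).
by move=> z _; exact: ug.
Qed.

(** Because g^-1 - 1 = - g^-1 (g - 1). *)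
Lemma ginv_flat g i : G1 a g -> mxflat (fun u => ginv g (c i u) - 1%:M).
Proof.
move=> Gg; have [_ ug _] := Gg; have fg := G1_flat i Gg.
have sgi := mxsmooth_P1_local a i (ginv_smooth Gg).
apply: (mxflat_eq (disc_rad_gt0 a i) (h := fun u => - (ginv g (c i u) *m (g (c i u) - 1%:M)))).
  by move=> z _; rewrite mulmxBr mulmx1 /ginv mulVmx ?opprB.
apply: mxflatN; apply: mxflatMl fg; apply/mxgermP; exists (rad i) => //; exact: disc_rad_gt0.
Qed.

Lemma lieG1_Ad g x : G1 a g -> lieG1 a x -> lieG1 a (Ad (ginv g) x).
Proof.
move=> Gg lx; have [sg ug _] := Gg; have sgi := ginv_smooth Gg.
have E p : Ad (ginv g) x p = ginv g p *m x p *m g p by rewrite /Ad /ginv invmxK.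
split.
  move=> b; apply: (mxsmooth_eq openT (h := fun u => ginv g (stdpar b u) *m x (stdpar b u) *m g (stdpar b u))).
    by move=> z _; rewrite /= E.
  by apply: (mxsmoothM openT _ (sg b)); exact: (mxsmoothM openT (sgi b) (lx.1 b)).
move=> i; have fx := lieG1_flat i lx.
have s1 := mxsmooth_P1_local a i sgi; have s2 := mxsmooth_P1_local a i lx.1.
have s3 := mxsmooth_P1_local a i sg.
have oD := @copen_disc R 0 (rad i); have r0 := disc_rad_gt0 a i.
exists (rad i); split => //.
exists (fun u => ginv g (c i u) *m x (c i u) *m g (c i u)); split.
- by apply: (mxsmoothM oD _ s3); exact: mxsmoothM.
- by move=> z _; rewrite /= E expr0 invr1 scale1r.
- move=> j q; rewrite /zero_series; case: (j + 0%N%:Z) => // p.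
  rewrite mxflat_taylor //; apply: mxflatM; last by apply/mxgermP; exists (rad i).
  by apply: mxflatMl fx; apply/mxgermP; exists (rad i).
Qed.

Lemma pulls_gauge s cc g alpha u : pulls s cc (gauge g alpha) u =
  g (cc u) *m pulls s cc alpha u *m ginv g (cc u) + pulls s cc (dfun g) u *m ginv g (cc u).
Proof. by rewrite /gauge pulls_addf !pulls_rmulf pulls_lmulf. Qed.

Lemma gauge_smooth g alpha : G1 a g -> fsmooth O alpha -> fsmooth O (gauge g alpha).
Proof.
move=> Gg sa b s; have oO := @popen_off _ _ _ a b; have [sg ug _] := Gg.
have sG : mxsmooth_on (stdpar b @^-1` O) (fun u => g (stdpar b u)) by exact: mxsmooth_sub (sg b).
have sI : mxsmooth_on (stdpar b @^-1` O) (fun u => ginv g (stdpar b u)).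
  by apply: mxsmooth_sub (ginv_smooth Gg b).
apply: (mxsmooth_eq oO (h := fun u => g (stdpar b u) *m pulls s (stdpar b) alpha u *m ginv g (stdpar b u)
   + MW s (fun v => g (stdpar b v)) u *m ginv g (stdpar b u))).
  by move=> z _; rewrite pulls_gauge dfun_stdpar.
apply: (mxsmoothD oO); last by apply: (mxsmoothM oO _ sI); exact: mxsmoothMW.
by apply: (mxsmoothM oO _ sI); exact: (mxsmoothM oO sG (sa b s)).
Qed.

(** Since g - 1, g^-1 - 1 and dg are flat, g[alpha] - alpha has zero expansion at each a_i. *)
Lemma gauge_extA g alpha : G1 a g -> extA a alpha -> extA a (gauge g alpha).
Proof.
move=> Gg ea; have [sa Ha] := ea; have [sg ug _] := Gg.
have salpha := singular_fsmooth sa.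
have L i s : laurent_expansion (ord i) (fun u => pulls s (c i) (gauge g alpha) u - pulls s (c i) alpha u)
    (@zero_series R n).
  have [_ /(_ i) [r [r0 [s10 [s01 [S1 S2 E]]]]]] := sa.
  have [S sS ES] : exists2 S : C -> M, mxsmooth_on (disc 0 r) S &
      forall u, disc 0 r u -> pulls s (c i) alpha u = u ^- ord i *: S u.
    by case: s; [exists s01 | exists s10] => // u Hu; have [E1 E2] := E u Hu.
  have gS : mxgerm S by apply/mxgermP; exists r.
  pose G u := g (c i u); pose H u := ginv g (c i u).
  have fG : mxflat (fun u => G u - 1%:M) := G1_flat i Gg.
  have fH : mxflat (fun u => H u - 1%:M) := ginv_flat i Gg.
  have r1 := disc_rad_gt0 a i.
  have oD := @copen_disc R 0 (rad i).
  have sG : mxsmooth_on (disc 0 (rad i)) G := mxsmooth_P1_local a i sg.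
  have gG : mxgerm G by apply/mxgermP; exists (rad i).
  have gH : mxgerm H.
    by apply/mxgermP; exists (rad i); [exact: r1 | exact: (mxsmooth_P1_local a i (ginv_smooth Gg))].
  have fdG : mxflat (MW s G).
    apply: (mxflat_eq r1 (h := MW s (fun u => G u - 1%:M))); last exact: mxflatMW.
    move=> z Hz; have dG := mxsmooth_cdiff oD sG Hz.
    rewrite (MWD s dG (k := fun=> - 1%:M)) ?MW_cst ?addr0 // => j k; exact: cdiff_cst.
  pose T u := (G u - 1%:M) *m S u *m H u + S u *m (H u - 1%:M) + u ^+ ord i *: (MW s G u *m H u).
  have fT : mxflat T.
    apply: mxflatD; last by apply: mxflatZ (germ_smoothX _) _; exact: mxflatM fdG gH.
    by apply: mxflatD; [apply: mxflatM => //; exact: mxflatM | exact: mxflatMl].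
  have [r' r'0 sT] := (mxgermP _).1 (mxflat_germ fT).
  have m0 : 0 < Num.min r' (Num.min r (rad i)) by rewrite !lt_min r'0 r0 disc_rad_gt0.
  have dx u : disc 0 (rad i) u -> pulls s (c i) (dfun g) u = MW s G u.
    by move=> Hu; rewrite (dfun_pull s (@copen_disc _ _ _) (@locpar_holo _ _ _ a i) sg Hu).
  apply: (flat_laurent (pole_ord_gt0 a i) m0 (S := T)) => //.
  - by apply: mxsmooth_sub sT; apply: disc_sub; rewrite ge_min lexx.
  - rewrite pulls_gauge dx; last exact: locpar0.
    have G0 : g (c i 0) = 1%:M by apply/eqP; rewrite -subr_eq0; apply/eqP; exact: mxflat0 fG.
    by rewrite /ginv G0 invmx1 !mulmx1 mul1mx (mxflat0 fdG) addr0 subrr.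
  - move=> u /andP[u0]; rewrite !lt_min => /and3P[_ ur ui].
    rewrite pulls_gauge dx; last by rewrite /disc /= subr0.
    rewrite -[g _]/(G u) -[ginv g _]/(H u) /T.
    have -> : S u = u ^+ ord i *: pulls s (c i) alpha u.
      by rewrite (div_mul ES) // u0.
    rewrite !mulmxBl !mulmxBr !mul1mx !mulmx1 !scalerDr !scalerN -!(scalemxAr, scalemxAl) -!addrA.
    by congr (_ + _); rewrite addKr addrC.
have LL i s l : laurent_expansion (ord i) (pulls s (c i) alpha) l ->
    laurent_expansion (ord i) (pulls s (c i) (gauge g alpha)) l.
  move=> H; apply: (eq_laurent ltr01 _ (laurentD H (L i s))) => u _.
  by rewrite addrC subrK.
have HH i : exists v : 'rV[C]_n, (ord i = 1%N -> distinct_mod_Z v) /\ L_form a i (gauge g alpha)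
      (fun j q => germ_series a i j q + dlog_series (v - germ_residue a i) j q) (@zero_series R n).
  have [v [dv [L1 L2]]] := Ha i; exists v; split => //; split; first exact: (LL i false).
  exact: (LL i true).
split=> //; apply: singular_of_laurent; first exact: gauge_smooth.
by move=> i; have [v [_ H]] := HH i; eexists; eexists; exact: H.
Qed.

(** The second derivatives of g cancel by symmetry, the rest is [gauge_algebra]. *)
Lemma curvature_gauge g alpha p : G1 a g -> fsmooth O alpha -> O p ->
  curvature (gauge g alpha) p = g p *m curvature alpha p *m ginv g p.
Proof.
move=> Gg sa Op; have [sg ug _] := Gg.
set b := at_oo p; set z := stdcoord p.
have oO := @popen_off _ _ _ a b.
have Oz : O (stdpar b z) by exact: off_at.
pose G u := g (stdpar b u); pose P s := pulls s (stdpar b) alpha.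
have sG : mxsmooth_on setT G := sg b.
have sI : mxsmooth_on setT (fun u => invmx (G u)) := ginv_smooth Gg b.
have dG : mxcdiff G z := mxsmooth_cdiff openT sG I.
have dI : mxcdiff (fun u => invmx (G u)) z := mxsmooth_cdiff openT sI I.
have dP s : mxcdiff (P s) z := mxsmooth_cdiff oO (sa b s) Oz.
have dMG t : mxcdiff (MW t G) z := mxsmooth_cdiff openT (mxsmoothMW t openT sG) I.
have EP s : pulls s (stdpar b) (gauge g alpha) = fun u => (G u *m P s u + MW s G u) *m invmx (G u).
  by apply/funext => u; rewrite pulls_gauge dfun_stdpar // mulmxDl.
have EI t : MW t (fun u => invmx (G u)) z = - (invmx (G z) *m MW t G z *m invmx (G z)).
  by apply: (MW_inv t openT _ sG I) => w _; exact: ug.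
have D s t : MW t (pulls s (stdpar b) (gauge g alpha)) z =
    (MW t G z *m P s z + G z *m MW t (P s) z + MW t (MW s G) z) *m invmx (G z) -
    (G z *m P s z + MW s G z) *m invmx (G z) *m MW t G z *m invmx (G z).
  rewrite EP (MWM t (mxcdiffD (mxcdiffM dG (dP s)) (dMG s)) dI) (MWD t (mxcdiffM dG (dP s)) (dMG s)).
  by rewrite (MWM t dG (dP s)) EI mulmxN !mulmxA.
have Ep q : curvature q p = - (MW false (pulls true (stdpar b) q) z - MW true (pulls false (stdpar b) q) z)
   + (pulls false (stdpar b) q z *m pulls true (stdpar b) q z - pulls true (stdpar b) q z *m pulls false (stdpar b) q z).
  by rewrite !pulls_at.
have gp : g p = G z by rewrite /G stdpar_at.
have Gu : G z \in unitmx by exact: ug.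
rewrite !Ep !D !EP /ginv gp -/(P false) -/(P true) (MW_swap false true openT sG I).
move: (MW _ (MW _ _) z) (MW true G z) (MW false G z) (P true z) (P false z) (MW false (P true) z) (MW true (P false) z) (G z) Gu.
move=> GG G1 G0 P1 P0 Q1 Q0 K uK.
exact: gauge_algebra (mulVmx uK).
Qed.

Lemma pairing_equivariant g alpha x : G1 a g -> extA a alpha -> lieG1 a x ->
  curvature_pairing (gauge g alpha) x = coAd g (curvature_pairing alpha) x.
Proof.
move=> Gg ea lx; have [sg ug _] := Gg.
rewrite /coAd /curvature_pairing; congr (_ * _).
have lA := lieG1_Ad Gg lx.
apply: (integralP1_eq (bounded2_curvature (gauge_extA Gg ea) lx.1) (bounded2_curvature ea lA.1)) => z Oz.
rewrite (curvature_gauge Gg (singular_fsmooth ea.1) Oz) /Ad /ginv invmxK.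
by rewrite -!mulmxA mxtrace_mulC -!mulmxA.
Qed.

End Gauge.

(** * Continuity of the differential *)

Section Continuity.
Context {R : realType} {n m : nat}.
Variable a : conn_data R n m.
Local Notation C := R[i].
Local Notation M := 'M[C]_n.
Implicit Types (z w u v e : C) (b s : bool) (p : P1 R) (i : 'I_m).
Implicit Types (phi psi chi alpha beta : form1 R n) (x y : mxfun R n).

Local Notation O := (off_D a).
Local Notation c i := (locpar a i).
Local Notation rad i := (disc_rad a i).
Local Notation ord i := (pole_ord a i).
Local Notation addf := Defs.addf.
Local Notation oppf := Defs.oppf.

Definition outside p := forall i v, disc 0 (rad i / 2) v -> c i v <> p.

(** The values t of the function equal to |z_i|^k_i on the disc of radius rad i / 2 around
    a_i and to 1 off these discs.  A relation rather than a function: both values are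
    allowed on the boundary circles. *)
Definition weight p (t : R) :=
  (exists i u, [/\ 0 < cnorm u, cnorm u <= rad i / 2, p = c i u & t = cnorm u ^+ ord i]) \/
  (outside p /\ t = 1).

Lemma weight_exists p : O p -> exists2 t : R, 0 < t & weight p t.
Proof.
move=> Op.
have [[i [u [ur up]]]|H] := pselect (exists i u, disc 0 (rad i / 2) u /\ c i u = p).
  have u0 : 0 < cnorm u.
    by rewrite cnorm_gt0; apply/eqP => u0; apply: (Op i); rewrite -up u0.
  exists (cnorm u ^+ ord i); first by rewrite exprn_gt0.
  left; exists i, u; split=> //; move: ur; rewrite /disc /= subr0; exact: ltW.
exists 1 => //; right; split=> // i v Hv Ev; apply: H; exists i, v; split=> //.
Qed.

Lemma half_disc i u : cnorm u <= rad i / 2 -> disc 0 (rad i) u.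
Proof.
rewrite /disc /= subr0 => H; apply: le_lt_trans H _.
by have := disc_rad_gt0 a i; lra.
Qed.

(** By compactness of each closed half disc, in its own coordinate, and of the complement of
    these discs in the sphere. *)
Lemma weighted_bound (q : P1 R -> R) (j l : nat) : (forall p, 0 <= q p) ->
  (forall b u, O (stdpar b u) -> exists2 e : R, 0 < e & exists K : R, forall v, disc u e v -> q (stdpar b v) <= K) ->
  (forall i u, 0 < cnorm u < rad i -> exists2 e : R, 0 < e & exists K : R, forall v, disc u e v -> q (c i v) <= K) ->
  (forall i, exists r K : R, [/\ 0 < r, 0 <= K & forall u, 0 < cnorm u < r ->
     q (c i u) * cnorm u ^+ (ord i * j) <= K * cnorm u ^+ (ord i * l)]) ->
  exists2 K : R, 0 <= K & forall p t, 0 < t -> weight p t -> q p * t ^+ j <= K * t ^+ l.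
Proof.
move=> q0 H1 H2 H3.
have [K K0 HK] : exists2 K : R, 0 <= K & forall p, outside p -> q p <= K.
  apply: (@sphere_bounded _ _ _ a).
    by move=> b u Ou; have [e e0 [K HK]] := H1 b u Ou; exists e => //; exists K => v Hv _; exact: HK.
  move=> i; exists (rad i / 2), 0; split; first by rewrite divr_gt0 // disc_rad_gt0.
  by move=> u ur Ho; exfalso; apply: (Ho i u) => //; rewrite /disc /= subr0.
have L i : exists K : R, 0 <= K /\ forall u, 0 < cnorm u -> cnorm u <= rad i / 2 ->
    q (c i u) * cnorm u ^+ (ord i * j) <= K * cnorm u ^+ (ord i * l).
  suff [K' K'0 HK'] : exists2 K : R, 0 <= K & forall u, cnorm u <= rad i / 2 -> (u != 0) ->
      q (c i u) * cnorm u ^+ (ord i * j) / cnorm u ^+ (ord i * l) <= K.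
    exists K'; split => // u u0 ur; rewrite -ler_pdivrMr ?exprn_gt0 //.
    by apply: HK' => //; rewrite -cnorm_gt0.
  apply: (@loc_bounded R (fun u => q (c i u) * cnorm u ^+ (ord i * j) / cnorm u ^+ (ord i * l))
    [set u | u != 0]) => u ur.
  have [u0|u0] := eqVneq u 0.
    have [r [K' [r0 K'0 B]]] := H3 i; exists r => //; exists K' => v; rewrite u0 /disc /= subr0 => vr v0.
    rewrite ler_pdivrMr ?exprn_gt0 ?cnorm_gt0 //; apply: B; by rewrite cnorm_gt0 v0.
  have un : 0 < cnorm u by rewrite cnorm_gt0.
  have [] := H2 i u.
    by rewrite un; move: (half_disc ur); rewrite /disc /= subr0.
  move=> e e0 [K' HK']; exists (Num.min e (cnorm u / 2)); first by rewrite lt_min e0 divr_gt0.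
  exists (K' * (cnorm u + cnorm u) ^+ (ord i * j) / (cnorm u / 2) ^+ (ord i * l)) => v.
  rewrite /disc /= lt_min => /andP[ve vu] v0.
  have V1 : cnorm v <= cnorm u + cnorm u.
    have := cnormD (v - u) u; rewrite subrK.
    move: vu un; move: (cnorm _) (cnorm _) (cnorm _) => *; lra.
  have V2 : cnorm u / 2 <= cnorm v.
    have := cnormB v (v - u); have -> : v - (v - u) = u by ring.
    move: vu un; move: (cnorm _) (cnorm _) (cnorm _) => *; lra.
  have p2 : 0 < cnorm u / 2 by rewrite divr_gt0.
  apply: ler_pM.
  - by rewrite mulr_ge0 ?exprn_ge0 ?cnorm_ge0.
  - by rewrite invr_ge0 exprn_ge0 ?cnorm_ge0.
  - apply: ler_pM => //; rewrite ?exprn_ge0 ?cnorm_ge0 //; first exact: HK'.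
    by apply: lerXn2r; rewrite ?nnegrE ?addr_ge0 ?cnorm_ge0.
  - rewrite lef_pV2 ?posrE ?exprn_gt0 ?cnorm_gt0 //.
    by apply: lerXn2r; rewrite ?nnegrE ?cnorm_ge0 // ltW.
have [k Hk] := choice L.
have k0 : 0 <= \sum_i k i by apply: sumr_ge0 => i _; exact: (Hk i).1.
exists (K + \sum_i k i); first exact: addr_ge0.
move=> p t t0 [[i [u [u0 ur -> ->]]]|[Ho ->]].
  rewrite -!exprM; apply: le_trans ((Hk i).2 u u0 ur) _.
  rewrite ler_wpM2r ?exprn_ge0 ?cnorm_ge0 // (bigD1 i) //= addrCA lerDl addr_ge0 //.
  by apply: sumr_ge0 => i' _; exact: (Hk i').1.
rewrite !expr1n !mulr1; apply: le_trans (HK p Ho) _.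
by rewrite lerDl.
Qed.

Lemma fnorm_loc_par i phi u : fsmooth O phi -> 0 < cnorm u < rad i ->
  exists2 e : R, 0 < e & exists K : R, forall v, disc u e v -> fnorm phi (c i v) <= K.
Proof.
move=> sphi /locpar_punct[Hu Ou].
apply: (fnorm_loc (@copen_disc _ _ _) (@locpar_holo _ _ _ a i) _ sphi Hu Ou).
by move=> v Hv; exact: locpar_deriv.
Qed.

Lemma fnorm_par i phi u : 0 < cnorm u < rad i -> fnorm phi (c i u) =
  (sph (c i) u)^-1 * (mnorm (pulls false (c i) phi u) + mnorm (pulls true (c i) phi u)).
Proof.
move=> /locpar_punct[Hu Ou]; rewrite -fnorm_pulls mulKf // gt_eqF //.
by apply: sph_gt0; exact: locpar_deriv.
Qed.

Lemma half_lt i : rad i / 2 < rad i.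
Proof. by have := disc_rad_gt0 a i; lra. Qed.

Lemma fnorm_weighted phi (j l : nat) : fsmooth O phi ->
  (forall i s, exists r K : R, [/\ 0 < r, 0 <= K & forall u, 0 < cnorm u < r ->
     mnorm (pulls s (c i) phi u) * cnorm u ^+ (ord i * j) <= K * cnorm u ^+ (ord i * l)]) ->
  exists2 K : R, 0 <= K & forall p t, 0 < t -> weight p t -> fnorm phi p * t ^+ j <= K * t ^+ l.
Proof.
move=> sphi H; apply: weighted_bound.
- exact: fnorm_ge0.
- by move=> b u; exact: fnorm_loc_std.
- by move=> i u; exact: fnorm_loc_par.
move=> i; have [S S0 HS] := sph_inner (half_lt i).
have [r [K [r0 K0 B]]] : exists r K : R, [/\ 0 < r, 0 <= K & forall s u, 0 < cnorm u < r ->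
    mnorm (pulls s (c i) phi u) * cnorm u ^+ (ord i * j) <= K * cnorm u ^+ (ord i * l)].
  by apply: uniform_near => s; exact: H.
have h0 : 0 < rad i / 2 by rewrite divr_gt0 // disc_rad_gt0.
exists (Num.min r (rad i / 2)), (S * (K + K)); split; rewrite ?lt_min ?r0 ?mulr_ge0 ?addr_ge0 //.
move=> u /andP[u0]; rewrite lt_min => /andP[ur uh].
have Bf := B false u; have Bt := B true u; rewrite u0 ur /= in Bf Bt.
rewrite fnorm_par; last by rewrite u0 (lt_trans uh) // half_lt.
rewrite -!mulrA; apply: ler_pM.
- by rewrite invr_ge0 sph_ge0.
- by rewrite mulr_ge0 ?exprn_ge0 ?cnorm_ge0 // addr_ge0 ?mnorm_ge0.
- by apply: HS; exact: ltW.
by rewrite mulrDl mulrDl; apply: lerD; [exact: Bf | exact: Bt].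
Qed.

Lemma singular_weighted phi : singular_form a phi ->
  exists2 K : R, 0 <= K & forall p t, 0 < t -> weight p t -> fnorm phi p * t <= K.
Proof.
move=> sphi.
have [K K0 HK] : exists2 K : R, 0 <= K & forall p t, 0 < t -> weight p t -> fnorm phi p * t ^+ 1 <= K * t ^+ 0.
  apply: fnorm_weighted; first exact: singular_fsmooth.
  move=> i s; have [_ /(_ i) [r [r0 [s10 [s01 [S1 S2 E]]]]]] := sphi.
  have [S sS ES] : exists2 S : C -> M, mxsmooth_on (disc 0 r) S &
      forall u, disc 0 r u -> pulls s (c i) phi u = u ^- ord i *: S u.
    by case: s; [exists s01 | exists s10] => // u Hu; have [E1 E2] := E u Hu.
  have [d [K [d0 K0 B]]] := mxsmooth_bounded r0 sS.
  exists (Num.min r d), K; split; rewrite ?lt_min ?r0 //.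
  move=> u /andP[u0]; rewrite lt_min => /andP[ur ud].
  have := div_mul ES (u := u); rewrite u0 ur => /(_ isT) E1.
  by rewrite muln1 muln0 expr0 mulr1 mulrC -cnormX -mnormZ E1; exact: B.
by exists K => // p t t0 Ht; have := HK p t t0 Ht; rewrite expr1 expr0 mulr1.
Qed.

Lemma flat_weighted phi : fsmooth O phi -> (forall i s, rapid (pulls s (c i) phi)) ->
  exists2 K : R, 0 <= K & forall p t, 0 < t -> weight p t -> fnorm phi p <= K * t.
Proof.
move=> sphi fphi.
have [K K0 HK] : exists2 K : R, 0 <= K & forall p t, 0 < t -> weight p t -> fnorm phi p * t ^+ 0 <= K * t ^+ 1.
  apply: fnorm_weighted => // i s; have [r [K [r0 K0 B]]] := fphi i s (ord i * 1)%N.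
  by exists r, K; split => // u ur; rewrite muln0 expr0 mulr1; exact: B.
by exists K => // p t t0 Ht; have := HK p t t0 Ht; rewrite expr1 expr0 mulr1.
Qed.

Lemma lieG1_weighted x : lieG1 a x ->
  exists2 K : R, 0 <= K & forall p t, 0 < t -> weight p t -> mnorm (x p) <= K * t ^+ 2.
Proof.
move=> lx.
have [K K0 HK] : exists2 K : R, 0 <= K & forall p t, 0 < t -> weight p t -> mnorm (x p) * t ^+ 0 <= K * t ^+ 2.
  apply: (weighted_bound (q := fun p => mnorm (x p))).
  - by move=> p; exact: mnorm_ge0.
  - by move=> b u _; exact: mxsmooth_locbound openT (lx.1 b) I.
  - move=> i u /andP[_ ur]; apply: (mxsmooth_locbound (@copen_disc R 0 (rad i)) (mxsmooth_P1_local a i lx.1)).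
    by rewrite /disc /= subr0.
  - move=> i; have [r [K [r0 K0 B]]] := mxflat_rapid (lieG1_flat i lx) (ord i * 2)%N.
    by exists r, K; split => // u ur; rewrite muln0 expr0 mulr1; exact: B.
by exists K => // p t t0 Ht; have := HK p t t0 Ht; rewrite expr0 mulr1.
Qed.

Lemma mxpartials0_lt (h : C -> M) u j l (d : R) :
  cnorm (mxpartials [::] h u j l) < d -> cnorm (h u j l) < d.
Proof. by rewrite /mxpartials mxE /cpartials /rpart /ipart /= ofC_K; case: (h u j l). Qed.

Lemma small_form_weighted : exists2 K : R, 0 <= K & forall phi (d : R), 0 <= d -> small_form a 0 d phi ->
  forall p t, 0 < t -> weight p t -> fnorm phi p * t <= K * d.
Proof.
have [k Hk] : exists k : 'I_m -> R, forall i, 0 <= k i /\ forall u, cnorm u <= rad i / 2 -> (sph (c i) u)^-1 <= k i.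
  have H i : exists k : R, 0 <= k /\ forall u, cnorm u <= rad i / 2 -> (sph (c i) u)^-1 <= k.
    by have [k k0 Hk] := sph_inner (half_lt i); exists k.
  by have [k Hk] := choice H; exists k.
have k0 : 0 <= \sum_i k i by apply: sumr_ge0 => i _; exact: (Hk i).1.
have N0 : 0 <= (n * n)%:R :> R by exact: ler0n.
exists ((2 + \sum_i k i) * ((n * n)%:R + (n * n)%:R)); first by rewrite mulr_ge0 ?addr_ge0.
move=> phi d d0 [S1 S2] p t t0 [[i [u [u0 ur -> ->]]]|[Ho ->]].
  have B s : mnorm (u ^+ ord i *: pulls s (c i) phi u) <= (n * n)%:R * d.
    apply: mnorm_le => j l; apply: ltW.
    have := S1 i [::] u (leqnn _) _ j l; rewrite u0 ur => /(_ isT) [].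
    by case: s => E0 E1; [exact: mxpartials0_lt E1 | exact: mxpartials0_lt E0].
  rewrite fnorm_par; last by rewrite u0 (le_lt_trans ur) // half_lt.
  rewrite -!mulrA; apply: ler_pM.
  - by rewrite invr_ge0 sph_ge0.
  - by rewrite mulr_ge0 ?exprn_ge0 ?cnorm_ge0 // addr_ge0 ?mnorm_ge0.
  - apply: le_trans ((Hk i).2 u ur) _; rewrite (bigD1 i) //= addrCA lerDl addr_ge0 //.
    by apply: sumr_ge0 => i' _; exact: (Hk i').1.
  have B' s : mnorm (pulls s (c i) phi u) * cnorm u ^+ ord i <= (n * n)%:R * d.
    by rewrite mulrC -cnormX -mnormZ.
  by rewrite mulrDl [leRHS]mulrDl; apply: lerD; exact: B'.
have [b [u [u1 Ep]]] := unit_chart p.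
have B s : mnorm (pulls s (stdpar b) phi u) <= (n * n)%:R * d.
  apply: mnorm_le => j l; apply: ltW.
  have Hu k' v : disc 0 (rad k' / 2) v -> c k' v <> stdpar b u by rewrite -Ep; exact: Ho.
  have [] := S2 b [::] u (leqnn _) u1 Hu j l.
  by case: s => E0 E1; [exact: mxpartials0_lt E1 | exact: mxpartials0_lt E0].
have s0 : 0 < sph (stdpar b) u by apply: sph_gt0; rewrite dparam_stdpar dstd_neq0.
have -> : fnorm phi p = (sph (stdpar b) u)^-1 * (mnorm (pulls false (stdpar b) phi u) + mnorm (pulls true (stdpar b) phi u)).
  by rewrite -fnorm_pulls -Ep mulKf // gt_eqF.
rewrite mulr1 -!mulrA; apply: ler_pM.
- by rewrite invr_ge0 ltW.
- by rewrite addr_ge0 ?mnorm_ge0.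
- rewrite sph_stdpar invrK; have : cnorm u ^+ 2 <= 1 by rewrite exprn_ile1 ?cnorm_ge0.
  by move: k0; move: (cnorm u ^+ 2) (\sum_i k i) => *; lra.
by rewrite mulrDl; apply: lerD; exact: B.
Qed.

Lemma tnorm_wedge phi chi p : tnorm (fun p => \tr (wedge phi chi p)) p <= fnorm phi p * fnorm chi p.
Proof.
rewrite /tnorm /fnorm expr2 mulrACA ler_wpM2l ?mulr_ge0 ?(ltW (dens_gt0 _)) //.
apply: le_trans (mnorm_tr _) _; apply: le_trans (mnormB _ _) _.
apply: le_trans (lerD (mnormM _ _) (mnormM _ _)) _.
have := mnorm_ge0 (phi p).1; have := mnorm_ge0 (phi p).2; have := mnorm_ge0 (chi p).1; have := mnorm_ge0 (chi p).2.
move: (mnorm _) (mnorm _) (mnorm _) (mnorm _) => *; nra.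
Qed.

Lemma fnormD phi psi p : fnorm (addf phi psi) p <= fnorm phi p + fnorm psi p.
Proof.
rewrite /fnorm -mulrDr ler_wpM2l ?(ltW (dens_gt0 _)) //.
by rewrite addrACA; apply: lerD; exact: mnormD.
Qed.

Lemma comp_sub s phi psi p : comp s (addf phi (oppf psi)) p = comp s phi p - comp s psi p.
Proof. by case: s; rewrite /comp /= scaleN1r. Qed.

Lemma fnorm_fundamental x alpha beta p :
  fnorm (addf (fundamental_field x beta) (oppf (fundamental_field x alpha))) p <=
  fnorm (addf beta (oppf alpha)) p * (mnorm (x p) + mnorm (x p)).
Proof.
rewrite /fnorm -mulrA ler_wpM2l ?(ltW (dens_gt0 _)) // mulrDl.
have E s : comp s (addf (fundamental_field x beta) (oppf (fundamental_field x alpha))) p =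
   comp s (addf beta (oppf alpha)) p *m x p - x p *m comp s (addf beta (oppf alpha)) p.
  rewrite !comp_sub !comp_fundamental mulmxBl mulmxBr.
  move: (comp s beta p *m x p) (comp s alpha p *m x p) (x p *m comp s beta p) (x p *m comp s alpha p)
    (comp s (dfun x) p) => A B D F G.
  by apply/matrixP => j l; rewrite !mxE; ring.
have H s : mnorm (comp s (addf (fundamental_field x beta) (oppf (fundamental_field x alpha))) p) <=
    mnorm (comp s (addf beta (oppf alpha)) p) * (mnorm (x p) + mnorm (x p)).
  rewrite E mulrDr; apply: le_trans (mnormB _ _) _; apply: lerD; first exact: mnormM.
  by rewrite mulrC; exact: mnormM.
by apply: lerD; [exact: (H false) | exact: (H true)].
Qed.

Lemma tr_wedge_sub phi psi chi rho p : \tr (wedge psi rho p) + -1 * \tr (wedge phi chi p) =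
  \tr (wedge (addf psi (oppf phi)) chi p) + \tr (wedge psi (addf rho (oppf chi)) p).
Proof.
have alg (K : comNzRingType) (f0 f1 g0 g1 c0 c1 d0 d1 : 'M[K]_n) :
    \tr (g0 *m d1 - g1 *m d0) + -1 * \tr (f0 *m c1 - f1 *m c0) =
    \tr ((g0 - f0) *m c1 - (g1 - f1) *m c0) + \tr (g0 *m (d1 - c1) - g1 *m (d0 - c0)).
  have trN (A : 'M[K]_n) : \tr (- A) = - \tr A by exact: raddfN.
  by rewrite !(mulmxDl, mulmxDr, mulNmx, mulmxN, opprD, opprK, mxtraceD, trN); ring.
by rewrite /wedge /= !scaleN1r alg.
Qed.

(** Write X_alpha for the fundamental field of x at alpha.  The difference equals
    omega (psi - phi, X_alpha) + omega (psi, X_beta - X_alpha), where X_beta - X_alpha is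
    [beta - alpha, x]; the flat factors X_alpha and x cancel the weights of the other ones. *)
Lemma omega_continuous x alpha phi : lieG1 a x -> extA a alpha -> extA_tangent a phi ->
  forall e : R, 0 < e -> exists N, exists2 d : R, 0 < d &
    forall beta psi, extA a beta -> extA_tangent a psi ->
      small_form a N d (addf beta (oppf alpha)) -> small_form a N d (addf psi (oppf phi)) ->
      cnorm (omega psi (fundamental_field x beta) - omega phi (fundamental_field x alpha)) < e.
Proof.
move=> lx ea tp eps eps0.
have tf := fundamental_tangent lx ea.
have [K1 K10 B1] := small_form_weighted.
have [K2 K20 B2] := singular_weighted tp.1.
have [K3 K30 B3] := flat_weighted (singular_fsmooth tf.1)
  (fun i s => laurent_zero_rapid (fundamental_laurent i s lx ea.1)).
have [K4 K40 B4] := lieG1_weighted lx.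
pose L := cnorm (twopii^-1 : C) * (4 * wt_mass * (K1 * K3 + (K2 + K1) * K1 * (K4 + K4))).
have L0 : 0 <= L.
  by rewrite !mulr_ge0 ?cnorm_ge0 ?wtK_ge0 // !addr_ge0 ?mulr_ge0 ?addr_ge0.
have L1 : 0 < L + 1 by rewrite ltr_wpDl.
(* d <= 1 bounds psi in terms of phi alone. *)
pose d := Num.min 1 (eps / (L + 1)).
have d0 : 0 < d by rewrite lt_min ltr01 divr_gt0.
have d1 : d <= 1 by rewrite ge_min lexx.
exists 0%N, d => // beta psi eb tpsi Sa Sp.
have tg := fundamental_tangent lx eb.
have n1 : bounded2 a (fun p => \tr (wedge psi (fundamental_field x beta) p)) :=
  bounded2_tr (rapid2_wedge (tangent_polar tpsi) (tangent_polar tg)).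
have n2 : bounded2 a (fun p => \tr (wedge phi (fundamental_field x alpha) p)) :=
  bounded2_tr (rapid2_wedge (tangent_polar tp) (tangent_polar tf)).
have -> : omega psi (fundamental_field x beta) - omega phi (fundamental_field x alpha) =
   twopii^-1 * integralP1 (fun p => \tr (wedge psi (fundamental_field x beta) p) +
      -1 * \tr (wedge phi (fundamental_field x alpha) p)).
  by rewrite (integralP1D n1 (bounded2Z _ n2)) (integralP1Z _ n2) /omega mulN1r mulrBr.
have H : cnorm (integralP1 (fun p => \tr (wedge psi (fundamental_field x beta) p) +
      -1 * \tr (wedge phi (fundamental_field x alpha) p))) <=
   4 * wt_mass * ((K1 * K3 + (K2 + K1) * K1 * (K4 + K4)) * d).
  apply: (integralP1_bound (bounded2D n1 (bounded2Z (-1) n2))).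
    by rewrite mulr_ge0 ?(ltW d0) // !addr_ge0 ?mulr_ge0 ?addr_ge0.
  move=> p Op; have [t t0 Ht] := weight_exists Op.
  rewrite /tnorm tr_wedge_sub.
  apply: (@le_trans _ _ (tnorm (fun p => \tr (wedge (addf psi (oppf phi)) (fundamental_field x alpha) p)) p +
    tnorm (fun p => \tr (wedge psi (addf (fundamental_field x beta) (oppf (fundamental_field x alpha))) p)) p)).
    by rewrite /tnorm -mulrDr ler_wpM2l ?sqr_ge0 //; exact: cnormD.
  apply: le_trans (lerD (tnorm_wedge _ _ _) (tnorm_wedge _ _ _)) _.
  have A1 := B1 _ _ (ltW d0) Sp p t t0 Ht; have A1' := B1 _ _ (ltW d0) Sa p t t0 Ht.
  have A2 := B2 p t t0 Ht; have A3 := B3 p t t0 Ht; have A4 := B4 p t t0 Ht.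
  have A5 := fnorm_fundamental x alpha beta p.
  have A6 : fnorm psi p <= fnorm phi p + fnorm (addf psi (oppf phi)) p.
    apply: le_trans (fnormD _ _ _); rewrite /fnorm /addf /oppf /scalef /= !scaleN1r.
    by rewrite ![(phi p).1 + _]addrC ![(phi p).2 + _]addrC !subrK.
  have := fnorm_ge0 phi p; have := fnorm_ge0 psi p; have := fnorm_ge0 (addf psi (oppf phi)) p.
  have := fnorm_ge0 (addf beta (oppf alpha)) p; have := mnorm_ge0 (x p).
  move: A1 A1' A2 A3 A4 A5 A6.
  move: (fnorm (addf psi _) p) (fnorm (addf beta _) p) (fnorm phi p) (fnorm (fundamental_field x alpha) p)
    (mnorm (x p)) (fnorm (addf (fundamental_field _ _) _) p) (fnorm psi p) => P' A' P F X G Q.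
  move=> A1 A1' A2 A3 A4 A5 A6 X0 A'0 P'0 Q0 P0.
  rewrite mulrDl; apply: lerD.
    apply: (@le_trans _ _ (P' * (K3 * t))); first exact: ler_wpM2l.
    rewrite mulrCA [K1 * K3]mulrC -mulrA; exact: ler_wpM2l.
  have G1 : G <= A' * ((K4 + K4) * t ^+ 2).
    by apply: le_trans A5 _; rewrite ler_wpM2l // mulrDl lerD.
  apply: (@le_trans _ _ ((P + P') * (A' * ((K4 + K4) * t ^+ 2)))).
    apply: (@le_trans _ _ (Q * (A' * ((K4 + K4) * t ^+ 2)))); first exact: ler_wpM2l.
    by apply: ler_wpM2r => //; rewrite !mulr_ge0 ?addr_ge0 ?exprn_ge0 // ltW.
  have -> : (P + P') * (A' * ((K4 + K4) * t ^+ 2)) = ((P * t + P' * t) * (A' * t)) * (K4 + K4) by ring.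
  rewrite [leRHS]mulrAC; apply: ler_wpM2r; first exact: addr_ge0.
  rewrite -mulrA; apply: ler_pM => //.
  - by rewrite addr_ge0 // mulr_ge0 // ltW.
  - by rewrite mulr_ge0 // ltW.
  - apply: lerD => //; apply: le_trans A1 _; by rewrite ler_piMr.
rewrite cnormM; apply: le_lt_trans (ler_wpM2l (cnorm_ge0 _) H) _.
have -> : cnorm (twopii^-1 : C) * (4 * wt_mass * ((K1 * K3 + (K2 + K1) * K1 * (K4 + K4)) * d)) = L * d.
  by rewrite /L; ring.
have : d <= eps / (L + 1) by rewrite ge_min lexx orbT.
rewrite ler_pdivlMr // mulrDr mulr1 mulrC => Hd.
by apply: lt_le_trans Hd; rewrite ltrDl.
Qed.

End Continuity.

(** * The moment map *)

Theorem proposition5p4 (R : realType) (n m : nat) (a : conn_data R n m) :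
  equivariant_moment_map a (@curvature_pairing R n).
Proof.
split; first exact: pairing_dual.
  move=> x lx; split; first by move=> alpha ea; exact: fundamental_tangent.
  split; last by move=> alpha phi ea tp; exact: omega_continuous.
  by move=> alpha phi ea tp; split; [exact: extA_line | exact: (pairing_derive ea tp lx)].
move=> g alpha Gg ea; split; first exact: gauge_extA.
by move=> x lx; split; [exact: lieG1_Ad | exact: (pairing_equivariant Gg ea lx)].
Qed.
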